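(* Let $F$ and $\Omega\subseteq\mathbb{C}^2$ be as described in the context. Then there exists a biholomorphic map $\Psi:\Omega\to\mathbb{C}\times\mathbb{C}^*$ conjugating $F$ to $(z,w)\mapsto(z+1,w)$, i.e. $\Psi\circ F=T\circ\Psi$ on $\Omega$ with $T(z,w)=(z+1,w)$.
   Context: $\lambda\in S^1=\{|\lambda|=1\}$ is Brjuno if $-\sum_{\nu=1}^\infty 2^{-\nu}\log\omega(2^\nu)<\infty$, where $\omega(m):=\min\{|\lambda^k-\lambda|\mid 2\le k\le m\}$ for $m\ge2$. Fix a Brjuno $\lambda\in S^1$, $l\in\mathbb{N}$ with $l\ge4$, $\theta_0\in(0,\pi/2)$, $\beta_0\in(0,1/2)$ with $\beta_0(l+1)\ge4$. Let $\check F$ be an automorphism of $\mathbb{C}^2$ with, near the origin, $$\check F(z,w)=(\lambda z,\overline\lambda w)\cdot\Bigl(1-\frac{zw}{2}\Bigr)+wO(\|(z,w)\|^l),$$ which maps the axis $\{w=0\}$ onto itself with $\check F(z,0)=(\lambda z,0)$. For $r>0$ let $\check B(r,\theta_0,\beta_0)$ be the set of $(z,w)\in\mathbb{C}^2$ with $|z|<|zw|^{\beta_0}$, $|w|<|zw|^{\beta_0}$, $|\arg(zw)|<\theta_0$, $|zw-r|<r$. It is known (Bracci, Raissy, Stensønes) that $\check F$ has a non-recurrent invariant Fatou component $\check\Omega$, biholomorphic to $\mathbb{C}\times\mathbb{C}^*$, whose orbits all converge to $(0,0)$, and that for some $r_0>0$ the set $\check B:=\check B(r_0,\theta_0,\beta_0)$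 satisfies $\check F(\check B)\subseteq\check B$, $\check F^n\to(0,0)$ uniformly on $\check B$, and $\check\Omega=\bigcup_{n\in\mathbb{N}}\check F^{-n}(\check B)$. Let $\Pi(x,y)=(xy,y)$ (the blow-up of $\mathbb{C}^2$ at the origin in the coordinates $(x,y)=(z/w,w)$, which cover the complement of the proper transform of $\{w=0\}$). The lift $F$ of $\check F$, with $\Pi\circ F=\check F\circ\Pi$, is an automorphism of $\mathbb{C}^2$ in the coordinates $(x,y)$ with $F(x,0)=(\lambda^2x,0)$. Put $\Omega:=\Pi^{-1}(\check\Omega)$. $\mathbb{C}^*=\mathbb{C}\setminus\{0\}$. *)

(* Defs.v *)
(* Stdlib reals and Coquelicot. *)
From Stdlib Require Export Reals List.
From Coquelicot Require Export Coquelicot.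

Open Scope R_scope.

(** * The space C^2 *)

Definition C2 : Type := (C * C)%type.

(* Scalars are [C], so that differentials are complex linear; the norm is the
   Euclidean one. *)
Definition C2_NM : NormedModule C_AbsRing :=
  prod_NormedModule C_AbsRing C_NormedModule C_NormedModule.

Definition norm2 (p : C2) : R := @norm C_AbsRing C2_NM p.

Definition dist2 (p q : C2) : R := norm2 (@minus C2_NM p q).

Definition origin : C2 := (RtoC 0, RtoC 0).

Definition whole (p : C2) : Prop := True.

Definition C_times_Cstar (p : C2) : Prop := snd p <> RtoC 0.

(** * Holomorphic maps *)

Definition holomorphic_on (U : C2 -> Prop) (f : C2 -> C2) : Prop :=
  @open C2_NM U /\
  forall p : C2, U p -> @ex_filterdiff C_AbsRing C2_NM C2_NM f (@locally C2_NM p).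

(* Only the restriction of [f] to [U] matters. *)
Definition biholomorphic (U V : C2 -> Prop) (f : C2 -> C2) : Prop :=
  exists g : C2 -> C2,
    holomorphic_on U f /\ holomorphic_on V g /\
    (forall p, U p -> V (f p)) /\ (forall q, V q -> U (g q)) /\
    (forall p, U p -> g (f p) = p) /\ (forall q, V q -> f (g q) = q).

Definition automorphism (f : C2 -> C2) : Prop := biholomorphic whole whole f.

(** * Fatou components *)

Definition iterate (f : C2 -> C2) (n : nat) (p : C2) : C2 := Nat.iter n f p.

Definition converges_locally_uniformly
    (U : C2 -> Prop) (f : nat -> C2 -> C2) (g : C2 -> C2) : Prop :=
  forall p, U p -> exists delta, 0 < delta /\
    forall eps, 0 < eps -> exists N : nat, forall n q, (N <= n)%nat ->
      U q -> dist2 p q < delta -> dist2 (f n q) (g q) < eps.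

Definition diverges_locally_uniformly
    (U : C2 -> Prop) (f : nat -> C2 -> C2) : Prop :=
  forall p, U p -> exists delta, 0 < delta /\
    forall M : R, exists N : nat, forall n q, (N <= n)%nat ->
      U q -> dist2 p q < delta -> M < norm2 (f n q).

(* Normality with values in the one-point compactification of C^2: [s] selects
   an arbitrary sequence in the family [f n], and [phi] a subsequence of it.
   Limits of holomorphic maps need not be required to be holomorphic. *)
Definition normal_on (U : C2 -> Prop) (f : nat -> C2 -> C2) : Prop :=
  forall s : nat -> nat, exists phi : nat -> nat,
    (forall m n, (m < n)%nat -> (phi m < phi n)%nat) /\
    ((exists g, converges_locally_uniformly U (fun k => f (s (phi k))) g) \/
     diverges_locally_uniformly U (fun k => f (s (phi k)))).

Definition Fatou_set (f : C2 -> C2) (p : C2) : Prop :=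
  exists U : C2 -> Prop, @open C2_NM U /\ U p /\ normal_on U (iterate f).

Definition connected_set (A : C2 -> Prop) : Prop :=
  forall U V : C2 -> Prop, @open C2_NM U -> @open C2_NM V ->
    (forall p, A p -> U p \/ V p) ->
    (exists p, A p /\ U p) -> (exists p, A p /\ V p) ->
    exists p, A p /\ U p /\ V p.

Definition connected_component (X A : C2 -> Prop) : Prop :=
  (exists p, A p) /\ (forall p, A p -> X p) /\ connected_set A /\
  forall A' : C2 -> Prop, connected_set A' -> (forall p, A' p -> X p) ->
    (forall p, A p -> A' p) -> forall p, A' p -> A p.

Definition Fatou_component (f : C2 -> C2) (Omega : C2 -> Prop) : Prop :=
  connected_component (Fatou_set f) Omega.

Definition invariant (f : C2 -> C2) (Omega : C2 -> Prop) : Prop :=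
  forall q, Omega q <-> exists p, Omega p /\ f p = q.

(* No orbit starting in [Omega] has a cluster point in [Omega]. *)
Definition non_recurrent (f : C2 -> C2) (Omega : C2 -> Prop) : Prop :=
  forall p q, Omega p -> Omega q ->
    ~ (forall eps, 0 < eps -> forall N : nat, exists n : nat,
         (N <= n)%nat /\ dist2 (iterate f n p) q < eps).

Definition orbits_converge_to (f : C2 -> C2) (Omega : C2 -> Prop) (q : C2) : Prop :=
  forall p, Omega p ->
    filterlim (fun n => iterate f n p) eventually (@locally C2_NM q).

Definition orbits_converge_uniformly_to
    (f : C2 -> C2) (B : C2 -> Prop) (q : C2) : Prop :=
  forall eps, 0 < eps -> exists N : nat, forall n p, (N <= n)%nat ->
    B p -> dist2 (iterate f n p) q < eps.

(** * The Brjuno condition *)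

(* [seq 2 (m - 1)] lists 2, ..., m; the default value is the one for k = 2, so
   for m >= 2 this is the minimum over 2 <= k <= m. *)
Definition omega (lam : C) (m : nat) : R :=
  fold_right Rmin (Cmod (lam ^ 2 - lam)%C)
    (map (fun k : nat => Cmod (lam ^ k - lam)%C) (seq 2 (m - 1))).

(* If some omega(2^nu) vanishes (lam a root of unity) the sum is +oo, but
   [ln 0 = 0] in the library, hence the first clause.  The terms are bounded
   below by - 2^-nu ln 2, so the sum is < +oo iff the series converges. *)
Definition Brjuno (lam : C) : Prop :=
  (forall nu : nat, (1 <= nu)%nat -> 0 < omega lam (2 ^ nu)) /\
  ex_series (fun j : nat => - (/ 2 ^ (S j) * ln (omega lam (2 ^ (S j))))).

(** * The maps and the local basins *)

(* [h] is the factor O(||(z,w)||^l); where w <> 0 it is determined by [Fc],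
   and where w = 0 its value is irrelevant, so no regularity is imposed. *)
Definition has_expansion (lam : C) (l : nat) (Fc : C2 -> C2) : Prop :=
  exists (h : C2 -> C2) (M delta : R), 0 < delta /\
    forall z w : C, norm2 (z, w) < delta ->
      norm2 (h (z, w)) <= M * norm2 (z, w) ^ l /\
      Fc (z, w) =
        ((lam * z * (1 - z * w / 2) + w * fst (h (z, w)))%C,
         (Cconj lam * w * (1 - z * w / 2) + w * snd (h (z, w)))%C).

(* [t] is the principal argument of [zeta]. *)
Definition is_arg (zeta : C) (t : R) : Prop :=
  zeta <> RtoC 0 /\ - PI < t <= PI /\
  zeta = (RtoC (Cmod zeta) * (cos t, sin t))%C.

Definition Bcheck (r theta0 beta0 : R) (p : C2) : Prop :=
  let z := fst p in
  let w := snd p in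
  Cmod z < Rpower (Cmod (z * w)) beta0 /\
  Cmod w < Rpower (Cmod (z * w)) beta0 /\
  (exists t, is_arg (z * w)%C t /\ Rabs t < theta0) /\
  Cmod (z * w - RtoC r)%C < r.

Definition blowup (p : C2) : C2 := ((fst p * snd p)%C, snd p).

Definition translation (p : C2) : C2 := ((fst p + 1)%C, snd p).

(* Main.v *)
Require Import Defs.
From Stdlib Require Import Lra Lia ClassicalEpsilon FunctionalExtensionality.

(** Put U = 1/(zw).  On the local basin one step changes U by 1 + (3/4)/U + O(U^-2) and
    log w by -log lam - (1/2)/U + O(U^-2), so that U - (3/4) log U and log w + (1/2) log U
    satisfy the desired functional equations up to errors O(U^-2).  These errors are
    summable along orbits, since Re U grows by at least 1/2 at each step; adding the sums e1
    and e2 gives psi with psi o F = psi + 1 and, after multiplication by exp (log lam psi),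
    an invariant function tau, and both extend to the whole basin by the dynamics.

    In the coordinates (U, S), z = exp (-S - (log U)/2), w = exp (S - (log U)/2), the map
    (psi, log tau - log lam psi) is close to the identity on bidiscs of radius 2 about
    suitable points with Re U large.  By Cauchy estimates the difference is a contraction,
    so Picard iteration inverts it holomorphically there, and the dynamics carries every
    point of the basin and of C x C^* into this range.  The blow-up is biholomorphic over
    w <> 0, which contains the basin because {w = 0} is invariant.

    Holomorphy is only assumed as pointwise complex differentiability, so the Cauchy
    estimates rest on Goursat's lemma. *)

(** The constants come from u = zw. Up to the remainder, u is sent to u (1 - u/2)^2, and 1/(1 -
    u/2)^2 = 1 + u + (3/4) u^2 + ..., which produces 3/4; the factor 1 - u/2 of w produces 1/2. The
    remainder changes u by at most a constant times |u|^(beta0 (l + 1)), and beta0 (l + 1) >= 4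
    makes this O(|u|^4), that is O(U^-2) after inversion.

    Surjectivity rests on the shape of the local basin in the chart. There |z| and |w| are exp (-Re
    S) |U|^(-1/2) and exp (Re S) |U|^(-1/2), so the bounds on them say |Re S| < (1/2 - beta0) log
    |U|, a strip that widens without limit because beta0 < 1/2. Prescribing psi + n and tau instead
    of psi and tau keeps Re S under control for all n, since log lam is purely imaginary; hence
    bidiscs of fixed size fit once n is large.

    The chart has period 2 pi i in S. Injectivity therefore needs a compatible choice of S for two
    points with the same tau before the contraction can compare them. *)

Lemma Cmod_minus_sym (x y : C) : Cmod (x - y) = Cmod (y - x).
Proof. rewrite <- Cmod_opp. f_equal. ring. Qed.

Lemma Cmod_minus_triangle (x y : C) : Cmod (x - y) <= Cmod x + Cmod y.
Proof.
  eapply Rle_trans; [apply Cmod_triangle|]. rewrite Cmod_opp. lra.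
Qed.

Lemma Cmod_triangle_inv (x y : C) : Cmod x - Cmod y <= Cmod (x - y).
Proof.
  pose proof (Cmod_triangle (x - y) y).
  replace (x - y + y)%C with x in H by ring. lra.
Qed.

Lemma Cmod_dist_triangle (x y z : C) : Cmod (x - z) <= Cmod (x - y) + Cmod (y - z).
Proof.
  replace (x - z)%C with ((x - y) + (y - z))%C by ring. apply Cmod_triangle.
Qed.

Lemma im_le_Cmod (c : C) : Rabs (Im c) <= Cmod c.
Proof.
  eapply Rle_trans; [|apply Rmax_Cmod]. apply Rmax_r.
Qed.

Lemma Cmod_le_re_im (c : C) : Cmod c <= Rabs (Re c) + Rabs (Im c).
Proof.
  unfold Cmod. apply Rsqr_incr_0_var.
  - rewrite Rsqr_sqrt by nra. unfold Rsqr, Re, Im.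
    pose proof (Rabs_pos (fst c)). pose proof (Rabs_pos (snd c)).
    rewrite <- (pow2_abs (fst c)), <- (pow2_abs (snd c)). nra.
  - pose proof (Rabs_pos (Re c)). pose proof (Rabs_pos (Im c)). lra.
Qed.

(** * Complex differentiability *)

(** The remainder is multiplied out rather than divided, so that no case h = 0 arises. In two
    variables the neighbourhoods are polydiscs, the shape of all later estimates;
    [holomorphic_on_diffable2] is the bridge to the library notion. *)
Definition has_deriv (f : C -> C) (z a : C) : Prop :=
  forall eps, 0 < eps -> exists d, 0 < d /\ forall h, Cmod h < d ->
    Cmod (f (z + h) - f z - a * h)%C <= eps * Cmod h.

Definition has_diff (f : C2 -> C) (p : C2) (a b : C) : Prop :=
  forall eps, 0 < eps -> exists d, 0 < d /\ forall h k, Cmod h < d -> Cmod k < d ->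
    Cmod (f (fst p + h, snd p + k) - f p - a * h - b * k)%C <= eps * (Cmod h + Cmod k).

Definition diffable (f : C2 -> C) (p : C2) : Prop := exists a b, has_diff f p a b.

Lemma has_diff_lip f p a b : has_diff f p a b ->
  exists K d, 0 < K /\ 0 < d /\ forall h k, Cmod h < d -> Cmod k < d ->
    Cmod (f (fst p + h, snd p + k) - f p)%C <= K * (Cmod h + Cmod k).
Proof.
  intros H. destruct (H 1 Rlt_0_1) as [d [Hd Hb]].
  exists (1 + Cmod a + Cmod b), d.
  pose proof (Cmod_ge_0 a). pose proof (Cmod_ge_0 b).
  repeat split; try lra. intros h k Hh Hk.
  specialize (Hb h k Hh Hk).
  replace (f (fst p + h, snd p + k) - f p)%C with
    ((f (fst p + h, snd p + k) - f p - a * h - b * k) + (a * h + b * k))%C by ring.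
  eapply Rle_trans; [apply Cmod_triangle|].
  pose proof (Cmod_triangle (a * h) (b * k)). rewrite !Cmod_mult in H2.
  pose proof (Cmod_ge_0 h). pose proof (Cmod_ge_0 k). nra.
Qed.

(** The source of the differentiation rules: sums and products are this chain rule applied to an
    explicit polynomial on C^2. *)
Lemma has_diff_comp f u v p fa fb ua ub va vb :
  has_diff u p ua ub -> has_diff v p va vb ->
  has_diff f (u p, v p) fa fb ->
  has_diff (fun q => f (u q, v q)) p (fa * ua + fb * va)%C (fa * ub + fb * vb)%C.
Proof.
  intros Hu Hv Hf eps Heps.
  destruct (has_diff_lip _ _ _ _ Hu) as [Ku [du [HKu [Hdu Lu]]]].
  destruct (has_diff_lip _ _ _ _ Hv) as [Kv [dv [HKv [Hdv Lv]]]].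
  pose proof (Cmod_ge_0 fa) as Pa. pose proof (Cmod_ge_0 fb) as Pb.
  (* Half of [eps] pays for the outer remainder, whose increments are controlled by the Lipschitz
     constants; [e2] spends the other half on the inner remainders, which get multiplied by [fa] and
     [fb]. *)
  set (e1 := eps / 2 / (Ku + Kv)).
  assert (He1 : 0 < e1) by (unfold e1; apply Rdiv_lt_0_compat; lra).
  set (e2 := eps / 2 / (Cmod fa + Cmod fb + 1)).
  assert (He2 : 0 < e2) by (unfold e2; apply Rdiv_lt_0_compat; lra).
  destruct (Hf e1 He1) as [df [Hdf Bf]].
  destruct (Hu e2 He2) as [d1 [Hd1 Bu]].
  destruct (Hv e2 He2) as [d2 [Hd2 Bv]].
  set (d3 := df / (2 * (Ku + Kv))).
  assert (Hd3 : 0 < d3) by (unfold d3; apply Rdiv_lt_0_compat; lra).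
  exists (Rmin (Rmin du dv) (Rmin (Rmin d1 d2) d3)). split.
  { repeat apply Rmin_glb_lt; assumption. }
  intros h k Hh Hk.
  repeat match goal with H : _ < Rmin _ _ |- _ =>
    let H1 := fresh in let H2 := fresh in
    assert (H1 := Rlt_le_trans _ _ _ H (Rmin_l _ _));
    assert (H2 := Rlt_le_trans _ _ _ H (Rmin_r _ _)); clear H end.
  specialize (Lu h k ltac:(lra) ltac:(lra)). specialize (Lv h k ltac:(lra) ltac:(lra)).
  specialize (Bu h k ltac:(lra) ltac:(lra)). specialize (Bv h k ltac:(lra) ltac:(lra)).
  pose proof (Cmod_ge_0 h) as Ph. pose proof (Cmod_ge_0 k) as Pk.
  set (q := (fst p + h, snd p + k)%C) in *.
  set (U := (u q - u p)%C) in *. set (V := (v q - v p)%C) in *.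
  assert (Hs : (Ku + Kv) * (Cmod h + Cmod k) < df).
  { assert (Cmod h + Cmod k < 2 * d3) by lra.
    apply Rlt_le_trans with ((Ku + Kv) * (2 * d3)).
    - apply Rmult_lt_compat_l; lra.
    - unfold d3. right. field. lra. }
  assert (HU : Cmod U < df) by nra.
  assert (HV : Cmod V < df) by nra.
  specialize (Bf U V HU HV). simpl in Bf.
  replace (u p + U)%C with (u q) in Bf by (unfold U; ring).
  replace (v p + V)%C with (v q) in Bf by (unfold V; ring).
  replace (f (u q, v q) - f (u p, v p) - (fa * ua + fb * va) * h - (fa * ub + fb * vb) * k)%C
   with ((f (u q, v q) - f (u p, v p) - fa * U - fb * V) +
     (fa * (U - ua * h - ub * k) + fb * (V - va * h - vb * k)))%C by ring.
  eapply Rle_trans; [apply Cmod_triangle|].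
  pose proof (Cmod_triangle (fa * (U - ua * h - ub * k)) (fb * (V - va * h - vb * k))) as T.
  rewrite !Cmod_mult in T.
  assert (E1 : e1 * (Cmod U + Cmod V) <= eps / 2 * (Cmod h + Cmod k)).
  { apply Rle_trans with (e1 * ((Ku + Kv) * (Cmod h + Cmod k))).
    - apply Rmult_le_compat_l; lra.
    - unfold e1. right. field. lra. }
  assert (E2 : (Cmod fa + Cmod fb + 1) * e2 = eps / 2) by (unfold e2; field; lra).
  assert (Cmod fa * Cmod (U - ua * h - ub * k) + Cmod fb * Cmod (V - va * h - vb * k)
     <= (Cmod fa + Cmod fb) * (e2 * (Cmod h + Cmod k))).
  { fold U in Bu. fold V in Bv. nra. }
  assert ((Cmod fa + Cmod fb) * (e2 * (Cmod h + Cmod k)) <= eps / 2 * (Cmod h + Cmod k)).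
  { rewrite <- E2, <- Rmult_assoc. apply Rmult_le_compat_r; nra. }
  lra.
Qed.

Lemma has_diff_ext_loc f g p a b : (exists r, 0 < r /\ forall h k, Cmod h < r -> Cmod k < r ->
    f (fst p + h, snd p + k)%C = g (fst p + h, snd p + k)%C) ->
  has_diff f p a b -> has_diff g p a b.
Proof.
  intros [r [Hr E]] H eps He. destruct (H eps He) as [d [Hd B]].
  exists (Rmin d r). split; [apply Rmin_glb_lt; assumption|].
  intros h k Hh Hk.
  assert (E0 : f p = g p).
  { specialize (E 0 0). rewrite Cmod_0 in E. specialize (E Hr Hr).
    rewrite !Cplus_0_r in E. destruct p; exact E. }
  rewrite <- E0, <- E; [apply B| |]; eapply Rlt_le_trans; try eassumption;
    first [apply Rmin_l | apply Rmin_r].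
Qed.

Lemma has_diff_const c p : has_diff (fun _ => c) p 0 0.
Proof.
  intros eps He. exists 1. split; [lra|]. intros h k _ _.
  replace (c - c - 0 * h - 0 * k)%C with (RtoC 0) by ring. rewrite Cmod_0.
  pose proof (Cmod_ge_0 h). pose proof (Cmod_ge_0 k). nra.
Qed.

Lemma has_diff_fst p : has_diff fst p 1 0.
Proof.
  intros eps He. exists 1. split; [lra|]. intros h k _ _. simpl.
  replace (fst p + h - fst p - 1 * h - 0 * k)%C with (RtoC 0) by ring. rewrite Cmod_0.
  pose proof (Cmod_ge_0 h). pose proof (Cmod_ge_0 k). nra.
Qed.

Lemma has_diff_snd p : has_diff snd p 0 1.
Proof.
  intros eps He. exists 1. split; [lra|]. intros h k _ _. simpl.
  replace (snd p + k - snd p - 0 * h - 1 * k)%C with (RtoC 0) by ring. rewrite Cmod_0.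
  pose proof (Cmod_ge_0 h). pose proof (Cmod_ge_0 k). nra.
Qed.

Lemma has_diff_mul0 p : has_diff (fun q => fst q * snd q)%C p (snd p) (fst p).
Proof.
  intros eps He. exists eps. split; [lra|]. intros h k Hh _. simpl.
  replace ((fst p + h) * (snd p + k) - fst p * snd p - snd p * h - fst p * k)%C
    with (h * k)%C by ring. rewrite Cmod_mult.
  pose proof (Cmod_ge_0 h). pose proof (Cmod_ge_0 k). nra.
Qed.

Lemma has_diff_add0 p : has_diff (fun q => fst q + snd q)%C p 1 1.
Proof.
  intros eps He. exists eps. split; [lra|]. intros h k Hh _. simpl.
  replace (fst p + h + (snd p + k) - (fst p + snd p) - 1 * h - 1 * k)%C
    with (RtoC 0)%C by ring. rewrite Cmod_0.
  pose proof (Cmod_ge_0 h). pose proof (Cmod_ge_0 k). nra.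
Qed.

(** One-variable functions are treated as functions of the first coordinate. Together with the
    converse below, this transfers the two-variable rules to one variable. *)
Lemma has_deriv_fst f z c a : has_deriv f z a -> has_diff (fun q => f (fst q)) (z, c) a 0.
Proof.
  intros H eps He. destruct (H eps He) as [d [Hd B]]. exists d. split; [assumption|].
  intros h k Hh Hk. simpl. specialize (B h Hh).
  replace (f (z + h) - f z - a * h - 0 * k)%C with (f (z + h) - f z - a * h)%C by ring.
  pose proof (Cmod_ge_0 k). nra.
Qed.

Lemma has_diff_has_deriv f z c a b :
  has_diff (fun q => f (fst q)) (z, c) a b -> has_deriv f z a.
Proof.
  intros H eps He. destruct (H eps He) as [d [Hd B]]. exists d. split; [assumption|].
  intros h Hh. specialize (B h 0 Hh). rewrite Cmod_0 in B. specialize (B Hd). simpl in B.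
  replace (f (z + h) - f z - a * h - b * 0)%C with (f (z + h) - f z - a * h)%C in B by ring.
  lra.
Qed.

Lemma diffable_comp f u v p :
  diffable u p -> diffable v p -> diffable f (u p, v p) ->
  diffable (fun q => f (u q, v q)) p.
Proof.
  intros [? [? Hu]] [? [? Hv]] [? [? Hf]]. do 2 eexists.
  eapply has_diff_comp; eassumption.
Qed.

Lemma diffable_const c p : diffable (fun _ => c) p.
Proof. do 2 eexists. apply has_diff_const. Qed.

Lemma diffable_fst p : diffable fst p.
Proof. do 2 eexists. apply has_diff_fst. Qed.

Lemma diffable_snd p : diffable snd p.
Proof. do 2 eexists. apply has_diff_snd. Qed.

Lemma diffable_mult u v p : diffable u p -> diffable v p ->
  diffable (fun q => u q * v q)%C p.
Proof.
  intros Hu Hv. apply (diffable_comp (fun q => fst q * snd q)%C); trivial.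
  do 2 eexists. apply has_diff_mul0.
Qed.

Lemma diffable_plus u v p : diffable u p -> diffable v p ->
  diffable (fun q => u q + v q)%C p.
Proof.
  intros Hu Hv. apply (diffable_comp (fun q => fst q + snd q)%C); trivial.
  do 2 eexists. apply has_diff_add0.
Qed.

Lemma diffable_ext f g p : (forall q, f q = g q) -> diffable f p -> diffable g p.
Proof.
  intros E [a [b H]]. exists a, b. revert H. apply has_diff_ext_loc.
  exists 1. split; [lra|]. intros; apply E.
Qed.

Lemma diffable_opp u p : diffable u p -> diffable (fun q => - u q)%C p.
Proof.
  intros Hu. apply (diffable_ext (fun q => (-(1)) * u q)%C); [intros; ring|].
  apply diffable_mult; [apply diffable_const|trivial].
Qed.

Lemma diffable_minus u v p : diffable u p -> diffable v p ->
  diffable (fun q => u q - v q)%C p.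
Proof. intros Hu Hv. apply diffable_plus; [|apply diffable_opp]; trivial. Qed.

Lemma diffable_comp1 f u p a : diffable u p -> has_deriv f (u p) a ->
  diffable (fun q => f (u q)) p.
Proof.
  intros Hu Hf. apply (diffable_comp (fun q => f (fst q)) u u); trivial.
  exists a, 0. apply has_deriv_fst. trivial.
Qed.

Lemma has_deriv_affine a b z : has_deriv (fun t => a + t * b)%C z b.
Proof.
  intros eps He. exists 1. split; [lra|]. intros h _.
  replace (a + (z + h) * b - (a + z * b) - b * h)%C with (RtoC 0) by ring.
  rewrite Cmod_0. pose proof (Cmod_ge_0 h). nra.
Qed.

Lemma has_deriv_inv z : z <> RtoC 0 -> has_deriv Cinv z (- / (z * z))%C.
Proof.
  intros Hz eps He. pose proof (proj1 (Cmod_gt_0 z) Hz) as Pz.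
  set (m := Cmod z) in *.
  exists (Rmin (m / 2) (eps * (m * m * m) / 2)). split.
  { apply Rmin_glb_lt; [lra|]. repeat apply Rmult_lt_0_compat; lra. }
  intros h Hh.
  assert (H1 := Rlt_le_trans _ _ _ Hh (Rmin_l _ _)).
  assert (H2 := Rlt_le_trans _ _ _ Hh (Rmin_r _ _)). clear Hh.
  assert (Hzh : m / 2 <= Cmod (z + h)).
  { pose proof (Cmod_triangle_inv z (-h)) as T. rewrite Cmod_opp in T.
    replace (z - - h)%C with (z + h)%C in T by ring. fold m in T. lra. }
  assert (Nzh : (z + h)%C <> 0) by (apply Cmod_gt_0; lra).
  replace (/ (z + h) - / z - - / (z * z) * h)%C with (h * (h * / (z * z * (z + h))))%C
    by (field; split; assumption).
  rewrite !Cmod_mult, Cmod_inv by (repeat apply Cmult_neq_0; assumption).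
  rewrite !Cmod_mult. fold m. pose proof (Cmod_ge_0 h).
  rewrite (Rmult_comm eps). apply Rmult_le_compat_l; trivial.
  set (y := Cmod (z + h)) in *.
  assert (0 < m * m * y) by (repeat apply Rmult_lt_0_compat; lra).
  apply Rmult_le_reg_r with (m * m * y); trivial.
  rewrite Rmult_assoc, Rinv_l by lra.
  assert (m * m * (m / 2) <= m * m * y) by (apply Rmult_le_compat_l; nra). nra.
Qed.

Lemma diffable_inv u p : diffable u p -> u p <> RtoC 0 -> diffable (fun q => / u q)%C p.
Proof. intros Hu Hz. eapply diffable_comp1; [trivial|]. apply has_deriv_inv; trivial. Qed.

Lemma has_diff_continuous f p : diffable f p -> forall eps, 0 < eps ->
  exists d, 0 < d /\ forall q, Cmod (fst q - fst p) < d -> Cmod (snd q - snd p) < d ->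
    Cmod (f q - f p) < eps.
Proof.
  intros [a [b H]] eps He. destruct (has_diff_lip _ _ _ _ H) as [K [d [HK [Hd L]]]].
  assert (0 < eps / (2 * K)) by (apply Rdiv_lt_0_compat; lra).
  exists (Rmin d (eps / (2 * K))). split; [apply Rmin_glb_lt; trivial|].
  intros q H1 H2.
  assert (H3 := Rlt_le_trans _ _ _ H1 (Rmin_l _ _)).
  assert (H4 := Rlt_le_trans _ _ _ H1 (Rmin_r _ _)).
  assert (H5 := Rlt_le_trans _ _ _ H2 (Rmin_l _ _)).
  assert (H6 := Rlt_le_trans _ _ _ H2 (Rmin_r _ _)).
  specialize (L _ _ H3 H5).
  replace (fst p + (fst q - fst p), snd p + (snd q - snd p))%C with q in L
    by (destruct q; simpl; f_equal; ring).
  eapply Rle_lt_trans; [exact L|].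
  apply Rlt_le_trans with (K * (2 * (eps / (2 * K)))).
  - apply Rmult_lt_compat_l; lra.
  - right. field. lra.
Qed.

(** * Exponential and logarithm *)

Definition Cexp (z : C) : C := (exp (fst z) * cos (snd z), exp (fst z) * sin (snd z)).

Lemma Cexp_plus (z w : C) : Cexp (z + w) = (Cexp z * Cexp w)%C.
Proof.
  unfold Cexp, Cmult; simpl. rewrite exp_plus, cos_plus, sin_plus. f_equal; ring.
Qed.

Lemma Cexp_0 : Cexp 0 = 1.
Proof. unfold Cexp; simpl. rewrite exp_0, cos_0, sin_0. unfold RtoC. f_equal; ring. Qed.

Lemma Cmod_Cexp (z : C) : Cmod (Cexp z) = exp (Re z).
Proof.
  unfold Cexp, Cmod, Re; simpl.
  replace (_ + _) with (exp (fst z) * exp (fst z) * (Rsqr (sin (snd z)) + Rsqr (cos (snd z))))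
    by (unfold Rsqr; ring).
  rewrite sin2_cos2, Rmult_1_r. apply sqrt_square. left; apply exp_pos.
Qed.

Lemma Cexp_neq_0 (z : C) : Cexp z <> 0.
Proof. apply Cmod_gt_0. rewrite Cmod_Cexp. apply exp_pos. Qed.

Lemma Cexp_opp (z : C) : Cexp (- z) = (/ Cexp z)%C.
Proof.
  assert (Cexp z * Cexp (- z) = 1)%C as H.
  { rewrite <- Cexp_plus, <- Cexp_0. f_equal. ring. }
  replace (Cexp (- z)) with (/ Cexp z * (Cexp z * Cexp (- z)))%C
    by (field; apply Cexp_neq_0).
  rewrite H. ring.
Qed.

Lemma Cexp_minus (z w : C) : Cexp (z - w) = (Cexp z / Cexp w)%C.
Proof. unfold Cminus. rewrite Cexp_plus, Cexp_opp. reflexivity. Qed.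

Lemma derivable_pt_lim_0_bound f l : derivable_pt_lim f 0 l -> forall eps, 0 < eps ->
  exists d, 0 < d /\ forall x, Rabs x < d -> Rabs (f x - f 0 - l * x) <= eps * Rabs x.
Proof.
  intros H eps He. destruct (H eps He) as [d Hd]. exists d. split; [apply cond_pos|].
  intros x Hx. destruct (Req_dec x 0) as [->|Nx].
  - rewrite Rmult_0_r, Rminus_0_r, Rminus_diag, Rabs_R0. lra.
  - specialize (Hd x Nx Hx). rewrite Rplus_0_l in Hd.
    replace (f x - f 0 - l * x) with (((f x - f 0) / x - l) * x) by (field; trivial).
    rewrite Rabs_mult. apply Rmult_le_compat_r; [apply Rabs_pos|lra].
Qed.

Lemma has_deriv_Cexp_0 : has_deriv Cexp 0 1.
Proof.
  (* The real and imaginary parts of the remainder cost 4 and 5 times [eps] |h|, so 1/20 is ample.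
     The cap 1 gives |exp x - 1| <= 2 |h| and exp x <= 3. *)
  intros eps0 He0. set (eps := Rmin (eps0 / 20) 1).
  assert (He : 0 < eps) by (apply Rmin_glb_lt; lra).
  assert (Hle : eps <= eps0 / 20) by apply Rmin_l.
  assert (Hl1 : eps <= 1) by apply Rmin_r.
  destruct (derivable_pt_lim_0_bound exp 1 ltac:(rewrite <- exp_0; apply derivable_pt_lim_exp)
    eps He) as [d1 [Hd1 B1]].
  destruct (derivable_pt_lim_0_bound cos 0
    ltac:(replace 0 with (- sin 0) at 2 by (rewrite sin_0; ring); apply derivable_pt_lim_cos)
    eps He) as [d2 [Hd2 B2]].
  destruct (derivable_pt_lim_0_bound sin 1 ltac:(rewrite <- cos_0; apply derivable_pt_lim_sin)
    eps He) as [d3 [Hd3 B3]].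
  exists (Rmin (Rmin d1 d2) (Rmin d3 eps)). split; [repeat (apply Rmin_glb_lt; try assumption)|].
  intros h Hh.
  clearbody eps.
  repeat match goal with H : _ < Rmin _ _ |- _ =>
    let H1 := fresh in let H2 := fresh in
    assert (H1 := Rlt_le_trans _ _ _ H (Rmin_l _ _));
    assert (H2 := Rlt_le_trans _ _ _ H (Rmin_r _ _)); clear H end.
  rewrite Cplus_0_l, Cexp_0. destruct h as [x y].
  pose proof (re_le_Cmod (x, y)) as Rx. pose proof (im_le_Cmod (x, y)) as Ry.
  simpl in Rx, Ry. set (N := Cmod (x, y)) in *.
  specialize (B1 x ltac:(lra)). specialize (B2 y ltac:(lra)). specialize (B3 y ltac:(lra)).
  rewrite exp_0 in B1. rewrite cos_0 in B2. rewrite sin_0 in B3.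
  pose proof (Rabs_pos x). pose proof (Rabs_pos y).
  assert (Ex1 : Rabs (exp x - 1) <= 2 * N).
  { replace (exp x - 1) with ((exp x - 1 - 1 * x) + x) by ring.
    eapply Rle_trans; [apply Rabs_triang|]. nra. }
  assert (Ex : Rabs (exp x) <= 3).
  { replace (exp x) with ((exp x - 1) + 1) by ring.
    eapply Rle_trans; [apply Rabs_triang|]. rewrite Rabs_R1. lra. }
  eapply Rle_trans; [apply Cmod_le_re_im|]. unfold Cexp; simpl.
  apply Rle_trans with (4 * eps * N + 5 * eps * N); [|nra].
  apply Rplus_le_compat.
  - match goal with |- Rabs ?e <= _ =>
      replace e with (exp x * (cos y - 1 - 0 * y) + (exp x - 1 - 1 * x)) by ring end.
    eapply Rle_trans; [apply Rabs_triang|]. rewrite Rabs_mult.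
    pose proof (Rabs_pos (cos y - 1 - 0 * y)).
    assert (Rabs (exp x) * Rabs (cos y - 1 - 0 * y) <= 3 * (eps * N)).
    { apply Rmult_le_compat; try lra. apply Rabs_pos. nra. }
    nra.
  - match goal with |- Rabs ?e <= _ =>
      replace e with (exp x * (sin y - 0 - 1 * y) + (exp x - 1) * y) by ring end.
    eapply Rle_trans; [apply Rabs_triang|]. rewrite !Rabs_mult.
    assert (Rabs (exp x) * Rabs (sin y - 0 - 1 * y) <= 3 * (eps * N)).
    { apply Rmult_le_compat; try lra; try apply Rabs_pos. nra. }
    assert (Rabs (exp x - 1) * Rabs y <= 2 * N * eps).
    { apply Rmult_le_compat; try lra; try apply Rabs_pos. }
    nra.
Qed.

Lemma has_deriv_Cexp z : has_deriv Cexp z (Cexp z).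
Proof.
  intros eps He. pose proof (proj1 (Cmod_gt_0 _) (Cexp_neq_0 z)) as P.
  destruct (has_deriv_Cexp_0 (eps / Cmod (Cexp z))) as [d [Hd B]].
  { apply Rdiv_lt_0_compat; trivial. }
  exists d. split; trivial. intros h Hh. specialize (B h Hh).
  rewrite Cplus_0_l, Cexp_0 in B.
  rewrite Cexp_plus.
  replace (Cexp z * Cexp h - Cexp z - Cexp z * h)%C
    with (Cexp z * (Cexp h - 1 - 1 * h))%C by ring.
  rewrite Cmod_mult.
  apply Rle_trans with (Cmod (Cexp z) * (eps / Cmod (Cexp z) * Cmod h)).
  - apply Rmult_le_compat_l; lra.
  - right. field. lra.
Qed.

Lemma diffable_Cexp u p : diffable u p -> diffable (fun q => Cexp (u q)) p.
Proof. intros Hu. eapply diffable_comp1; [trivial|]. apply has_deriv_Cexp. Qed.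

(** Comparing moduli kills the real part. For 0 < |y| < 2 pi, cos y = 1 - 2 sin^2 (y/2) is less than
    1. *)
Lemma Cexp_eq_1 (z : C) : Cexp z = 1 -> Rabs (Im z) < 2 * PI -> z = 0.
Proof.
  intros H Hi. pose proof (f_equal Cmod H) as H1.
  rewrite Cmod_Cexp, Cmod_1 in H1.
  assert (E : fst z = 0) by (apply exp_inv; rewrite exp_0; exact H1).
  unfold Cexp in H. rewrite E, exp_0 in H. unfold RtoC in H. injection H as Hc Hs.
  rewrite Rmult_1_l in Hc, Hs. unfold Im in Hi. apply Rabs_def2 in Hi.
  assert (E2 : snd z = 0).
  { assert (Hh : forall y, 0 < y < 2 * PI -> cos y = 1 -> False).
    { intros y Hy Hcy. replace y with (2 * (y / 2)) in Hcy by field.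
      rewrite cos_2a_sin in Hcy.
      assert (0 < sin (y / 2)) by (apply sin_gt_0; lra). nra. }
    destruct (Rtotal_order (snd z) 0) as [L|[L|L]]; trivial; exfalso.
    - apply (Hh (- snd z)); [lra|]. rewrite cos_neg. exact Hc.
    - apply (Hh (snd z)); [lra|exact Hc]. }
  destruct z; simpl in *; unfold RtoC; congruence.
Qed.

Lemma Cexp_inj (z w : C) : Cexp z = Cexp w -> Rabs (Im z - Im w) < 2 * PI -> z = w.
Proof.
  intros H Hi. assert (z - w = 0)%C as E.
  { apply Cexp_eq_1.
    - rewrite Cexp_minus, H. field. apply Cexp_neq_0.
    - exact Hi. }
  replace z with (z - w + w)%C by ring. rewrite E. ring.
Qed.

Lemma Cexp_period (z : C) : Cexp (z + (0, 2 * PI)) = Cexp z.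
Proof.
  rewrite Cexp_plus. unfold Cexp at 2; simpl.
  rewrite exp_0, cos_2PI, sin_2PI. rewrite !Rmult_1_l.
  change (1, 0) with (RtoC 1). ring.
Qed.

Lemma Cexp_surj (z : C) : z <> 0 -> exists y, Cexp y = z.
Proof.
  intros Hz. pose proof (proj1 (Cmod_gt_0 z) Hz) as P. destruct z as [x y].
  set (m := Cmod (x, y)) in *.
  assert (Hm : m * m = x * x + y * y).
  { unfold m, Cmod. rewrite sqrt_sqrt; simpl; nra. }
  assert (Hs : (x / m) * (x / m) + (y / m) * (y / m) = 1).
  { field_simplify; [|lra]. apply Rmult_eq_reg_r with (m * m); [|nra].
    unfold Rdiv. field_simplify; [|lra]. nra. }
  assert (-1 <= x / m <= 1) as Hb by nra.
  assert (Hsin : sin (acos (x / m)) = Rabs (y / m)).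
  { rewrite sin_acos by trivial. rewrite <- sqrt_Rsqr_abs. f_equal. unfold Rsqr. lra. }
  assert (Hmm : m <> 0) by lra.
  assert (forall t, cos t = x / m -> sin t = y / m -> Cexp (ln m, t) = (x, y)) as G.
  { intros t Hc Hsn. unfold Cexp; simpl. rewrite exp_ln, Hc, Hsn by trivial.
    f_equal; field; trivial. }
  destruct (Rle_dec 0 (y / m)).
  - exists (ln m, acos (x / m)). apply G; [apply cos_acos; trivial|].
    rewrite Hsin, Rabs_pos_eq; trivial.
  - exists (ln m, - acos (x / m)). apply G.
    + rewrite cos_neg. apply cos_acos; trivial.
    + rewrite sin_neg, Hsin, Rabs_left; lra.
Qed.

(* The principal logarithm; only its values on the right half-plane are meaningful. *)
Definition Clog (z : C) : C := (ln (Cmod z), atan (Im z / Re z)).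

Lemma Cexp_Clog (z : C) : 0 < Re z -> Cexp (Clog z) = z.
Proof.
  intros Hz. destruct z as [x y]. simpl in Hz. unfold Clog, Cexp; simpl.
  assert (P : 0 < Cmod (x, y)).
  { apply Cmod_gt_0. intros E. injection E. intros; lra. }
  rewrite exp_ln by trivial.
  assert (E : Cmod (x, y) = x * sqrt (1 + (y / x) ^ 2)).
  { unfold Cmod; simpl.
    rewrite <- (sqrt_square x) at 3 by lra. rewrite <- sqrt_mult by nra.
    f_equal. field. lra. }
  assert (Ps : 0 < sqrt (1 + (y / x) ^ 2)) by (apply sqrt_lt_R0; nra).
  rewrite cos_atan, sin_atan, E. unfold Rsqr. simpl in *. rewrite Rmult_1_r in *.
  f_equal; field; lra.
Qed.

Lemma Im_Clog (z : C) : Rabs (Im (Clog z)) < PI / 2.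
Proof. unfold Clog; simpl. pose proof (atan_bound (Im z / Re z)). apply Rabs_def1; lra. Qed.

Lemma Re_Clog (z : C) : Re (Clog z) = ln (Cmod z).
Proof. reflexivity. Qed.

Lemma Clog_Cexp (w : C) : Rabs (Im w) < PI / 2 -> 0 < Re (Cexp w) -> Clog (Cexp w) = w.
Proof.
  intros Hi Hr. apply Cexp_inj; [apply Cexp_Clog; trivial|].
  pose proof (Im_Clog (Cexp w)). apply Rabs_def2 in H. apply Rabs_def2 in Hi.
  apply Rabs_def1; lra.
Qed.

(** Each of the three logarithms has imaginary part below pi/2 in modulus, so the two sides differ
    by less than 3 pi/2 there, which is inside the range of [Cexp_inj]. *)
Lemma Clog_mult (z w : C) : 0 < Re z -> 0 < Re w -> 0 < Re (z * w)%C ->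
  Clog (z * w) = (Clog z + Clog w)%C.
Proof.
  intros Hz Hw Hzw. apply Cexp_inj.
  - rewrite Cexp_plus, !Cexp_Clog; trivial.
  - pose proof (Im_Clog z) as A. pose proof (Im_Clog w) as B. pose proof (Im_Clog (z * w)) as D.
    apply Rabs_def2 in A, B, D. pose proof PI_RGT_0.
    change (Im (Clog z + Clog w)) with (Im (Clog z) + Im (Clog w)).
    apply Rabs_def1; lra.
Qed.

Lemma continuity_pt_bound f x : continuity_pt f x -> forall eps, 0 < eps ->
  exists d, 0 < d /\ forall y, Rabs (y - x) < d -> Rabs (f y - f x) < eps.
Proof.
  intros H eps He. destruct (H eps He) as [d [Hd B]]. exists d. split; trivial.
  intros y Hy. destruct (Req_dec x y) as [->|N].
  - rewrite Rminus_diag, Rabs_R0. trivial.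
  - apply (B y). repeat split; trivial.
Qed.

Lemma Clog_continuous (z : C) : 0 < Re z -> forall eps, 0 < eps ->
  exists d, 0 < d /\ forall h, Cmod h < d -> 0 < Re (z + h)%C /\ Cmod (Clog (z + h) - Clog z) < eps.
Proof.
  intros Hz eps He.
  assert (Pm : 0 < Cmod z) by (pose proof (re_le_Cmod z); rewrite Rabs_pos_eq in H; lra).
  destruct (continuity_pt_bound ln (Cmod z)) with (eps := eps / 2) as [d1 [Hd1 B1]]; [|lra|].
  { apply derivable_continuous_pt. exists (/ Cmod z). apply derivable_pt_lim_ln. trivial. }
  destruct (continuity_pt_bound atan (Im z / Re z)) with (eps := eps / 2) as [d2 [Hd2 B2]]; [|lra|].
  { apply derivable_continuous_pt. apply derivable_pt_atan. }
  set (x := Re z) in *. set (y := Im z) in *.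
  (* A Lipschitz constant for the quotient y/x under perturbations of size at most x/2, which keep
     the denominator above x/2. *)
  set (K := 2 / x * (1 + Rabs y / x)).
  assert (HK : 0 < K).
  { unfold K. pose proof (Rabs_pos y). apply Rmult_lt_0_compat.
    - apply Rdiv_lt_0_compat; lra.
    - assert (0 <= Rabs y / x) by (apply Rdiv_le_0_compat; lra). lra. }
  exists (Rmin (Rmin d1 (x / 2)) (d2 / K)). split.
  { repeat apply Rmin_glb_lt; try lra. apply Rdiv_lt_0_compat; trivial. }
  intros h Hh.
  repeat match goal with H : _ < Rmin _ _ |- _ =>
    let H1 := fresh in let H2 := fresh in
    assert (H1 := Rlt_le_trans _ _ _ H (Rmin_l _ _));
    assert (H2 := Rlt_le_trans _ _ _ H (Rmin_r _ _)); clear H end.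
  pose proof (re_le_Cmod h) as Rh. pose proof (im_le_Cmod h) as Ih.
  change (Re (z + h)) with (x + Re h).
  assert (Hx : x / 2 < x + Re h).
  { assert (- Rabs (Re h) <= Re h) by (pose proof (Rle_abs (- Re h)); rewrite Rabs_Ropp in *; lra).
    lra. }
  split; [lra|].
  eapply Rle_lt_trans; [apply Cmod_le_re_im|].
  change (Re (Clog (z + h) - Clog z)) with (ln (Cmod (z + h)) - ln (Cmod z)).
  change (Im (Clog (z + h) - Clog z)) with (atan ((y + Im h) / (x + Re h)) - atan (y / x)).
  assert (Rabs (ln (Cmod (z + h)) - ln (Cmod z)) < eps / 2).
  { apply B1. apply Rle_lt_trans with (Cmod h); [|lra].
    apply Rabs_le. split.
    - pose proof (Cmod_triangle_inv z (- h)) as T. rewrite Cmod_opp in T.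
      replace (z - - h)%C with (z + h)%C in T by ring. lra.
    - pose proof (Cmod_triangle z h). lra. }
  assert (Rabs (atan ((y + Im h) / (x + Re h)) - atan (y / x)) < eps / 2); [|lra].
  apply B2.
  replace ((y + Im h) / (x + Re h) - y / x) with ((Im h - y / x * Re h) / (x + Re h))
    by (field; lra).
  apply Rle_lt_trans with (K * Cmod h).
  - unfold Rdiv at 1. rewrite Rabs_mult, Rabs_inv, (Rabs_pos_eq (x + Re h)) by lra.
    rewrite Rmult_comm. unfold K.
    assert (/ (x + Re h) <= 2 / x).
    { apply Rmult_le_reg_r with (x * (x + Re h)); [nra|]. field_simplify; try lra; nra. }
    rewrite (Rmult_assoc (2 / x)). apply Rmult_le_compat; trivial.
    + left; apply Rinv_0_lt_compat; lra.
    + apply Rabs_pos.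
    + unfold Rminus. eapply Rle_trans; [apply Rabs_triang|].
      rewrite Rabs_Ropp, Rabs_mult. unfold Rdiv. rewrite Rabs_mult, Rabs_inv, (Rabs_pos_eq x) by lra.
      assert (0 <= Rabs y * / x).
      { apply Rmult_le_pos; [apply Rabs_pos|left; apply Rinv_0_lt_compat; lra]. }
      nra.
  - apply Rmult_lt_reg_r with (/ K); [apply Rinv_0_lt_compat; trivial|].
    replace (K * Cmod h * / K) with (Cmod h) by (field; lra). exact H0.
Qed.

(* The logarithm is a continuous right inverse of the exponential, whose derivative
   does not vanish. *)
Lemma has_deriv_Clog (z : C) : 0 < Re z -> has_deriv Clog z (/ z)%C.
Proof.
  intros Hz eps He. set (w := Clog z).
  assert (Ew : Cexp w = z) by (apply Cexp_Clog; trivial).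
  assert (Nz : z <> 0) by (rewrite <- Ew; apply Cexp_neq_0).
  pose proof (proj1 (Cmod_gt_0 z) Nz) as Pz. set (m := Cmod z) in *.
  (* The derivative of [Cexp] at [w] is z, of modulus [m]. The first bound inverts this to |k| <=
     (2/m) |h|; the second makes the remainder, divided by [m], at most [eps] |h|. *)
  set (e1 := Rmin (m / 2) (eps * m * m / 2)).
  assert (He1 : 0 < e1).
  { apply Rmin_glb_lt; [lra|]. apply Rdiv_lt_0_compat; [|lra]. repeat apply Rmult_lt_0_compat; lra. }
  destruct (has_deriv_Cexp w e1 He1) as [d1 [Hd1 B1]].
  destruct (Clog_continuous z Hz d1 Hd1) as [d [Hd Bd]].
  exists d. split; trivial. intros h Hh. destruct (Bd h Hh) as [Hr Hk].
  fold w in Hk |- *. set (k := (Clog (z + h) - w)%C) in *.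
  specialize (B1 k Hk).
  replace (w + k)%C with (Clog (z + h)) in B1 by (unfold k; ring).
  rewrite Cexp_Clog in B1 by trivial. rewrite Ew in B1.
  replace (z + h - z - z * k)%C with (h - z * k)%C in B1 by ring.
  assert (Hk2 : Cmod k <= 2 / m * Cmod h).
  { pose proof (Cmod_triangle_inv (z * k) h) as T. rewrite Cmod_minus_sym in B1.
    rewrite Cmod_mult in T. fold m in T.
    assert (e1 <= m / 2) by apply Rmin_l. pose proof (Cmod_ge_0 k).
    apply Rmult_le_reg_l with (m / 2); [lra|].
    replace (m / 2 * (2 / m * Cmod h)) with (Cmod h) by (field; lra). nra. }
  replace (k - / z * h)%C with (- (/ z * (h - z * k)))%C by (field; trivial).
  rewrite Cmod_opp, Cmod_mult, Cmod_inv by trivial. fold m.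
  assert (e1 <= eps * m * m / 2) by apply Rmin_r.
  pose proof (Cmod_ge_0 h). pose proof (Cmod_ge_0 k).
  apply Rle_trans with (/ m * (eps * m * m / 2 * (2 / m * Cmod h))).
  - apply Rmult_le_compat_l; [left; apply Rinv_0_lt_compat; trivial|].
    eapply Rle_trans; [exact B1|]. apply Rmult_le_compat; lra.
  - right. field. lra.
Qed.

Lemma diffable_Clog u p : diffable u p -> 0 < Re (u p) -> diffable (fun q => Clog (u q)) p.
Proof. intros Hu Hp. eapply diffable_comp1; [trivial|]. apply has_deriv_Clog; trivial. Qed.

(** * Goursat's lemma on squares *)

Lemma has_deriv_continuous f z : (exists a, has_deriv f z a) -> forall eps, 0 < eps ->
  exists d, 0 < d /\ forall y, Cmod (y - z) < d -> Cmod (f y - f z) < eps.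
Proof.
  intros [a H] eps He.
  destruct (has_diff_continuous (fun q => f (fst q)) (z, RtoC 0)) with (eps := eps)
    as [d [Hd B]]; trivial.
  { exists a, 0. apply has_deriv_fst; trivial. }
  exists d. split; trivial. intros y Hy. apply (B (y, RtoC 0)); trivial.
  simpl. replace (0 - 0)%C with (RtoC 0) by ring. rewrite Cmod_0. trivial.
Qed.

Lemma continuous_of_deriv (K : C -> C) (t : R) : (exists a, has_deriv K (RtoC t) a) ->
  @continuous R_UniformSpace C_R_NormedModule (fun s : R => K (RtoC s)) t.
Proof.
  intros H. apply filterlim_locally. intros eps.
  destruct (has_deriv_continuous K t H eps (cond_pos eps)) as [d [Hd B]].
  exists (mkposreal d Hd). intros y Hy.
  apply C_NormedModule_mixin_compat1.
  change (Cmod (K y - K t) < eps). apply B.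
  rewrite <- RtoC_minus, Cmod_R. exact Hy.
Qed.

(* The four sides of the square with lower left corner [p] and side [s], run through
   simultaneously; the integral of this over [0, s] is the integral of [g] along the
   boundary. *)
Definition square_integrand (g : C -> C) (p : C) (s : R) (t : C) : C :=
  (g (p + t) - g (p + Ci * s + t) + Ci * (g (p + s + Ci * t) - g (p + Ci * t)))%C.

Definition square_integral (g : C -> C) (p : C) (s : R) : C :=
  @RInt C_R_CompleteNormedModule (fun t : R => square_integrand g p s (RtoC t)) 0 s.

Lemma diffable_deriv_affine g a b p : (exists c, has_deriv g (a + fst p * b)%C c) ->
  diffable (fun q => g (a + fst q * b)%C) p.
Proof.
  intros [c H]. apply (diffable_comp1 g (fun q => a + fst q * b)%C p c); trivial.
  apply diffable_plus; [apply diffable_const|].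
  apply diffable_mult; [apply diffable_fst|apply diffable_const].
Qed.

(** A left half-plane is the natural domain: Goursat's lemma will be applied to a function pulled
    back by exp, which maps Re z < ln r onto the punctured disc of radius r. *)
Lemma square_integrand_deriv g c p s t :
  (forall z, Re z < c -> exists a, has_deriv g z a) ->
  0 <= s -> Re p + s < c -> 0 <= t <= s ->
  exists a, has_deriv (square_integrand g p s) (RtoC t) a.
Proof.
  intros Hg Hs Hp Ht.
  destruct (diffable_ext
    (fun q => g (p + fst q * 1) - g ((p + Ci * s) + fst q * 1) +
      Ci * (g ((p + s) + fst q * Ci) - g (p + fst q * Ci)))%C
    (fun q => square_integrand g p s (fst q)) (RtoC t, RtoC 0)) as [a [b H]].
  - intros [q q']. unfold square_integrand; simpl.
    rewrite !Cmult_1_r, !(Cmult_comm q). reflexivity.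
  - apply diffable_plus; [|apply diffable_mult; [apply diffable_const|]];
      apply diffable_minus; apply diffable_deriv_affine; apply Hg; simpl;
      unfold Re in *; lra.
  - exists a. exact (has_diff_has_deriv _ _ _ _ _ H).
Qed.

Section Goursat.

Variables (g : C -> C) (c : R).
Hypothesis Hg : forall z, Re z < c -> exists a, has_deriv g z a.

Lemma square_ex_RInt p s : 0 <= s -> Re p + s < c ->
  @ex_RInt C_R_CompleteNormedModule (fun t : R => square_integrand g p s (RtoC t)) 0 s.
Proof.
  intros Hs Hp. apply (@ex_RInt_continuous C_R_CompleteNormedModule). intros t Ht.
  rewrite Rmin_left, Rmax_right in Ht by trivial.
  apply continuous_of_deriv. apply (square_integrand_deriv g c); trivial.
Qed.

Lemma square_integral_norm p s M : 0 <= s -> Re p + s < c ->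
  (forall t, 0 <= t <= s -> Cmod (square_integrand g p s (RtoC t)) <= M) ->
  Cmod (square_integral g p s) <= s * M.
Proof.
  intros Hs Hp HM.
  replace (s * M) with ((s - 0) * M) by ring.
  rewrite Cmod_norm.
  apply (@norm_RInt_le_const C_R_CompleteNormedModule (fun t : R => square_integrand g p s (RtoC t)));
    trivial.
  { intros t Ht. rewrite <- Cmod_norm. auto. }
  apply (@RInt_correct C_R_CompleteNormedModule). apply square_ex_RInt; trivial.
Qed.

(** The integral over [s, 2s] is shifted to [0, s]. The identity then holds between integrands: for
    every t the contributions of the inner sides of the four small squares cancel. *)
Lemma square_subdivide p s : 0 <= s -> Re p + (s + s) < c ->
  square_integral g p (s + s) =
   (square_integral g p s + square_integral g (p + s) s +
    square_integral g (p + Ci * s) s + square_integral g (p + s + Ci * s) s)%C.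
Proof.
  intros Hs Hp.
  assert (E1 := square_ex_RInt p (s + s) ltac:(lra) Hp).
  assert (Ea : @ex_RInt C_R_CompleteNormedModule
     (fun t : R => square_integrand g p (s + s) (RtoC t)) 0 s).
  { apply (@ex_RInt_Chasles_1 C_R_CompleteNormedModule) with (b := s) (c := s + s); [lra|trivial]. }
  assert (Eb : @ex_RInt C_R_CompleteNormedModule
     (fun t : R => square_integrand g p (s + s) (RtoC t)) s (s + s)).
  { apply (@ex_RInt_Chasles_2 C_R_CompleteNormedModule) with (a := 0) (b := s); [lra|trivial]. }
  unfold square_integral at 1.
  rewrite <- (@RInt_Chasles C_R_CompleteNormedModule _ 0 s (s + s)) by trivial.
  assert (Hsh : @RInt C_R_CompleteNormedModule
     (fun t : R => square_integrand g p (s + s) (RtoC t)) s (s + s) =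
     @RInt C_R_CompleteNormedModule
     (fun t : R => square_integrand g p (s + s) (RtoC (1 * t + s))) 0 s).
  { pose proof (@RInt_comp_lin C_R_CompleteNormedModule
      (fun t : R => square_integrand g p (s + s) (RtoC t)) 1 s 0 s) as H.
    replace (1 * 0 + s) with s in H by ring. replace (1 * s + s) with (s + s) in H by ring.
    rewrite <- H by trivial. apply RInt_ext. intros x _.
    exact (@scal_one R_AbsRing C_R_CompleteNormedModule _). }
  assert (Eb' : @ex_RInt C_R_CompleteNormedModule
     (fun t : R => square_integrand g p (s + s) (RtoC (1 * t + s))) 0 s).
  { apply (@ex_RInt_ext C_R_CompleteNormedModule
      (fun t : R => scal 1 (square_integrand g p (s + s) (RtoC (1 * t + s))))).
    - intros x _. exact (@scal_one R_AbsRing C_R_CompleteNormedModule _).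
    - apply (@ex_RInt_comp_lin C_R_CompleteNormedModule
      (fun t : R => square_integrand g p (s + s) (RtoC t)) 1 s 0 s).
      replace (1 * 0 + s) with s by ring. replace (1 * s + s) with (s + s) by ring. trivial. }
  rewrite Hsh, <- (@RInt_plus C_R_CompleteNormedModule) by trivial.
  assert (F1 : Re p + s < c) by lra.
  assert (F2 : Re (p + s)%C + s < c) by (unfold Re in *; simpl; lra).
  assert (F3 : Re (p + Ci * s)%C + s < c) by (unfold Re in *; simpl; lra).
  assert (F4 : Re (p + s + Ci * s)%C + s < c) by (unfold Re in *; simpl; lra).
  assert (I1 := square_ex_RInt _ s Hs F1). assert (I2 := square_ex_RInt _ s Hs F2).
  assert (I3 := square_ex_RInt _ s Hs F3). assert (I4 := square_ex_RInt _ s Hs F4).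
  unfold square_integral.
  match goal with |- _ = (?a + ?b + ?d + ?e)%C =>
    change (a + b + d + e)%C with (@plus C_R_CompleteNormedModule
      (@plus C_R_CompleteNormedModule (@plus C_R_CompleteNormedModule a b) d) e) end.
  pose proof (@ex_RInt_plus C_R_CompleteNormedModule _ _ _ _ I1 I2) as J1.
  pose proof (@ex_RInt_plus C_R_CompleteNormedModule _ _ _ _ J1 I3) as J2.
  rewrite <- (@RInt_plus C_R_CompleteNormedModule _ _ _ _ I1 I2).
  rewrite <- (@RInt_plus C_R_CompleteNormedModule _ _ _ _ J1 I3).
  rewrite <- (@RInt_plus C_R_CompleteNormedModule _ _ _ _ J2 I4).
  apply (@RInt_ext C_R_CompleteNormedModule). intros t _.
  repeat match goal with |- context [@plus ?V ?a ?b] => change (@plus V a b) with (Cplus a b) end.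
  match goal with |- ?l = ?r => change (@eq C l r) end.
  unfold square_integrand.
  replace (1 * t + s) with (t + s) by ring. rewrite !RtoC_plus.
  replace (p + (t + s))%C with (p + s + t)%C by ring.
  replace (p + s + Ci * s + Ci * t)%C with (p + s + Ci * (t + s))%C by ring.
  replace (p + Ci * (s + s) + (t + s))%C with (p + s + Ci * s + Ci * s + t)%C by ring.
  replace (p + Ci * (s + s) + t)%C with (p + Ci * s + Ci * s + t)%C by ring.
  replace (p + s + Ci * s + s + Ci * t)%C with (p + (s + s) + Ci * (t + s))%C by ring.
  replace (p + s + s + Ci * t)%C with (p + (s + s) + Ci * t)%C by ring.
  replace (p + Ci * s + s + Ci * t)%C with (p + s + Ci * (t + s))%C by ring.
  replace (p + Ci * s + Ci * t)%C with (p + Ci * (t + s))%C by ring.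
  replace (p + Ci * s + s + t)%C with (p + s + Ci * s + t)%C by ring.
  ring.
Qed.

Lemma square_local_bound p s q a eps : 0 <= s -> 0 <= eps -> Re p + s < c ->
  (forall z, Cmod (z - q) <= 2 * s -> Cmod (g z - g q - a * (z - q)) <= eps * (2 * s)) ->
  Re p <= Re q <= Re p + s -> Im p <= Im q <= Im p + s ->
  Cmod (square_integral g p s) <= s * (8 * eps * s).
Proof.
  intros Hs He Hp Hb Hr Hi. apply square_integral_norm; trivial. intros t Ht.
  set (r := fun z => (g z - g q - a * (z - q))%C) in *.
  (* For an affine function the four sides cancel pointwise, because Ci (a s) = a (Ci s). So g may
     be replaced by its first-order remainder [r], and four values of size 2 s [eps] give 8 [eps]
     s. *)
  assert (E : square_integrand g p s t =
    ((r (p + t)%C - r (p + Ci * s + t)%C) + Ci * (r (p + s + Ci * t)%C - r (p + Ci * t)%C))%C).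
  { unfold square_integrand, r. ring. }
  rewrite E. eapply Rle_trans; [apply Cmod_triangle|].
  rewrite Cmod_mult, Cmod_Ci, Rmult_1_l.
  assert (B : forall x y, 0 <= x <= s -> 0 <= y <= s -> Cmod (r (p + (x, y))%C) <= eps * (2 * s)).
  { intros x y Hx Hy. apply Hb. eapply Rle_trans; [apply Cmod_le_re_im|].
    unfold Re, Im in *; simpl.
    assert (Rabs (fst p + x + - fst q) <= s) by (apply Rabs_le; lra).
    assert (Rabs (snd p + y + - snd q) <= s) by (apply Rabs_le; lra). lra. }
  pose proof (Cmod_minus_triangle (r (p + t)%C) (r (p + Ci * s + t)%C)) as T1.
  pose proof (Cmod_minus_triangle (r (p + s + Ci * t)%C) (r (p + Ci * t)%C)) as T2.
  pose proof (B t 0 ltac:(lra) ltac:(lra)) as B1.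
  pose proof (B t s ltac:(lra) ltac:(lra)) as B2.
  pose proof (B s t ltac:(lra) ltac:(lra)) as B3.
  pose proof (B 0 t ltac:(lra) ltac:(lra)) as B4.
  replace (p + (t, s))%C with (p + Ci * s + t)%C in B2
    by (apply injective_projections; simpl; ring).
  replace (p + (s, t))%C with (p + s + Ci * t)%C in B3
    by (apply injective_projections; simpl; ring).
  replace (p + (0, t))%C with (p + Ci * t)%C in B4
    by (apply injective_projections; simpl; ring).
  change (t, 0) with (RtoC t) in B1.
  lra.
Qed.

Lemma square_quarter p s : 0 <= s -> Re p + s < c ->
  exists q, Cmod (square_integral g p s) / 4 <= Cmod (square_integral g q (s / 2)) /\
    (Re p <= Re q /\ Re q + s / 2 <= Re p + s) /\ (Im p <= Im q /\ Im q + s / 2 <= Im p + s).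
Proof.
  intros Hs Hp. set (h := s / 2).
  assert (Eh : h + h = s) by (unfold h; lra).
  pose proof (square_subdivide p h ltac:(lra) ltac:(rewrite Eh; trivial)) as E.
  rewrite Eh in E. set (J := square_integral g) in *.
  assert (T : Cmod (J p s) <= Cmod (J p h) + Cmod (J (p + h)%C h) +
     Cmod (J (p + Ci * h)%C h) + Cmod (J (p + h + Ci * h)%C h)).
  { rewrite E. eapply Rle_trans; [apply Cmod_triangle|]. apply Rplus_le_compat_r.
    eapply Rle_trans; [apply Cmod_triangle|]. apply Rplus_le_compat_r. apply Cmod_triangle. }
  destruct (Rle_dec (Cmod (J p s) / 4) (Cmod (J p h))).
  { exists p. split; trivial. lra. }
  destruct (Rle_dec (Cmod (J p s) / 4) (Cmod (J (p + h)%C h))).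
  { exists (p + h)%C. split; trivial. unfold Re, Im; simpl. lra. }
  destruct (Rle_dec (Cmod (J p s) / 4) (Cmod (J (p + Ci * h)%C h))).
  { exists (p + Ci * h)%C. split; trivial. unfold Re, Im; simpl. lra. }
  exists (p + h + Ci * h)%C. split; [lra|]. unfold Re, Im; simpl. lra.
Qed.

End Goursat.

(** The common point is the supremum of the left endpoints. It is used separately for real and
    imaginary parts of the corners of nested squares. *)
Lemma nested_intervals (a s : nat -> R) : (forall n, 0 <= s n) ->
  (forall n, a n <= a (S n) /\ a (S n) + s (S n) <= a n + s n) ->
  exists l, forall n, a n <= l <= a n + s n.
Proof.
  intros Hs Ha.
  assert (Mon : forall m n, (m <= n)%nat -> a m <= a n /\ a n + s n <= a m + s m).
  { intros m n L. induction L; [lra|]. destruct (Ha m0). lra. }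
  assert (Up : forall m n, a m <= a n + s n).
  { intros m n. destruct (Nat.le_ge_cases m n) as [L|L]; destruct (Mon _ _ L);
    pose proof (Hs n); pose proof (Hs m); lra. }
  destruct (completeness (fun x => exists n, x = a n)) as [l [L1 L2]].
  - exists (a O + s O). intros x [n ->]. apply Up.
  - exists (a O). exists O. reflexivity.
  - exists l. intros n. split.
    + apply L1. exists n. reflexivity.
    + apply L2. intros x [m ->]. apply Up.
Qed.

Lemma Goursat g c p s : (forall z, Re z < c -> exists a, has_deriv g z a) ->
  0 < s -> Re p + s < c -> square_integral g p s = 0.
Proof.
  intros Hg Hs Hp. apply Cmod_eq_0.
  destruct (Rle_lt_or_eq_dec _ _ (Cmod_ge_0 (square_integral g p s))) as [Pos|]; [exfalso|auto].
  set (eta := Cmod (square_integral g p s)) in *.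
  set (sd := fun n => s / 2 ^ n).
  assert (Psd : forall n, 0 < sd n).
  { intros n. apply Rdiv_lt_0_compat; trivial. apply pow_lt; lra. }
  assert (Esd : forall n, sd (S n) = sd n / 2).
  { intros n. unfold sd. simpl. field. apply pow_nonzero; lra. }
  (* The side condition is placed under the existential quantifier, so that the choice of a
     subsquare is a total function and can be iterated. *)
  assert (Hstep : forall (q : C) (n : nat), exists q', Re q + sd n < c ->
     Cmod (square_integral g q (sd n)) / 4 <= Cmod (square_integral g q' (sd n / 2)) /\
    (Re q <= Re q' /\ Re q' + sd n / 2 <= Re q + sd n) /\
    (Im q <= Im q' /\ Im q' + sd n / 2 <= Im q + sd n)).
  { intros q n. destruct (Rlt_dec (Re q + sd n) c) as [L|L].
    - destruct (square_quarter g c Hg q (sd n)) as [q' H]; trivial.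
      + left; apply Psd.
      + exists q'. intros _. exact H.
    - exists q. intros; contradiction. }
  set (next := fun q n => proj1_sig (constructive_indefinite_description _ (Hstep q n))).
  set (P := fix P n := match n with O => p | S n => next (P n) n end).
  assert (HP : forall n, Re (P n) + sd n < c /\
     eta / 4 ^ n <= Cmod (square_integral g (P n) (sd n))).
  { induction n as [|n [IH1 IH2]].
    - unfold sd. simpl. rewrite !Rdiv_1_r. unfold eta. split; lra.
    - change (P (S n)) with (next (P n) n). unfold next.
      destruct (constructive_indefinite_description _ (Hstep (P n) n)) as [q' Hq]; simpl.
      destruct (Hq IH1) as [Q1 [[Q2 Q3] _]]. rewrite Esd. split; [lra|].
      replace (eta / (4 * 4 ^ n)) with (eta / 4 ^ n / 4); [lra|].
      field. apply pow_nonzero; lra. }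
  assert (HN : forall n, (Re (P n) <= Re (P (S n)) /\ Re (P (S n)) + sd (S n) <= Re (P n) + sd n) /\
      (Im (P n) <= Im (P (S n)) /\ Im (P (S n)) + sd (S n) <= Im (P n) + sd n)).
  { intros n. change (P (S n)) with (next (P n) n). unfold next.
    destruct (constructive_indefinite_description _ (Hstep (P n) n)) as [q' Hq]; simpl.
    rewrite Esd. apply Hq. apply HP. }
  destruct (nested_intervals (fun n => Re (P n)) sd) as [x Hx].
  { intros n; left; apply Psd. } { intros n; apply HN. }
  destruct (nested_intervals (fun n => Im (P n)) sd) as [y Hy].
  { intros n; left; apply Psd. } { intros n; apply HN. }
  destruct (Hg (x, y)) as [a Ha].
  { specialize (Hx O). destruct (HP O). simpl. unfold Re in *. lra. }
  (* With this value the local bound 8 [eps] (s/2^n)^2 is exactly half of the lower bound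
     [eta]/4^n. *)
  set (eps := eta / (16 * s * s)).
  assert (He : 0 < eps) by (apply Rdiv_lt_0_compat; nra).
  destruct (Ha eps He) as [d [Hd B]].
  assert (exists n, 2 * sd n < d) as [n Hn].
  { destruct (pow_lt_1_zero (/ 2)) with (y := d / (2 * s)) as [n Hn].
    - rewrite Rabs_pos_eq; lra.
    - apply Rdiv_lt_0_compat; lra.
    - exists n. specialize (Hn n (le_n n)).
      rewrite Rabs_pos_eq in Hn by (apply pow_le; lra).
      unfold sd. rewrite pow_inv in Hn.
      apply Rmult_lt_compat_l with (r := 2 * s) in Hn; [|lra].
      replace (2 * s * (d / (2 * s))) with d in Hn by (field; lra). unfold Rdiv. lra. }
  destruct (HP n) as [HP1 HP2]. pose proof (Psd n) as Pn.
  pose proof (square_local_bound g c Hg (P n) (sd n) (x, y) a eps) as LB.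
  assert (Cmod (square_integral g (P n) (sd n)) <= sd n * (8 * eps * sd n)) as H.
  { apply LB; try lra.
    - intros z Hz. specialize (B (z - (x, y))%C ltac:(lra)).
      replace ((x, y) + (z - (x, y)))%C with z in B by ring.
      eapply Rle_trans; [exact B|]. apply Rmult_le_compat_l; lra.
    - apply Hx.
    - apply Hy. }
  assert (Ef : sd n * (8 * eps * sd n) = eta / 4 ^ n / 2).
  { unfold sd, eps. replace (4 ^ n) with (2 ^ n * 2 ^ n).
    - assert (2 ^ n <> 0) by (apply pow_nonzero; lra). field. lra.
    - rewrite <- Rpow_mult_distr. replace (2 * 2) with 4 by ring. reflexivity. }
  assert (0 < eta / 4 ^ n) by (apply Rdiv_lt_0_compat; [trivial|apply pow_lt; lra]).
  lra.
Qed.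

(** * Cauchy estimates *)

Lemma has_deriv_comp f u z a b : has_deriv u z a -> has_deriv f (u z) b ->
  has_deriv (fun t => f (u t)) z (b * a)%C.
Proof.
  intros Hu Hf. apply (has_diff_has_deriv (fun t => f (u t)) z 0 _ (b * 0 + 0 * 0)%C).
  replace (b * a)%C with (b * a + 0 * a)%C by ring.
  apply (has_diff_comp (fun q => f (fst q)) (fun q => u (fst q)) (fun q => u (fst q)) (z, RtoC 0) b 0 a 0 a 0).
  - apply has_deriv_fst; trivial.
  - apply has_deriv_fst; trivial.
  - apply (has_deriv_fst f). trivial.
Qed.

Lemma has_deriv_minus f g z a b : has_deriv f z a -> has_deriv g z b ->
  has_deriv (fun t => f t - g t)%C z (a - b)%C.
Proof.
  intros Hf Hg eps He.
  destruct (Hf (eps / 2)) as [d1 [Hd1 B1]]; [lra|].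
  destruct (Hg (eps / 2)) as [d2 [Hd2 B2]]; [lra|].
  exists (Rmin d1 d2). split; [apply Rmin_glb_lt; trivial|]. intros h Hh.
  specialize (B1 h (Rlt_le_trans _ _ _ Hh (Rmin_l _ _))).
  specialize (B2 h (Rlt_le_trans _ _ _ Hh (Rmin_r _ _))).
  replace (f (z + h) - g (z + h) - (f z - g z) - (a - b) * h)%C with
    ((f (z + h) - f z - a * h) - (g (z + h) - g z - b * h))%C by ring.
  eapply Rle_trans; [apply Cmod_minus_triangle|]. lra.
Qed.

Lemma has_deriv_shift f v z a : has_deriv f (z + v)%C a -> has_deriv (fun t => f (t + v))%C z a.
Proof.
  intros H eps He. destruct (H eps He) as [d [Hd B]]. exists d. split; trivial.
  intros h Hh. replace (z + h + v)%C with (z + v + h)%C by ring. auto.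
Qed.

Lemma Cminus_diag_uniq (x y : C) : (x - y)%C = 0 -> x = y.
Proof. intros H. replace x with (x - y + y)%C by ring. rewrite H. ring. Qed.

(* With q z = (f z - f 0) / z, Goursat's lemma for the periodic function q (exp z) on
   squares of side 2 pi shows that the mean of q over the circle of radius exp s is the
   same for s and s - 2 pi; as s tends to -oo it tends to f'(0). *)
Lemma cauchy_estimate_0 f r M a : 0 < r ->
  (forall z, Cmod z < r -> exists b, has_deriv f z b) ->
  (forall z, Cmod z < r -> Cmod (f z) <= M) ->
  has_deriv f 0 a -> Cmod a <= 4 * M / r.
Proof.
  intros Hr Hf HM Ha.
  set (g := fun z => ((f (Cexp z) - f 0) * / Cexp z)%C).
  assert (Hexp : forall z, Re z < ln r -> Cmod (Cexp z) < r).
  { intros z Hz. rewrite Cmod_Cexp, <- (exp_ln r) by trivial. apply exp_increasing; trivial. }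
  assert (Hg : forall z, Re z < ln r -> exists b, has_deriv g z b).
  { intros z Hz. destruct (Hf (Cexp z) (Hexp z Hz)) as [b Hb].
    assert (diffable (fun q => g (fst q)) (z, RtoC 0)) as [b1 [b2 Hd]].
    { apply diffable_mult.
      - apply diffable_minus; [|apply diffable_const].
        apply (diffable_comp1 f (fun q => Cexp (fst q)) (z, RtoC 0) b); [|exact Hb].
        apply diffable_Cexp, diffable_fst.
      - apply diffable_inv; [|apply Cexp_neq_0]. apply diffable_Cexp, diffable_fst. }
    exists b1. exact (has_diff_has_deriv _ _ _ _ _ Hd). }
  (* The integral of [k s] over [0, 2 pi] is 2 pi i times the mean, over the circle of radius exp s,
     of the difference quotient of f at 0. *)
  set (k := fun (s : R) (t : C) => (Ci * g (RtoC s + Ci * t))%C).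
  assert (Hk : forall s t, s < ln r -> exists b, has_deriv (k s) (RtoC t) b).
  { intros s t Hs.
    assert (diffable (fun q => k s (fst q)) (RtoC t, RtoC 0)) as [b1 [b2 Hd]].
    { apply diffable_mult; [apply diffable_const|].
      apply (diffable_ext (fun q => g (RtoC s + fst q * Ci)%C)).
      { intros q. rewrite (Cmult_comm (fst q)). reflexivity. }
      apply diffable_deriv_affine. apply Hg. unfold Re; simpl. lra. }
    exists b1. exact (has_diff_has_deriv _ _ _ _ _ Hd). }
  pose proof PI_RGT_0 as HPI.
  set (I := fun s => @RInt C_R_CompleteNormedModule (fun t : R => k s (RtoC t)) 0 (2 * PI)).
  assert (EI : forall s, s < ln r ->
    @ex_RInt C_R_CompleteNormedModule (fun t : R => k s (RtoC t)) 0 (2 * PI)).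
  { intros s Hs. apply (@ex_RInt_continuous C_R_CompleteNormedModule). intros t _.
    apply (continuous_of_deriv (k s)). auto. }
  assert (Per : forall s, s + 2 * PI < ln r -> I (s + 2 * PI) = I s).
  { intros s Hs.
    pose proof (Goursat g (ln r) (RtoC s) (2 * PI) Hg ltac:(lra) Hs) as G.
    unfold square_integral in G.
    rewrite (@RInt_ext C_R_CompleteNormedModule _
      (fun t : R => @minus C_R_CompleteNormedModule (k (s + 2 * PI) (RtoC t)) (k s (RtoC t)))) in G.
    - pose proof (@RInt_minus C_R_CompleteNormedModule _ _ _ _
        (EI (s + 2 * PI) Hs) (EI s ltac:(lra))) as E.
      apply Cminus_diag_uniq. etransitivity; [symmetry; exact E|exact G].
    - intros t _.
      change (square_integrand g (RtoC s) (2 * PI) (RtoC t) =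
        (k (s + 2 * PI)%R (RtoC t) - k s (RtoC t))%C).
      unfold square_integrand, k.
      (* The horizontal sides of the square are a period apart and cancel, so only the two vertical
         sides remain. *)
      assert (Eg : g (RtoC s + Ci * RtoC (2 * PI) + RtoC t)%C = g (RtoC s + RtoC t)%C).
      { unfold g. replace (RtoC s + Ci * RtoC (2 * PI) + RtoC t)%C with
          ((RtoC s + RtoC t) + (0, (2 * PI)%R))%C by (apply injective_projections; simpl; ring).
        rewrite Cexp_period. reflexivity. }
      rewrite Eg, RtoC_plus. ring. }
  (* On the circle of radius r/2 the quotient is at most 2 M/(r/2) = 4 M/r, the claimed bound. *)
  set (s0 := ln (r / 2)).
  assert (Es0 : exp s0 = r / 2) by (apply exp_ln; lra).
  assert (Hs0 : s0 < ln r) by (apply ln_increasing; lra).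
  assert (HIn : forall n : nat, I (s0 - INR n * (2 * PI)) = I s0).
  { induction n as [|n IH].
    - simpl. f_equal. ring.
    - rewrite <- IH, <- Per.
      + f_equal. rewrite S_INR. ring.
      + rewrite S_INR. pose proof (pos_INR n). nra. }
  assert (Bnd : forall s N, s < ln r -> (forall t : R, Cmod (k s t) <= N) -> Cmod (I s) <= 2 * PI * N).
  { intros s N Hs HN. replace (2 * PI * N) with ((2 * PI - 0) * N) by ring. rewrite Cmod_norm.
    apply (@norm_RInt_le_const C_R_CompleteNormedModule (fun t : R => k s (RtoC t))); try lra.
    - intros t _. rewrite <- Cmod_norm. auto.
    - apply (@RInt_correct C_R_CompleteNormedModule). auto. }
  assert (Cnd : forall s eps, s < ln r -> (forall t : R, Cmod (k s t - Ci * a) <= eps) ->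
    Cmod (I s - RtoC (2 * PI) * (Ci * a)) <= 2 * PI * eps).
  { intros s eps Hs He. replace (2 * PI * eps) with ((2 * PI - 0) * eps) by ring. rewrite Cmod_norm.
    apply (@norm_RInt_le_const C_R_CompleteNormedModule (fun t : R => (k s (RtoC t) - Ci * a)%C)); try lra.
    - intros t _. rewrite <- Cmod_norm. auto.
    - replace (RtoC (2 * PI) * (Ci * a))%C with
       (@scal R_AbsRing C_R_CompleteNormedModule (2 * PI - 0) (Ci * a)%C).
      + apply (@is_RInt_minus C_R_CompleteNormedModule).
        * apply (@RInt_correct C_R_CompleteNormedModule). auto.
        * apply (@is_RInt_const C_R_CompleteNormedModule).
      + rewrite Rminus_0_r. exact (scal_R_Cmult _ _). }
  assert (Hq : forall z t, Cmod (Cexp z) < r -> t = Cexp z ->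
      Cmod (g z) <= 2 * M / Cmod t).
  { intros z t Hz ->. unfold g. rewrite Cmod_mult, Cmod_inv by apply Cexp_neq_0.
    apply Rmult_le_compat_r.
    - left. apply Rinv_0_lt_compat, Cmod_gt_0, Cexp_neq_0.
    - eapply Rle_trans; [apply Cmod_minus_triangle|].
      pose proof (HM _ Hz). pose proof (HM 0). rewrite Cmod_0 in H0. specialize (H0 Hr). lra. }
  assert (B0 : Cmod (I s0) <= 2 * PI * (4 * M / r)).
  { apply Bnd; trivial. intros t. unfold k. rewrite Cmod_mult, Cmod_Ci, Rmult_1_l.
    set (z := (RtoC s0 + Ci * RtoC t)%C).
    assert (Ez : Cmod (Cexp z) = r / 2).
    { rewrite Cmod_Cexp, <- Es0. f_equal. unfold z, Re; simpl. ring. }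
    eapply Rle_trans; [apply (Hq z _ ltac:(rewrite Ez; lra) eq_refl)|].
    rewrite Ez. right. field. lra. }
  apply Rmult_le_reg_l with (2 * PI); [lra|].
  apply Rnot_lt_le. intros L.
  (* Chosen so that 2 pi [eps] is half the gap between 2 pi |a| and the bound on [I s0]. On a small
     enough circle the integral is that close to 2 pi i a, yet it equals [I s0]. *)
  set (eps := (2 * PI * Cmod a - 2 * PI * (4 * M / r)) / (4 * PI)).
  assert (He : 0 < eps) by (apply Rdiv_lt_0_compat; lra).
  destruct (Ha eps He) as [d [Hd B]].
  assert (exists n, exp (s0 - INR n * (2 * PI)) < d) as [n Hn].
  { destruct (INR_unbounded ((s0 - ln d) / (2 * PI))) as [n Hn]. exists n.
    rewrite <- (exp_ln d) by trivial. apply exp_increasing.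
    apply Rmult_lt_compat_r with (r := 2 * PI) in Hn; [|lra].
    replace ((s0 - ln d) / (2 * PI) * (2 * PI)) with (s0 - ln d) in Hn by (field; lra). lra. }
  set (s := s0 - INR n * (2 * PI)) in *.
  assert (Hs : s < ln r).
  { unfold s. pose proof (pos_INR n). nra. }
  assert (BC : Cmod (I s - RtoC (2 * PI) * (Ci * a)) <= 2 * PI * eps).
  { apply Cnd; trivial. intros t. unfold k.
    set (z := (RtoC s + Ci * RtoC t)%C).
    assert (Ez : Cmod (Cexp z) = exp s).
    { rewrite Cmod_Cexp. f_equal. unfold z, Re; simpl. ring. }
    specialize (B (Cexp z) ltac:(rewrite Ez; trivial)). rewrite Cplus_0_l in B.
    replace (Ci * g z - Ci * a)%C with (Ci * (/ Cexp z * (f (Cexp z) - f 0 - a * Cexp z)))%C.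
    - rewrite !Cmod_mult, Cmod_Ci, Rmult_1_l, Cmod_inv by apply Cexp_neq_0.
      assert (0 < Cmod (Cexp z)) by (apply Cmod_gt_0, Cexp_neq_0).
      apply Rmult_le_reg_l with (Cmod (Cexp z)); trivial.
      rewrite <- Rmult_assoc, Rinv_r by lra. lra.
    - unfold g. field. apply Cexp_neq_0. }
  unfold s in BC. rewrite HIn in BC.
  pose proof (Cmod_triangle_inv (RtoC (2 * PI) * (Ci * a)) (I s0)) as T.
  rewrite Cmod_minus_sym in T.
  rewrite !Cmod_mult, Cmod_Ci, Cmod_R, Rabs_pos_eq, Rmult_1_l in T by lra.
  assert (2 * PI * eps = (2 * PI * Cmod a - 2 * PI * (4 * M / r)) / 2) by (unfold eps; field; lra).
  lra.
Qed.

Definition disc (c : C) (r : R) (z : C) : Prop := Cmod (z - c) < r.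

Lemma cauchy_estimate f c r M a : 0 < r ->
  (forall z, disc c r z -> exists b, has_deriv f z b) ->
  (forall z, disc c r z -> Cmod (f z) <= M) ->
  has_deriv f c a -> Cmod a <= 4 * M / r.
Proof.
  intros Hr Hf HM Ha. unfold disc in *.
  apply (cauchy_estimate_0 (fun z => f (z + c)%C)); trivial.
  - intros z Hz. destruct (Hf (z + c)%C) as [b Hb].
    + replace (z + c - c)%C with z by ring. trivial.
    + exists b. apply has_deriv_shift. trivial.
  - intros z Hz. apply HM. replace (z + c - c)%C with z by ring. trivial.
  - apply has_deriv_shift. rewrite Cplus_0_l. trivial.
Qed.

Lemma mean_value_bound f a b K :
  (forall t, 0 <= t <= 1 -> exists D, has_deriv f (a + RtoC t * (b - a))%C D /\ Cmod D <= K) ->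
  Cmod (f b - f a) <= K * Cmod (b - a).
Proof.
  intros H.
  set (D := fun t => epsilon (inhabits (RtoC 0))
    (fun D => has_deriv f (a + RtoC t * (b - a))%C D /\ Cmod D <= K)).
  assert (HD : forall t, 0 <= t <= 1 -> has_deriv f (a + RtoC t * (b - a))%C (D t) /\ Cmod (D t) <= K).
  { intros t Ht. apply epsilon_spec. auto. }
  (* The mean value theorem is only real, so f is projected onto the direction of f b - f a. Then h
     1 - h 0 = |f b - f a|^2, and one factor cancels at the end. *)
  set (w := Cconj (f b - f a)).
  set (h := fun t : R => Re (w * f (a + RtoC t * (b - a)))%C).
  assert (Hh : forall t, 0 <= t <= 1 -> is_derive h t (Re (w * (D t * (b - a)))%C)).
  { intros t Ht. apply is_derive_Reals. intros eps He. destruct (HD t Ht) as [Hd _].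
    pose proof (has_deriv_comp f (fun t => a + t * (b - a))%C (RtoC t) _ _
      (has_deriv_affine a (b - a)%C (RtoC t)) Hd) as Hc.
    assert (Pw : 0 < Cmod w + 1) by (pose proof (Cmod_ge_0 w); lra).
    destruct (Hc (eps / 2 / (Cmod w + 1))) as [d [Hdp B]].
    { apply Rdiv_lt_0_compat; lra. }
    exists (mkposreal d Hdp). intros x Nx Hx. simpl in Hx.
    specialize (B (RtoC x)). rewrite Cmod_R in B. specialize (B Hx).
    rewrite <- RtoC_plus in B. cbv beta in B.
    set (E := (f (a + RtoC (t + x) * (b - a)) - f (a + RtoC t * (b - a)) -
       D t * (b - a) * RtoC x)%C) in *.
    replace ((h (t + x) - h t) / x - Re (w * (D t * (b - a)))%C) with (Re (w * E)%C / x).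
    - unfold Rdiv. rewrite Rabs_mult, Rabs_inv.
      pose proof (Rabs_pos_lt x Nx) as Px.
      apply Rmult_lt_reg_r with (Rabs x); trivial.
      rewrite Rmult_assoc, Rinv_l, Rmult_1_r by lra.
      eapply Rle_lt_trans; [apply re_le_Cmod|]. rewrite Cmod_mult.
      apply Rle_lt_trans with ((Cmod w + 1) * (eps / 2 / (Cmod w + 1) * Rabs x)).
      + apply Rmult_le_compat; try apply Cmod_ge_0; lra.
      + replace ((Cmod w + 1) * (eps / 2 / (Cmod w + 1) * Rabs x)) with (eps / 2 * Rabs x)
          by (field; lra). nra.
    - unfold h, E. unfold Re; simpl. field. trivial. }
  destruct (MVT_gen h 0 1 (fun t => Re (w * (D t * (b - a)))%C)) as [c [Hc Ec]].
  - intros x Hx. rewrite Rmin_left, Rmax_right in Hx by lra. apply Hh. lra.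
  - intros x Hx. rewrite Rmin_left, Rmax_right in Hx by lra.
    apply derivable_continuous_pt. eexists. apply is_derive_Reals. apply Hh. lra.
  - rewrite Rmin_left, Rmax_right in Hc by lra.
    assert (E1 : h 1 - h 0 = Cmod (f b - f a) * Cmod (f b - f a)).
    { unfold h. replace (a + 1 * (b - a))%C with b by ring. replace (a + 0 * (b - a))%C with a by ring.
      pose proof (Cmod2_conj (f b - f a)) as Q. fold w in Q.
      assert (Q2 : Re (w * (f b - f a))%C = Cmod (f b - f a) ^ 2).
      { rewrite Cmult_comm, <- Q. reflexivity. }
      rewrite <- Rsqr_def, Rsqr_pow2, <- Q2. unfold Re; simpl. ring. }
    rewrite E1, Rminus_0_r, Rmult_1_r in Ec.
    destruct (HD c ltac:(lra)) as [_ HK].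
    set (m := Cmod (f b - f a)) in *.
    assert (m * m <= m * (K * Cmod (b - a))).
    { rewrite Ec. eapply Rle_trans; [apply Rle_abs|]. eapply Rle_trans; [apply re_le_Cmod|].
      rewrite !Cmod_mult. unfold w. rewrite Cmod_conj. fold m.
      apply Rmult_le_compat_l; [apply Cmod_ge_0|]. apply Rmult_le_compat_r; [apply Cmod_ge_0|trivial]. }
    destruct (Rle_lt_or_eq_dec 0 m (Cmod_ge_0 _)) as [P|P].
    + apply Rmult_le_reg_l with m; trivial.
    + rewrite <- P. apply Rmult_le_pos; [|apply Cmod_ge_0].
      eapply Rle_trans; [apply Cmod_ge_0|exact HK].
Qed.

Lemma disc_segment c r x y t : disc c r x -> disc c r y -> 0 <= t <= 1 ->
  disc c r (x + RtoC t * (y - x))%C.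
Proof.
  unfold disc. intros Hx Hy Ht.
  replace (x + RtoC t * (y - x) - c)%C with (RtoC (1 - t) * (x - c) + RtoC t * (y - c))%C
    by (rewrite RtoC_minus; ring).
  eapply Rle_lt_trans; [apply Cmod_triangle|].
  rewrite !Cmod_mult, !Cmod_R, !Rabs_pos_eq by lra.
  destruct (Req_dec t 0); [subst; lra|]. nra.
Qed.

Lemma disc_incl c r x s y : disc c r x -> disc x s y -> disc c (r + s) y.
Proof.
  unfold disc. intros Hx Hy. pose proof (Cmod_dist_triangle y x c). lra.
Qed.

(** Each point of the segment from x to y has a disc of radius r/2 around it inside the large disc,
    so the derivative there is at most 4 M/(r/2). *)
Lemma cauchy_lipschitz f c r M x y : 0 < r ->
  (forall z, disc c r z -> exists b, has_deriv f z b) ->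
  (forall z, disc c r z -> Cmod (f z) <= M) ->
  disc c (r / 2) x -> disc c (r / 2) y ->
  Cmod (f y - f x) <= 8 * M / r * Cmod (y - x).
Proof.
  intros Hr Hf HM Hx Hy. apply mean_value_bound. intros t Ht.
  pose proof (disc_segment _ _ _ _ _ Hx Hy Ht) as Hp.
  set (p := (x + RtoC t * (y - x))%C) in *.
  assert (In : forall z, disc p (r / 2) z -> disc c r z).
  { intros z Hz. pose proof (disc_incl _ _ _ _ _ Hp Hz) as Q.
    replace (r / 2 + r / 2) with r in Q by field. trivial. }
  destruct (Hf p) as [D HD].
  { apply In. unfold disc. replace (p - p)%C with (RtoC 0) by ring. rewrite Cmod_0. lra. }
  exists D. split; trivial.
  replace (8 * M / r) with (4 * M / (r / 2)) by (field; lra).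
  apply (cauchy_estimate f p); auto. lra.
Qed.

(** A second derivative is avoided: f'(c + v) - a is the derivative at c of z |-> f (z + v) - f z,
    which [cauchy_lipschitz] bounds by (8 M/r) |v| on radius r/4. A second Cauchy estimate gives 4
    (8 M/r)/(r/4) = 128 M/r^2, and the mean value bound for f z - a z adds the other factor |x -
    c|. *)
Lemma cauchy_second_order f c r M a x : 0 < r ->
  (forall z, disc c r z -> exists b, has_deriv f z b) ->
  (forall z, disc c r z -> Cmod (f z) <= M) ->
  has_deriv f c a -> disc c (r / 4) x ->
  Cmod (f x - f c - a * (x - c)) <= 128 * M / (r * r) * (Cmod (x - c) * Cmod (x - c)).
Proof.
  intros Hr Hf HM Ha Hx.
  replace (f x - f c - a * (x - c))%C with ((f x - a * x) - (f c - a * c))%C by ring.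
  rewrite <- Rmult_assoc.
  apply (mean_value_bound (fun z => f z - a * z)%C). intros t Ht.
  set (v := (RtoC t * (x - c))%C).
  assert (Hv : Cmod v <= Cmod (x - c)).
  { unfold v. rewrite Cmod_mult, Cmod_R, Rabs_pos_eq by lra. pose proof (Cmod_ge_0 (x - c)). nra. }
  unfold disc in Hx.
  destruct (Hf (c + v)%C) as [b Hb].
  { unfold disc. replace (c + v - c)%C with v by ring. lra. }
  exists (b - a)%C. split.
  { apply has_deriv_minus; trivial.
    pose proof (has_deriv_affine 0 a (c + v)%C) as A.
    intros eps He. destruct (A eps He) as [d [Hd B]]. exists d. split; trivial.
    intros h Hh. specialize (B h Hh).
    replace (a * (c + v + h) - a * (c + v) - a * h)%C with
     (0 + (c + v + h) * a - (0 + (c + v) * a) - a * h)%C by ring. trivial. }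
  assert (Hq : has_deriv (fun z => f (z + v) - f z)%C c (b - a)%C).
  { apply has_deriv_minus; trivial. apply has_deriv_shift; trivial. }
  pose proof (Cmod_ge_0 v) as Pv.
  apply Rle_trans with (4 * (8 * M / r * Cmod v) / (r / 4)).
  - apply (cauchy_estimate (fun z => f (z + v) - f z)%C c); trivial; [lra| |].
    + intros z Hz. destruct (Hf (z + v)%C) as [b1 Hb1].
      { unfold disc in *. replace (z + v - c)%C with ((z - c) + v)%C by ring.
        eapply Rle_lt_trans; [apply Cmod_triangle|]. lra. }
      destruct (Hf z) as [b2 Hb2]; [unfold disc in *; lra|].
      exists (b1 - b2)%C. apply has_deriv_minus; trivial. apply has_deriv_shift; trivial.
    + intros z Hz. unfold disc in *.
      replace (Cmod v) with (Cmod (z + v - z)) by (f_equal; ring).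
      apply (cauchy_lipschitz f c); trivial; unfold disc; [lra|].
      replace (z + v - c)%C with ((z - c) + v)%C by ring.
      eapply Rle_lt_trans; [apply Cmod_triangle|]. lra.
  - replace (4 * (8 * M / r * Cmod v) / (r / 4)) with (128 * M / (r * r) * Cmod v) by (field; lra).
    apply Rmult_le_compat_l; trivial.
    apply Rdiv_le_0_compat; [|nra].
    assert (0 <= M); [|lra].
    eapply Rle_trans; [apply Cmod_ge_0|apply (HM c)].
    unfold disc. replace (c - c)%C with (RtoC 0) by ring. rewrite Cmod_0. lra.
Qed.

(** * Sequences of holomorphic functions on a polydisc *)

Definition Ccv (u : nat -> C) (l : C) : Prop :=
  forall eps, 0 < eps -> exists N : nat, forall n, (N <= n)%nat -> Cmod (u n - l) < eps.

Lemma Ccv_dist u v l m K : Ccv u l -> Ccv v m ->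
  (exists N : nat, forall n, (N <= n)%nat -> Cmod (u n - v n) <= K) -> Cmod (l - m) <= K.
Proof.
  intros Hu Hv [N HN]. apply Rnot_lt_le. intros L.
  destruct (Hu ((Cmod (l - m) - K) / 2)) as [N1 H1]; [lra|].
  destruct (Hv ((Cmod (l - m) - K) / 2)) as [N2 H2]; [lra|].
  set (n := (N + N1 + N2)%nat).
  specialize (HN n ltac:(unfold n; lia)). specialize (H1 n ltac:(unfold n; lia)).
  specialize (H2 n ltac:(unfold n; lia)).
  pose proof (Cmod_dist_triangle l (u n) m). pose proof (Cmod_dist_triangle (u n) (v n) m).
  rewrite (Cmod_minus_sym l (u n)) in H. lra.
Qed.

Lemma Ccv_unique u l m : Ccv u l -> Ccv u m -> l = m.
Proof.
  intros Hl Hm. apply Cminus_diag_uniq, Cmod_eq_0. apply Rle_antisym; [|apply Cmod_ge_0].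
  apply (Ccv_dist u u l m); trivial. exists O. intros n _.
  replace (u n - u n)%C with (RtoC 0) by ring. rewrite Cmod_0. lra.
Qed.

Lemma Ccv_const c : Ccv (fun _ => c) c.
Proof.
  intros eps He. exists O. intros n _. replace (c - c)%C with (RtoC 0) by ring.
  rewrite Cmod_0. trivial.
Qed.

Lemma Ccv_plus u v l m : Ccv u l -> Ccv v m -> Ccv (fun n => u n + v n)%C (l + m)%C.
Proof.
  intros Hu Hv eps He. destruct (Hu (eps / 2)) as [N1 H1]; [lra|].
  destruct (Hv (eps / 2)) as [N2 H2]; [lra|]. exists (N1 + N2)%nat. intros n Hn.
  specialize (H1 n ltac:(lia)). specialize (H2 n ltac:(lia)).
  replace (u n + v n - (l + m))%C with ((u n - l) + (v n - m))%C by ring.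
  eapply Rle_lt_trans; [apply Cmod_triangle|]. lra.
Qed.

Lemma Ccv_scal c u l : Ccv u l -> Ccv (fun n => c * u n)%C (c * l)%C.
Proof.
  intros Hu eps He. pose proof (Cmod_ge_0 c).
  destruct (Hu (eps / (Cmod c + 1))) as [N HN]; [apply Rdiv_lt_0_compat; lra|].
  exists N. intros n Hn. specialize (HN n Hn).
  replace (c * u n - c * l)%C with (c * (u n - l))%C by ring. rewrite Cmod_mult.
  apply Rle_lt_trans with ((Cmod c + 1) * Cmod (u n - l)).
  - apply Rmult_le_compat_r; [apply Cmod_ge_0|lra].
  - apply Rmult_lt_reg_r with (/ (Cmod c + 1)); [apply Rinv_0_lt_compat; lra|].
    field_simplify; [|lra..]. unfold Rdiv in HN. field_simplify in HN; lra.
Qed.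

Lemma Ccv_minus u v l m : Ccv u l -> Ccv v m -> Ccv (fun n => u n - v n)%C (l - m)%C.
Proof.
  intros Hu Hv. replace (l - m)%C with (l + (-(1)) * m)%C by ring.
  intros eps He. destruct (Ccv_plus _ _ _ _ Hu (Ccv_scal (-(1)) _ _ Hv) eps He) as [N HN].
  exists N. intros n Hn. replace (u n - v n)%C with (u n + (-(1)) * v n)%C by ring. auto.
Qed.

Lemma Ccv_shift u l : Ccv u l -> Ccv (fun n => u (S n)) l.
Proof. intros H eps He. destruct (H eps He) as [N HN]. exists N. intros n Hn. apply HN. lia. Qed.

Lemma Ccv_cauchy (u : nat -> C) :
  (forall eps, 0 < eps -> exists N : nat, forall n m, (N <= n)%nat -> (N <= m)%nat ->
     Cmod (u n - u m) < eps) -> exists l, Ccv u l.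
Proof.
  intros H.
  destruct (Rcomplete.R_complete (fun n => Re (u n))) as [x Hx].
  { intros eps He. destruct (H eps He) as [N HN]. exists N. intros n m Hn Hm.
    eapply Rle_lt_trans; [apply (re_le_Cmod (u n - u m))|]. apply HN; lia. }
  destruct (Rcomplete.R_complete (fun n => Im (u n))) as [y Hy].
  { intros eps He. destruct (H eps He) as [N HN]. exists N. intros n m Hn Hm.
    eapply Rle_lt_trans; [apply (im_le_Cmod (u n - u m))|]. apply HN; lia. }
  exists (x, y). intros eps He.
  destruct (Hx (eps / 2)) as [N1 H1]; [lra|]. destruct (Hy (eps / 2)) as [N2 H2]; [lra|].
  exists (N1 + N2)%nat. intros n Hn.
  specialize (H1 n ltac:(lia)). specialize (H2 n ltac:(lia)). unfold R_dist in *.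
  eapply Rle_lt_trans; [apply Cmod_le_re_im|].
  change (Re (u n - (x, y))%C) with (Re (u n) - x). change (Im (u n - (x, y))%C) with (Im (u n) - y).
  lra.
Qed.

Lemma telescoping_bound (u : nat -> C) (s : nat -> R) :
  (forall n, Cmod (u (S n) - u n) <= s n - s (S n)) ->
  forall m n, (m <= n)%nat -> Cmod (u n - u m) <= s m - s n.
Proof.
  intros Hu m n L. induction L as [|n L IH].
  - replace (u m - u m)%C with (RtoC 0) by ring. rewrite Cmod_0. lra.
  - pose proof (Cmod_dist_triangle (u (S n)) (u n) (u m)). specialize (Hu n). lra.
Qed.

(** The majorant is given by its tails [s], so no series has to be summed: [s] is decreasing and
    nonnegative, hence convergent, and this makes u a Cauchy sequence. *)
Lemma Ccv_telescoping (u : nat -> C) (s : nat -> R) : (forall n, 0 <= s n) ->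
  (forall n, Cmod (u (S n) - u n) <= s n - s (S n)) ->
  exists l, Ccv u l /\ Cmod (l - u O) <= s O.
Proof.
  intros Hs Hu.
  pose proof (telescoping_bound u s Hu) as Huu.
  destruct (Ccv_cauchy u) as [l Hl].
  - intros eps He.
    assert (Hdec : forall n, s (S n) <= s n).
    { intros n. specialize (Hu n). pose proof (Cmod_ge_0 (u (S n) - u n)). lra. }
    destruct (ex_finite_lim_seq_decr s 0 Hdec Hs) as [x Hx].
    apply is_lim_seq_spec in Hx.
    destruct (Hx (mkposreal (eps / 4) ltac:(lra))) as [N HN]. simpl in HN.
    exists N. intros n m Hn Hm.
    pose proof (HN N (le_n N)) as HNN.
    pose proof (Huu N n Hn) as A. pose proof (Huu N m Hm) as B.
    pose proof (HN n Hn) as Hsn. pose proof (HN m Hm) as Hsm.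
    apply Rabs_def2 in HNN, Hsn, Hsm.
    pose proof (Cmod_dist_triangle (u n) (u N) (u m)) as T.
    rewrite (Cmod_minus_sym (u N)) in T. lra.
  - exists l. split; trivial.
    apply (Ccv_dist u (fun _ => u O) l (u O)); trivial; [apply Ccv_const|].
    exists O. intros n _. pose proof (Huu O n ltac:(lia)). specialize (Hs n). lra.
Qed.

Definition polydisc (p : C2) (r : R) (q : C2) : Prop :=
  Cmod (fst q - fst p) < r /\ Cmod (snd q - snd p) < r.

Lemma polydisc_center p r : 0 < r -> polydisc p r p.
Proof.
  intros Hr. split; [replace (fst p - fst p)%C with (RtoC 0) by ring
    | replace (snd p - snd p)%C with (RtoC 0) by ring]; rewrite Cmod_0; trivial.
Qed.

Lemma polydisc_incl p r q s t y : polydisc p r q -> polydisc q s y -> r + s <= t -> polydisc p t y.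
Proof.
  intros [A B] [D E] H. split.
  - pose proof (Cmod_dist_triangle (fst y) (fst q) (fst p)). lra.
  - pose proof (Cmod_dist_triangle (snd y) (snd q) (snd p)). lra.
Qed.

Lemma has_diff_line f p h k z a b : has_diff f (fst p + z * h, snd p + z * k)%C a b ->
  has_deriv (fun t => f (fst p + t * h, snd p + t * k)%C) z (a * h + b * k)%C.
Proof.
  intros H.
  apply (has_diff_has_deriv (fun t => f (fst p + t * h, snd p + t * k)%C) z 0 _ (a * 0 + b * 0)%C).
  apply (has_diff_comp f (fun q => fst p + fst q * h)%C (fun q => snd p + fst q * k)%C (z, RtoC 0)); trivial.
  - apply (has_deriv_fst (fun t => fst p + t * h)%C). apply has_deriv_affine.
  - apply (has_deriv_fst (fun t => snd p + t * k)%C). apply has_deriv_affine.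
Qed.

Lemma polydisc_line p r h k D z : 0 < D -> Cmod h <= D -> Cmod k <= D -> Cmod z < r / D ->
  polydisc p r (fst p + z * h, snd p + z * k)%C.
Proof.
  intros HD Hh Hk Hz.
  assert (Hz' : Cmod z * D < r).
  { apply Rmult_lt_compat_r with (r := D) in Hz; trivial.
    replace (r / D * D) with r in Hz by (field; lra). trivial. }
  pose proof (Cmod_ge_0 z). split; simpl.
  - replace (fst p + z * h - fst p)%C with (z * h)%C by ring. rewrite Cmod_mult. nra.
  - replace (snd p + z * k - snd p)%C with (z * k)%C by ring. rewrite Cmod_mult. nra.
Qed.

(** Restriction to the complex line with parameter 0 at x and 1 at y. Around each parameter in
    [0, 1] the line stays in the polydisc on a disc of radius (r/2)/D, where the one-variable Cauchy
    estimate applies; D = 0 is split off because of the division. *)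
Lemma polydisc_lipschitz f p r M x y D : 0 < r ->
  (forall q, polydisc p r q -> diffable f q) ->
  (forall q, polydisc p r q -> Cmod (f q) <= M) ->
  polydisc p (r / 2) x -> polydisc p (r / 2) y ->
  Cmod (fst y - fst x) <= D -> Cmod (snd y - snd x) <= D ->
  Cmod (f y - f x) <= 8 * M / r * D.
Proof.
  intros Hr Hf HM Hx Hy H1 H2.
  destruct (Rle_lt_or_eq_dec 0 D) as [HD|HD].
  { eapply Rle_trans; [apply Cmod_ge_0|exact H1]. }
  2:{ subst D. replace y with x.
      - replace (f x - f x)%C with (RtoC 0) by ring. rewrite Cmod_0. lra.
      - apply injective_projections; symmetry; apply Cminus_diag_uniq, Cmod_eq_0;
        apply Rle_antisym; trivial; apply Cmod_ge_0. }
  set (h := (fst y - fst x)%C) in *. set (k := (snd y - snd x)%C) in *.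
  set (phi := fun t => f (fst x + t * h, snd x + t * k)%C).
  pose proof (mean_value_bound phi 0 1 (8 * M / r * D)) as MV.
  assert (E1 : phi 1 = f y).
  { unfold phi, h, k. f_equal. apply injective_projections; simpl; ring. }
  assert (E0 : phi 0 = f x).
  { unfold phi. f_equal. apply injective_projections; simpl; ring. }
  rewrite E1, E0 in MV. replace (1 - 0)%C with (RtoC 1) in MV by ring.
  rewrite Cmod_1, Rmult_1_r in MV. apply MV. clear MV. intros t Ht.
  replace (0 + RtoC t * 1)%C with (RtoC t) by ring.
  set (q := (fst x + RtoC t * h, snd x + RtoC t * k)%C).
  assert (Hq : polydisc p (r / 2) q).
  { split.
    - apply (disc_segment (fst p) (r / 2) (fst x) (fst y)); trivial; [apply Hx|apply Hy].
    - apply (disc_segment (snd p) (r / 2) (snd x) (snd y)); trivial; [apply Hx|apply Hy]. }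
  assert (In : forall z, disc (RtoC t) (r / 2 / D) z ->
     polydisc p r (fst x + z * h, snd x + z * k)%C).
  { intros z Hz. apply (polydisc_incl p (r / 2) q (r / 2)); [exact Hq| |right; field].
    pose proof (polydisc_line q (r / 2) h k D (z - RtoC t)%C HD H1 H2 Hz) as Q.
    unfold q in Q at 2 3. simpl in Q.
    replace (fst x + z * h, snd x + z * k)%C with
     (fst x + RtoC t * h + (z - RtoC t) * h, snd x + RtoC t * k + (z - RtoC t) * k)%C by (f_equal; ring).
    exact Q. }
  assert (Hd : forall z, disc (RtoC t) (r / 2 / D) z -> exists b, has_deriv phi z b).
  { intros z Hz. destruct (Hf _ (In z Hz)) as [a [b Hab]].
    eexists. apply has_diff_line. exact Hab. }
  assert (Pr : 0 < r / 2 / D) by (apply Rdiv_lt_0_compat; lra).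
  destruct (Hd (RtoC t)) as [b Hb].
  { unfold disc. replace (RtoC t - RtoC t)%C with (RtoC 0) by ring. rewrite Cmod_0. trivial. }
  exists b. split; trivial.
  replace (8 * M / r * D) with (4 * M / (r / 2 / D)) by (field; lra).
  apply (cauchy_estimate phi (RtoC t)); auto. intros z Hz. apply HM. auto.
Qed.

(** On the line through p in direction (h, k) the function is defined on a disc of radius r/D and is
    evaluated at 1; D < r/4 places 1 in the quarter disc required by [cauchy_second_order]. *)
Lemma polydisc_second_order f p r M a b h k D : 0 < D -> D < r / 4 ->
  (forall q, polydisc p r q -> diffable f q) ->
  (forall q, polydisc p r q -> Cmod (f q) <= M) ->
  has_diff f p a b -> Cmod h <= D -> Cmod k <= D ->
  Cmod (f (fst p + h, snd p + k) - f p - a * h - b * k)%C <= 128 * M / (r * r) * (D * D).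
Proof.
  intros HD Hr Hf HM Hab Hh Hk.
  set (phi := fun t => f (fst p + t * h, snd p + t * k)%C).
  assert (E1 : phi 1 = f (fst p + h, snd p + k)%C).
  { unfold phi. f_equal. apply injective_projections; simpl; ring. }
  assert (Ep : (fst p + 0 * h, snd p + 0 * k)%C = p).
  { apply injective_projections; simpl; ring. }
  assert (E0 : phi 0 = f p) by (unfold phi; rewrite Ep; trivial).
  pose proof (cauchy_second_order phi 0 (r / D) M (a * h + b * k)%C 1) as Q.
  rewrite E1, E0 in Q. replace (1 - 0)%C with (RtoC 1) in Q by ring.
  rewrite Cmod_1, !Rmult_1_r, Cmult_1_r in Q.
  replace (f (fst p + h, snd p + k) - f p - a * h - b * k)%C with
    (f (fst p + h, snd p + k) - f p - (a * h + b * k))%C by ring.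
  replace (128 * M / (r * r) * (D * D)) with (128 * M / (r / D * (r / D))) by (field; lra).
  assert (Hz : forall z, disc 0 (r / D) z -> polydisc p r (fst p + z * h, snd p + z * k)%C).
  { intros z Hz. unfold disc in Hz. replace (z - 0)%C with z in Hz by ring.
    apply polydisc_line with (D := D); trivial. }
  apply Q.
  - apply Rdiv_lt_0_compat; lra.
  - intros z Hz'. destruct (Hf _ (Hz z Hz')) as [a' [b' Hab']].
    eexists. apply has_diff_line. exact Hab'.
  - intros z Hz'. apply HM, Hz; trivial.
  - apply has_diff_line. rewrite Ep. trivial.
  - unfold disc. replace (1 - 0)%C with (RtoC 1) by ring. rewrite Cmod_1.
    apply Rmult_lt_reg_r with D; trivial. replace (r / D / 4 * D) with (r / 4) by (field; lra). lra.
Qed.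

(* The second order estimate is uniform in n, so the differentials converge because the
   difference quotients do. *)
Lemma weierstrass (f : nat -> C2 -> C) (g : C2 -> C) p r M : 0 < r ->
  (forall n q, polydisc p r q -> diffable (f n) q) ->
  (forall n q, polydisc p r q -> Cmod (f n q) <= M) ->
  (forall q, polydisc p r q -> Ccv (fun n => f n q) (g q)) ->
  diffable g p.
Proof.
  intros Hr Hf HM Hcv.
  assert (Hp : polydisc p r p) by (apply polydisc_center; trivial).
  assert (PM : 0 <= M) by (eapply Rle_trans; [apply Cmod_ge_0|apply (HM O p Hp)]).
  set (K := 128 * M / (r * r)).
  assert (PK : 0 <= K) by (apply Rdiv_le_0_compat; nra).
  assert (Hab : forall n, exists ab : C * C, has_diff (f n) p (fst ab) (snd ab)).
  { intros n. destruct (Hf n p Hp) as [a [b H]]. exists (a, b). exact H. }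
  set (ab := fun n => proj1_sig (constructive_indefinite_description _ (Hab n))).
  assert (Hab' : forall n, has_diff (f n) p (fst (ab n)) (snd (ab n))).
  { intros n. unfold ab. destruct (constructive_indefinite_description _ (Hab n)); trivial. }
  clearbody ab. clear Hab.
  assert (SO : forall n h k D, 0 < D -> D < r / 4 -> Cmod h <= D -> Cmod k <= D ->
    Cmod (f n (fst p + h, snd p + k) - f n p - fst (ab n) * h - snd (ab n) * k)%C <= K * (D * D)).
  { intros n h k D HD HDr Hh Hk. apply polydisc_second_order; auto. }
  assert (In : forall h k, Cmod h < r -> Cmod k < r -> polydisc p r (fst p + h, snd p + k)%C).
  { intros h k Hh Hk. split; simpl.
    - replace (fst p + h - fst p)%C with h by ring; trivial.
    - replace (snd p + k - snd p)%C with k by ring; trivial. }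
  assert (Lin : forall h k : C, Cmod h <= 1 -> Cmod k <= 1 ->
    exists l, Ccv (fun n => fst (ab n) * h + snd (ab n) * k)%C l).
  { intros h k Hh Hk. apply Ccv_cauchy. intros eps He.
    (* Replacing the differential by the increment at scale D costs K D^2 <= (eps/8) D, once for n
       and once for m; the four values at q and p are each within (eps/8) D of their limits. The
       total stays below eps D. *)
    set (D := Rmin (r / 8) (eps / (8 * (K + 1)))).
    assert (HD : 0 < D) by (apply Rmin_glb_lt; [lra|apply Rdiv_lt_0_compat; lra]).
    assert (HD1 : D <= r / 8) by apply Rmin_l.
    assert (HD2 : D <= eps / (8 * (K + 1))) by apply Rmin_r.
    assert (HD3 : K * D <= eps / 8).
    { apply Rle_trans with ((K + 1) * (eps / (8 * (K + 1)))).
      - apply Rmult_le_compat; lra.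
      - right. field. lra. }
    assert (Hh' : Cmod (RtoC D * h) <= D).
    { rewrite Cmod_mult, Cmod_R, Rabs_pos_eq by lra. pose proof (Cmod_ge_0 h). nra. }
    assert (Hk' : Cmod (RtoC D * k) <= D).
    { rewrite Cmod_mult, Cmod_R, Rabs_pos_eq by lra. pose proof (Cmod_ge_0 k). nra. }
    set (q := (fst p + RtoC D * h, snd p + RtoC D * k)%C).
    destruct (Hcv q) with (eps := eps * D / 8) as [N1 H1]; [apply In; lra|nra|].
    destruct (Hcv p Hp (eps * D / 8)) as [N2 H2]; [nra|].
    exists (N1 + N2)%nat. intros n m Hn Hm.
    pose proof (H1 n ltac:(lia)) as A1. pose proof (H1 m ltac:(lia)) as A2.
    pose proof (H2 n ltac:(lia)) as A3. pose proof (H2 m ltac:(lia)) as A4.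
    pose proof (SO n _ _ D HD ltac:(lra) Hh' Hk') as S1.
    pose proof (SO m _ _ D HD ltac:(lra) Hh' Hk') as S2.
    fold q in S1, S2.
    set (X := (fst (ab n) * h + snd (ab n) * k - (fst (ab m) * h + snd (ab m) * k))%C).
    assert (EX : (RtoC D * X)%C =
     (((f n q - g q) - (f m q - g q)) - ((f n p - g p) - (f m p - g p)) +
      ((f m q - f m p - fst (ab m) * (RtoC D * h) - snd (ab m) * (RtoC D * k)) -
       (f n q - f n p - fst (ab n) * (RtoC D * h) - snd (ab n) * (RtoC D * k))))%C).
    { unfold X. ring. }
    assert (BX : Cmod (RtoC D * X) < eps * D).
    { rewrite EX. eapply Rle_lt_trans; [apply Cmod_triangle|].
      pose proof (Cmod_minus_triangle ((f n q - g q) - (f m q - g q)) ((f n p - g p) - (f m p - g p))) as T1.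
      pose proof (Cmod_minus_triangle (f n q - g q) (f m q - g q)) as T2.
      pose proof (Cmod_minus_triangle (f n p - g p) (f m p - g p)) as T3.
      pose proof (Cmod_minus_triangle
       (f m q - f m p - fst (ab m) * (RtoC D * h) - snd (ab m) * (RtoC D * k))
       (f n q - f n p - fst (ab n) * (RtoC D * h) - snd (ab n) * (RtoC D * k))) as T4.
      assert (K * (D * D) <= eps / 8 * D) by nra. nra. }
    rewrite Cmod_mult, Cmod_R, Rabs_pos_eq in BX by lra.
    apply Rmult_lt_reg_l with D; trivial. lra. }
  destruct (Lin 1 0) as [a Ha]; [rewrite Cmod_1; lra|rewrite Cmod_0; lra|].
  destruct (Lin 0 1) as [b Hb]; [rewrite Cmod_0; lra|rewrite Cmod_1; lra|].
  exists a, b. intros eps He.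
  exists (Rmin (r / 8) (eps / (K + 1))). split.
  { apply Rmin_glb_lt; [lra|]. apply Rdiv_lt_0_compat; lra. }
  intros h k Hh Hk.
  assert (H1 := Rlt_le_trans _ _ _ Hh (Rmin_l _ _)).
  assert (H2 := Rlt_le_trans _ _ _ Hh (Rmin_r _ _)).
  assert (H3 := Rlt_le_trans _ _ _ Hk (Rmin_l _ _)).
  assert (H4 := Rlt_le_trans _ _ _ Hk (Rmin_r _ _)).
  set (D := Rmax (Cmod h) (Cmod k)).
  assert (DD : D < r / 8 /\ D < eps / (K + 1)) by (unfold D; split; apply Rmax_lub_lt; trivial).
  assert (Dh : Cmod h <= D) by apply Rmax_l. assert (Dk : Cmod k <= D) by apply Rmax_r.
  assert (Dhk : D <= Cmod h + Cmod k).
  { apply Rmax_lub; pose proof (Cmod_ge_0 h); pose proof (Cmod_ge_0 k); lra. }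
  assert (D0 : 0 <= D) by (pose proof (Cmod_ge_0 h); lra).
  destruct (Rle_lt_or_eq_dec 0 D D0) as [HD|HD].
  - apply Rle_trans with (K * (D * D)).
    + set (q := (fst p + h, snd p + k)%C).
      replace (g q - g p - a * h - b * k)%C with ((g q - g p) - (a * h + b * k))%C by ring.
      (* The second sequence is the differential of [f n] applied to (h, k), written through its
         values on (1, 0) and (0, 1), whose limits a and b are known. The uniform bound K D^2 passes
         to the limit. *)
      apply (Ccv_dist (fun n => f n q - f n p)%C (fun n => h * (fst (ab n) * 1 + snd (ab n) * 0) + k * (fst (ab n) * 0 + snd (ab n) * 1))%C).
      * apply Ccv_minus; apply Hcv; [|trivial]. apply In; lra.
      * rewrite (Cmult_comm a), (Cmult_comm b). apply Ccv_plus; apply Ccv_scal; trivial.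
      * exists O. intros n _.
        replace (f n q - f n p - (h * (fst (ab n) * 1 + snd (ab n) * 0) + k * (fst (ab n) * 0 + snd (ab n) * 1)))%C
         with (f n q - f n p - fst (ab n) * h - snd (ab n) * k)%C by ring.
        apply SO; lra.
    + assert ((K + 1) * D <= eps).
      { apply Rle_trans with ((K + 1) * (eps / (K + 1))).
        - apply Rmult_le_compat_l; lra.
        - right; field; lra. }
      apply Rle_trans with (eps * D); nra.
  - assert (h = 0) by (apply Cmod_eq_0; pose proof (Cmod_ge_0 h); lra).
    assert (k = 0) by (apply Cmod_eq_0; pose proof (Cmod_ge_0 k); lra).
    subst h k. replace (fst p + 0, snd p + 0)%C with p by (apply injective_projections; simpl; ring).
    replace (g p - g p - a * 0 - b * 0)%C with (RtoC 0) by ring. rewrite Cmod_0. lra.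
Qed.

(** * Perturbations of the identity *)

Section Picard.

Variables (c : C2) (E1 E2 : C2 -> C).
Hypothesis HE1 : forall q, polydisc c 2 q -> diffable E1 q.
Hypothesis HE2 : forall q, polydisc c 2 q -> diffable E2 q.
Hypothesis BE1 : forall q, polydisc c 2 q -> Cmod (E1 q) <= / 32.
Hypothesis BE2 : forall q, polydisc c 2 q -> Cmod (E2 q) <= / 32.

(** The constant 8 M/r of [polydisc_lipschitz] with M = 1/32 and r = 2 is 1/8; the price is the
    passage from radius 2 to radius 1. *)
Lemma picard_contraction x y D : polydisc c 1 x -> polydisc c 1 y ->
  Cmod (fst y - fst x) <= D -> Cmod (snd y - snd x) <= D ->
  Cmod (E1 y - E1 x) <= / 8 * D /\ Cmod (E2 y - E2 x) <= / 8 * D.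
Proof.
  intros Hx Hy H1 H2. replace (/ 8) with (8 * / 32 / 2) by field.
  split; apply (polydisc_lipschitz _ c); trivial; try lra; replace (2 / 2) with 1 by field; trivial.
Qed.

Lemma picard_unique x y : polydisc c 1 x -> polydisc c 1 y ->
  (fst x + E1 x)%C = (fst y + E1 y)%C -> (snd x + E2 x)%C = (snd y + E2 y)%C -> x = y.
Proof.
  intros Hx Hy H1 H2. set (D := Rmax (Cmod (fst y - fst x)) (Cmod (snd y - snd x))).
  assert (D1 : Cmod (fst y - fst x) <= D) by apply Rmax_l.
  assert (D2 : Cmod (snd y - snd x) <= D) by apply Rmax_r.
  destruct (picard_contraction x y D Hx Hy D1 D2) as [A B].
  assert (F1 : (fst y - fst x)%C = (- (E1 y - E1 x))%C).
  { apply Cminus_diag_uniq. transitivity ((fst y + E1 y) - (fst x + E1 x))%C; [ring|].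
    rewrite H1. ring. }
  assert (F2 : (snd y - snd x)%C = (- (E2 y - E2 x))%C).
  { apply Cminus_diag_uniq. transitivity ((snd y + E2 y) - (snd x + E2 x))%C; [ring|].
    rewrite H2. ring. }
  assert (D <= / 8 * D).
  { unfold D at 1. rewrite F1, F2, !Cmod_opp. apply Rmax_lub; trivial. }
  pose proof (Cmod_ge_0 (fst y - fst x)). pose proof (Cmod_ge_0 (snd y - snd x)).
  symmetry. apply injective_projections; apply Cminus_diag_uniq, Cmod_eq_0; lra.
Qed.

(** Solves v + E v = q by iterating v |-> q - E v from the centre. For q within 1/2 of [c] the
    iterates stay within 1/2 + 1/32 < 3/4 of [c], where the contraction is available. *)
Fixpoint picard_iter (n : nat) (q : C2) : C2 :=
  match n with
  | O => c
  | S n => (fst q - E1 (picard_iter n q), snd q - E2 (picard_iter n q))%C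
  end.

Lemma picard_iter_in n q : polydisc c (/ 2) q -> polydisc c (3 / 4) (picard_iter n q).
Proof.
  intros [H1 H2]. induction n as [|n IH].
  - apply polydisc_center. lra.
  - assert (IH' : polydisc c 2 (picard_iter n q)) by (destruct IH; split; lra).
    pose proof (BE1 _ IH'). pose proof (BE2 _ IH'). split; simpl.
    + replace (fst q - E1 (picard_iter n q) - fst c)%C with
        ((fst q - fst c) - E1 (picard_iter n q))%C by ring.
      eapply Rle_lt_trans; [apply Cmod_minus_triangle|]. lra.
    + replace (snd q - E2 (picard_iter n q) - snd c)%C with
        ((snd q - snd c) - E2 (picard_iter n q))%C by ring.
      eapply Rle_lt_trans; [apply Cmod_minus_triangle|]. lra.
Qed.

Lemma picard_iter_diffable n q : polydisc c (/ 2) q ->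
  diffable (fun x => fst (picard_iter n x)) q /\ diffable (fun x => snd (picard_iter n x)) q.
Proof.
  intros Hq. induction n as [|n [IH1 IH2]].
  - split; simpl; apply diffable_const.
  - assert (In : polydisc c 2 (picard_iter n q)).
    { destruct (picard_iter_in n q Hq). split; lra. }
    assert (Ex : forall E, (fun x => E (picard_iter n x)) =
      (fun x : C2 => E (fst (picard_iter n x), snd (picard_iter n x)) : C)).
    { intros E. apply functional_extensionality. intros x.
      rewrite <- surjective_pairing. reflexivity. }
    split; simpl; apply diffable_minus; try apply diffable_fst; try apply diffable_snd;
      rewrite Ex; apply diffable_comp; trivial; rewrite <- surjective_pairing; auto.
Qed.

(** The first step is shorter than 3/4, and the rate 1/8 is weakened to 1/2, so that the steps are
    the differences of the tails 2 (1/2)^n. *)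
Lemma picard_iter_step n q : polydisc c (/ 2) q ->
  Cmod (fst (picard_iter (S n) q) - fst (picard_iter n q)) <= (/ 2) ^ n /\
  Cmod (snd (picard_iter (S n) q) - snd (picard_iter n q)) <= (/ 2) ^ n.
Proof.
  intros Hq. induction n as [|n [IH1 IH2]].
  - destruct (picard_iter_in 1 q Hq). simpl in *. split; lra.
  - assert (W : forall m, polydisc c 1 (picard_iter m q)).
    { intros m. destruct (picard_iter_in m q Hq). split; lra. }
    destruct (picard_contraction _ _ _ (W n) (W (S n)) IH1 IH2) as [A B].
    assert (P : 0 < (/ 2) ^ n) by (apply pow_lt; lra).
    split.
    + change (fst (picard_iter (S (S n)) q)) with (fst q - E1 (picard_iter (S n) q))%C.
      change (fst (picard_iter (S n) q)) with (fst q - E1 (picard_iter n q))%C.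
      match goal with |- Cmod ?e <= _ => replace e with
       (- (E1 (picard_iter (S n) q) - E1 (picard_iter n q)))%C by ring end.
      rewrite Cmod_opp. simpl pow. lra.
    + change (snd (picard_iter (S (S n)) q)) with (snd q - E2 (picard_iter (S n) q))%C.
      change (snd (picard_iter (S n) q)) with (snd q - E2 (picard_iter n q))%C.
      match goal with |- Cmod ?e <= _ => replace e with
       (- (E2 (picard_iter (S n) q) - E2 (picard_iter n q)))%C by ring end.
      rewrite Cmod_opp. simpl pow. lra.
Qed.

Lemma picard : exists V1 V2 : C2 -> C, forall q, polydisc c (/ 2) q ->
  polydisc c 1 (V1 q, V2 q) /\
  (V1 q + E1 (V1 q, V2 q))%C = fst q /\ (V2 q + E2 (V1 q, V2 q))%C = snd q /\
  diffable V1 q /\ diffable V2 q.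
Proof.
  assert (L : forall q, exists v : C2, polydisc c (/ 2) q ->
    Ccv (fun n => fst (picard_iter n q)) (fst v) /\ Ccv (fun n => snd (picard_iter n q)) (snd v)).
  { intros q. destruct (classic (polydisc c (/ 2) q)) as [Hq|Hq].
    - destruct (Ccv_telescoping (fun n => fst (picard_iter n q)) (fun n => 2 * (/ 2) ^ n)) as [v1 [H1 _]].
      + intros n. pose proof (pow_lt (/ 2) n ltac:(lra)). lra.
      + intros n. destruct (picard_iter_step n q Hq) as [A _]. simpl pow. simpl pow in A. lra.
      + destruct (Ccv_telescoping (fun n => snd (picard_iter n q)) (fun n => 2 * (/ 2) ^ n)) as [v2 [H2 _]].
        * intros n. pose proof (pow_lt (/ 2) n ltac:(lra)). lra.
        * intros n. destruct (picard_iter_step n q Hq) as [_ A]. simpl pow. simpl pow in A. lra.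
        * exists (v1, v2). intros _. split; trivial.
    - exists c. intros; contradiction. }
  set (V := fun q => proj1_sig (constructive_indefinite_description _ (L q))).
  assert (HV : forall q, polydisc c (/ 2) q -> Ccv (fun n => fst (picard_iter n q)) (fst (V q)) /\
     Ccv (fun n => snd (picard_iter n q)) (snd (V q))).
  { intros q. unfold V. destruct (constructive_indefinite_description _ (L q)); trivial. }
  clearbody V. clear L.
  exists (fun q => fst (V q)), (fun q => snd (V q)). intros q Hq.
  rewrite <- surjective_pairing.
  destruct (HV q Hq) as [H1 H2].
  assert (In : polydisc c 1 (V q)).
  (* Strict bounds become weak in the limit, hence the margin between 3/4 and 1. *)
  { split; apply Rle_lt_trans with (3 / 4); try lra.
    - apply (Ccv_dist _ _ _ _ _ H1 (Ccv_const (fst c))). exists O. intros n _.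
      left. apply picard_iter_in; trivial.
    - apply (Ccv_dist _ _ _ _ _ H2 (Ccv_const (snd c))). exists O. intros n _.
      left. apply picard_iter_in; trivial. }
  assert (EE : Ccv (fun n => E1 (picard_iter n q)) (E1 (V q)) /\
    Ccv (fun n => E2 (picard_iter n q)) (E2 (V q))).
  { assert (W : forall m, polydisc c 1 (picard_iter m q)).
    { intros m. destruct (picard_iter_in m q Hq). split; lra. }
    split; intros eps He; destruct (H1 eps He) as [N1 B1]; destruct (H2 eps He) as [N2 B2];
      exists (N1 + N2)%nat; intros n Hn;
      destruct (picard_contraction (V q) (picard_iter n q) eps In (W n)) as [A B];
      try (left; apply B1; lia); try (left; apply B2; lia); lra. }
  destruct EE as [EE1 EE2].
  split; [trivial|]. split; [|split; [|split]].
  - assert (Ccv (fun n => fst (picard_iter (S n) q)) (fst q - E1 (V q))%C) as A.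
    { simpl. apply Ccv_minus; trivial. apply Ccv_const. }
    rewrite (Ccv_unique _ _ _ (Ccv_shift _ _ H1) A). ring.
  - assert (Ccv (fun n => snd (picard_iter (S n) q)) (snd q - E2 (V q))%C) as A.
    { simpl. apply Ccv_minus; trivial. apply Ccv_const. }
    rewrite (Ccv_unique _ _ _ (Ccv_shift _ _ H2) A). ring.
  - set (r := Rmin (/ 2 - Cmod (fst q - fst c)) (/ 2 - Cmod (snd q - snd c))).
    destruct Hq as [Q1 Q2].
    assert (Hr : 0 < r) by (apply Rmin_glb_lt; lra).
    assert (Sub : forall x, polydisc q r x -> polydisc c (/ 2) x).
    { intros x [X1 X2]. assert (R1 := Rmin_l _ _ : r <= _). assert (R2 := Rmin_r _ _ : r <= _).
      pose proof (Cmod_dist_triangle (fst x) (fst q) (fst c)).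
      pose proof (Cmod_dist_triangle (snd x) (snd q) (snd c)). split; lra. }
    apply (weierstrass (fun n x => fst (picard_iter n x)) _ q r (Cmod (fst c) + 1)); trivial.
    + intros n x Hx. apply picard_iter_diffable; auto.
    + intros n x Hx. destruct (picard_iter_in n x (Sub x Hx)) as [A _].
      pose proof (Cmod_triangle_inv (fst (picard_iter n x)) (fst c)). lra.
    + intros x Hx. apply HV; auto.
  - set (r := Rmin (/ 2 - Cmod (fst q - fst c)) (/ 2 - Cmod (snd q - snd c))).
    destruct Hq as [Q1 Q2].
    assert (Hr : 0 < r) by (apply Rmin_glb_lt; lra).
    assert (Sub : forall x, polydisc q r x -> polydisc c (/ 2) x).
    { intros x [X1 X2]. assert (R1 := Rmin_l _ _ : r <= _). assert (R2 := Rmin_r _ _ : r <= _).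
      pose proof (Cmod_dist_triangle (fst x) (fst q) (fst c)).
      pose proof (Cmod_dist_triangle (snd x) (snd q) (snd c)). split; lra. }
    apply (weierstrass (fun n x => snd (picard_iter n x)) _ q r (Cmod (snd c) + 1)); trivial.
    + intros n x Hx. apply picard_iter_diffable; auto.
    + intros n x Hx. destruct (picard_iter_in n x (Sub x Hx)) as [_ A].
      pose proof (Cmod_triangle_inv (snd (picard_iter n x)) (snd c)). lra.
    + intros x Hx. apply HV; auto.
Qed.

End Picard.

(** * Holomorphic maps of C^2 in coordinates *)

Lemma locally_polydisc (p : C2) (P : C2 -> Prop) :
  @locally C2_NM p P <-> exists r, 0 < r /\ forall q, polydisc p r q -> P q.
Proof.
  split.
  - intros [d Hd]. exists d. split; [apply cond_pos|]. intros q [H1 H2]. apply Hd.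
    split; apply C_NormedModule_mixin_compat1; assumption.
  - intros [r [Hr H]]. assert (Hs : 0 < r / 2) by lra.
    exists (mkposreal (r / 2) Hs). intros q [H1 H2]. apply H.
    (* Balls of the uniform structure on C are squares; one of half-side r/2 lies in the disc of
       radius sqrt 2 (r/2). *)
    assert (sqrt 2 * (r / 2) <= r) as Q.
    { assert (sqrt 2 <= 2); [|nra]. rewrite <- (sqrt_square 2) at 2 by lra. apply sqrt_le_1; lra. }
    split; (eapply Rlt_le_trans; [|exact Q]).
    + exact (C_NormedModule_mixin_compat2 _ _ _ H1).
    + exact (C_NormedModule_mixin_compat2 _ _ _ H2).
Qed.

Lemma open_polydisc (U : C2 -> Prop) :
  @open C2_NM U <-> forall p, U p -> exists r, 0 < r /\ forall q, polydisc p r q -> U q.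
Proof.
  split; intros H p Hp.
  - apply locally_polydisc. apply H. trivial.
  - apply locally_polydisc. auto.
Qed.

Lemma norm2_fst (p : C2) : Cmod (fst p) <= norm2 p.
Proof.
  change (norm2 p) with (sqrt (Cmod (fst p) ^ 2 + Cmod (snd p) ^ 2)).
  rewrite <- (sqrt_pow2 (Cmod (fst p))) at 1 by apply Cmod_ge_0.
  apply sqrt_le_1_alt. pose proof (pow2_ge_0 (Cmod (snd p))). lra.
Qed.

Lemma norm2_snd (p : C2) : Cmod (snd p) <= norm2 p.
Proof.
  change (norm2 p) with (sqrt (Cmod (fst p) ^ 2 + Cmod (snd p) ^ 2)).
  rewrite <- (sqrt_pow2 (Cmod (snd p))) at 1 by apply Cmod_ge_0.
  apply sqrt_le_1_alt. pose proof (pow2_ge_0 (Cmod (fst p))). lra.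
Qed.

Lemma norm2_le (p : C2) : norm2 p <= Cmod (fst p) + Cmod (snd p).
Proof.
  change (norm2 p) with (sqrt (Cmod (fst p) ^ 2 + Cmod (snd p) ^ 2)).
  pose proof (Cmod_ge_0 (fst p)). pose proof (Cmod_ge_0 (snd p)).
  rewrite <- (sqrt_pow2 (Cmod (fst p) + Cmod (snd p))) by lra.
  apply sqrt_le_1_alt. nra.
Qed.

Definition diffable2 (f : C2 -> C2) (p : C2) : Prop :=
  diffable (fun q => fst (f q)) p /\ diffable (fun q => snd (f q)) p.

Lemma diffable_comp2 g f p : diffable2 f p -> diffable g (f p) -> diffable (fun q => g (f q)) p.
Proof.
  intros [H1 H2] Hg. apply (diffable_ext (fun q => g (fst (f q), snd (f q)))).
  - intros q. rewrite <- surjective_pairing. reflexivity.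
  - apply diffable_comp; trivial. rewrite <- surjective_pairing. trivial.
Qed.

Lemma diffable2_comp g f p : diffable2 f p -> diffable2 g (f p) -> diffable2 (fun q => g (f q)) p.
Proof.
  intros Hf [H1 H2]. split.
  - apply (diffable_comp2 (fun q => fst (g q))); trivial.
  - apply (diffable_comp2 (fun q => snd (g q))); trivial.
Qed.

Lemma diffable_ext_loc f g p : (exists r, 0 < r /\ forall q, polydisc p r q -> f q = g q) ->
  diffable f p -> diffable g p.
Proof.
  intros [r [Hr E]] [a [b H]]. exists a, b. revert H. apply has_diff_ext_loc.
  exists r. split; trivial. intros h k Hh Hk. apply E. split; simpl.
  - replace (fst p + h - fst p)%C with h by ring; trivial.
  - replace (snd p + k - snd p)%C with k by ring; trivial.
Qed.

Lemma diffable2_iterate f n p : (forall q, diffable2 f q) -> diffable2 (iterate f n) p.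
Proof.
  intros Hf. induction n as [|n IH].
  - split; [apply diffable_fst|apply diffable_snd].
  - apply (diffable2_comp f (iterate f n)); trivial.
Qed.

Lemma diffable2_continuous f p r : diffable2 f p -> 0 < r ->
  exists d, 0 < d /\ forall q, polydisc p d q -> polydisc (f p) r (f q).
Proof.
  intros [H1 H2] Hr.
  destruct (has_diff_continuous _ _ H1 r Hr) as [d1 [Hd1 B1]].
  destruct (has_diff_continuous _ _ H2 r Hr) as [d2 [Hd2 B2]].
  exists (Rmin d1 d2). split; [apply Rmin_glb_lt; trivial|].
  intros q [Q1 Q2]. pose proof (Rmin_l d1 d2). pose proof (Rmin_r d1 d2).
  split; [apply B1|apply B2]; lra.
Qed.

(** By complex linearity the differential is determined by its values at (1, 0) and (0, 1), which
    serve as the two partial derivatives. *)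
Lemma ex_filterdiff_diffable2 (f : C2 -> C2) (p : C2) :
  @ex_filterdiff C_AbsRing C2_NM C2_NM f (@locally C2_NM p) -> diffable2 f p.
Proof.
  intros [L [HL HD]].
  assert (Hlin : forall h k : C, fst (L (h, k)) = (fst (L (RtoC 1, RtoC 0)) * h + fst (L (RtoC 0, RtoC 1)) * k)%C /\
     snd (L (h, k)) = (snd (L (RtoC 1, RtoC 0)) * h + snd (L (RtoC 0, RtoC 1)) * k)%C).
  { intros h k.
    assert (E : ((h, k) : C2_NM) = @plus C2_NM (@scal C_AbsRing C2_NM h (RtoC 1, RtoC 0))
       (@scal C_AbsRing C2_NM k (RtoC 0, RtoC 1))).
    { change ((h, k) = ((h * 1 + k * 0)%C, (h * 0 + k * 1)%C)). f_equal; ring. }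
    rewrite E, (linear_plus L HL), !(linear_scal L HL).
    split.
    - change ((h * fst (L (RtoC 1, RtoC 0)) + k * fst (L (RtoC 0, RtoC 1)))%C =
        (fst (L (RtoC 1, RtoC 0)) * h + fst (L (RtoC 0, RtoC 1)) * k)%C). ring.
    - change ((h * snd (L (RtoC 1, RtoC 0)) + k * snd (L (RtoC 0, RtoC 1)))%C =
        (snd (L (RtoC 1, RtoC 0)) * h + snd (L (RtoC 0, RtoC 1)) * k)%C). ring. }
  assert (HB : forall eps, 0 < eps -> exists d, 0 < d /\ forall h k, Cmod h < d -> Cmod k < d ->
    Cmod (fst (f (fst p + h, snd p + k)%C) - fst (f p) - fst (L (RtoC 1, RtoC 0)) * h - fst (L (RtoC 0, RtoC 1)) * k) <= eps * (Cmod h + Cmod k) /\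
    Cmod (snd (f (fst p + h, snd p + k)%C) - snd (f p) - snd (L (RtoC 1, RtoC 0)) * h - snd (L (RtoC 0, RtoC 1)) * k) <= eps * (Cmod h + Cmod k)).
  { intros eps He. specialize (HD p (fun P HP => HP) (mkposreal eps He)).
    apply locally_polydisc in HD. destruct HD as [r [Hr HD]].
    exists r. split; trivial. intros h k Hh Hk.
    set (q := ((fst p + h)%C, (snd p + k)%C) : C2).
    assert (Hq : polydisc p r q).
    { split; simpl.
      - replace (fst p + h - fst p)%C with h by ring; trivial.
      - replace (snd p + k - snd p)%C with k by ring; trivial. }
    specialize (HD q Hq). simpl in HD.
    set (w := @minus C2_NM (@minus C2_NM (f q) (f p)) (L (@minus C2_NM q p))) in HD.
    assert (Ew : @minus C2_NM q p = (h, k)).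
    { change ((fst q - fst p)%C, (snd q - snd p)%C) with
        ((fst p + h - fst p)%C, (snd p + k - snd p)%C).
      change (((fst p + h - fst p)%C, (snd p + k - snd p)%C) = (h, k)). f_equal; ring. }
    assert (HN : norm2 w <= eps * (Cmod h + Cmod k)).
    { eapply Rle_trans; [exact HD|]. apply Rmult_le_compat_l; [lra|].
      change (norm2 (@minus C2_NM q p) <= Cmod h + Cmod k). rewrite Ew. apply norm2_le. }
    destruct (Hlin h k) as [L1 L2].
    split.
    - eapply Rle_trans; [|exact HN]. eapply Rle_trans; [|apply norm2_fst].
      change (fst w) with (fst (f q) - fst (f p) - fst (L (@minus C2_NM q p)))%C. rewrite Ew, L1.
      right. f_equal. unfold q. ring.
    - eapply Rle_trans; [|exact HN]. eapply Rle_trans; [|apply norm2_snd].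
      change (snd w) with (snd (f q) - snd (f p) - snd (L (@minus C2_NM q p)))%C. rewrite Ew, L2.
      right. f_equal. unfold q. ring. }
  split; do 2 eexists; intros eps He; destruct (HB eps He) as [d [Hd B]]; exists d;
    (split; [trivial|]); intros h k Hh Hk; destruct (B h k Hh Hk); eassumption.
Qed.

Lemma diffable2_ex_filterdiff (f : C2 -> C2) (p : C2) : diffable2 f p ->
  @ex_filterdiff C_AbsRing C2_NM C2_NM f (@locally C2_NM p).
Proof.
  intros [[a1 [b1 H1]] [a2 [b2 H2]]].
  set (L := fun v : C2 => ((a1 * fst v + b1 * snd v)%C, (a2 * fst v + b2 * snd v)%C) : C2).
  exists (L : C2_NM -> C2_NM). split.
  - split.
    + intros x y.
      change ((a1 * (fst x + fst y) + b1 * (snd x + snd y), a2 * (fst x + fst y) + b2 * (snd x + snd y))%C =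
       ((a1 * fst x + b1 * snd x + (a1 * fst y + b1 * snd y))%C,
        (a2 * fst x + b2 * snd x + (a2 * fst y + b2 * snd y))%C)). f_equal; ring.
    + intros k x.
      change ((a1 * (k * fst x) + b1 * (k * snd x), a2 * (k * fst x) + b2 * (k * snd x))%C =
       ((k * (a1 * fst x + b1 * snd x))%C, (k * (a2 * fst x + b2 * snd x))%C)). f_equal; ring.
    + exists (Cmod a1 + Cmod b1 + Cmod a2 + Cmod b2 + 1).
      pose proof (Cmod_ge_0 a1) as Pa1. pose proof (Cmod_ge_0 b1) as Pb1.
      pose proof (Cmod_ge_0 a2) as Pa2. pose proof (Cmod_ge_0 b2) as Pb2.
      split; [lra|].
      change (forall x : C2, norm2 (L x) <= (Cmod a1 + Cmod b1 + Cmod a2 + Cmod b2 + 1) * norm2 x).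
      intros x.
      eapply Rle_trans; [apply norm2_le|]. unfold L; simpl.
      pose proof (Cmod_triangle (a1 * fst x) (b1 * snd x)) as T1.
      pose proof (Cmod_triangle (a2 * fst x) (b2 * snd x)) as T2.
      rewrite !Cmod_mult in T1, T2.
      pose proof (Cmod_ge_0 (fst x)). pose proof (norm2_fst x).
      pose proof (Rmult_le_compat_l _ _ _ Pa1 (norm2_fst x)).
      pose proof (Rmult_le_compat_l _ _ _ Pb1 (norm2_snd x)).
      pose proof (Rmult_le_compat_l _ _ _ Pa2 (norm2_fst x)).
      pose proof (Rmult_le_compat_l _ _ _ Pb2 (norm2_snd x)).
      lra.
  - intros x Hx.
    assert (x = p) as ->.
    { symmetry. apply (@is_filter_lim_locally_unique C_AbsRing C2_NM). exact Hx. }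
    intros eps. apply locally_polydisc.
    assert (He : 0 < eps / 4) by (pose proof (cond_pos eps); lra).
    destruct (H1 _ He) as [d1 [Hd1 B1]]. destruct (H2 _ He) as [d2 [Hd2 B2]].
    exists (Rmin d1 d2). split; [apply Rmin_glb_lt; trivial|].
    change (forall q : C2, polydisc p (Rmin d1 d2) q ->
      norm2 (@minus C2_NM (@minus C2_NM (f q) (f p)) (L (@minus C2_NM q p))) <=
      eps * norm2 (@minus C2_NM q p)).
    intros q [Q1 Q2].
    assert (Rmin d1 d2 <= d1) by apply Rmin_l. assert (Rmin d1 d2 <= d2) by apply Rmin_r.
    set (h := (fst q - fst p)%C) in *. set (k := (snd q - snd p)%C) in *.
    specialize (B1 h k ltac:(lra) ltac:(lra)). specialize (B2 h k ltac:(lra) ltac:(lra)).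
    assert (Eq : (fst p + h, snd p + k)%C = q).
    { apply injective_projections; unfold h, k; simpl; ring. }
    rewrite Eq in B1, B2.
    set (w := ((fst (f q) - fst (f p) - (a1 * h + b1 * k))%C,
      (snd (f q) - snd (f p) - (a2 * h + b2 * k))%C) : C2).
    change (norm2 w <= eps * norm2 (@minus C2_NM q p)).
    eapply Rle_trans; [apply norm2_le|]. unfold w; simpl fst; simpl snd.
    replace (fst (f q) - fst (f p) - (a1 * h + b1 * k))%C with
      (fst (f q) - fst (f p) - a1 * h - b1 * k)%C by ring.
    replace (snd (f q) - snd (f p) - (a2 * h + b2 * k))%C with
      (snd (f q) - snd (f p) - a2 * h - b2 * k)%C by ring.
    pose proof (norm2_fst (@minus C2_NM q p)) as N1. pose proof (norm2_snd (@minus C2_NM q p)) as N2.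
    change (Cmod h <= norm2 (@minus C2_NM q p)) in N1.
    change (Cmod k <= norm2 (@minus C2_NM q p)) in N2.
    pose proof (cond_pos eps). nra.
Qed.

Lemma holomorphic_on_diffable2 U f : holomorphic_on U f <->
  @open C2_NM U /\ forall p, U p -> diffable2 f p.
Proof.
  split; intros [HU H]; split; trivial; intros p Hp.
  - apply ex_filterdiff_diffable2. auto.
  - apply diffable2_ex_filterdiff. auto.
Qed.

(** * Continuous real functions on C^2 *)

Definition contR (f : C2 -> R) (p : C2) : Prop :=
  forall eps, 0 < eps -> exists d, 0 < d /\ forall q, polydisc p d q -> Rabs (f q - f p) < eps.

Lemma contR_re f p : diffable f p -> contR (fun q => Re (f q)) p.
Proof.
  intros H eps He. destruct (has_diff_continuous f p H eps He) as [d [Hd B]].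
  exists d. split; trivial. intros q [Q1 Q2].
  eapply Rle_lt_trans; [apply (re_le_Cmod (f q - f p))|]. auto.
Qed.

Lemma contR_im f p : diffable f p -> contR (fun q => Im (f q)) p.
Proof.
  intros H eps He. destruct (has_diff_continuous f p H eps He) as [d [Hd B]].
  exists d. split; trivial. intros q [Q1 Q2].
  eapply Rle_lt_trans; [apply (im_le_Cmod (f q - f p))|]. auto.
Qed.

Lemma contR_Cmod f p : diffable f p -> contR (fun q => Cmod (f q)) p.
Proof.
  intros H eps He. destruct (has_diff_continuous f p H eps He) as [d [Hd B]].
  exists d. split; trivial. intros q [Q1 Q2]. specialize (B q Q1 Q2).
  pose proof (Cmod_triangle_inv (f q) (f p)) as T1.
  pose proof (Cmod_triangle_inv (f p) (f q)) as T2. rewrite Cmod_minus_sym in T2.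
  apply Rabs_def1; lra.
Qed.

Lemma contR_minus f g p : contR f p -> contR g p -> contR (fun q => f q - g q) p.
Proof.
  intros Hf Hg eps He. destruct (Hf (eps / 2)) as [d1 [Hd1 B1]]; [lra|].
  destruct (Hg (eps / 2)) as [d2 [Hd2 B2]]; [lra|].
  exists (Rmin d1 d2). split; [apply Rmin_glb_lt; trivial|]. intros q [Q1 Q2].
  pose proof (Rmin_l d1 d2). pose proof (Rmin_r d1 d2).
  specialize (B1 q ltac:(split; lra)). specialize (B2 q ltac:(split; lra)).
  apply Rabs_def2 in B1, B2. apply Rabs_def1; lra.
Qed.

Lemma contR_comp phi f p : contR f p -> continuity_pt phi (f p) -> contR (fun q => phi (f q)) p.
Proof.
  intros Hf Hphi eps He. destruct (continuity_pt_bound phi _ Hphi eps He) as [d [Hd B]].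
  destruct (Hf d Hd) as [d' [Hd' B']]. exists d'. split; trivial. intros q Q. auto.
Qed.

Lemma contR_const c p : contR (fun _ => c) p.
Proof. intros eps He. exists 1. split; [lra|]. intros q _. rewrite Rminus_diag, Rabs_R0. trivial. Qed.

Lemma contR_pos_open f g p : contR f p -> contR g p -> f p < g p ->
  exists d, 0 < d /\ forall q, polydisc p d q -> f q < g q.
Proof.
  intros Hf Hg Hp. destruct (contR_minus g f p Hg Hf (g p - f p)) as [d [Hd B]]; [lra|].
  exists d. split; trivial. intros q Q. specialize (B q Q). apply Rabs_def2 in B. lra.
Qed.

(** * Asymptotics of one step *)

Lemma RtoC_neq (x y : R) : x <> y -> RtoC x <> RtoC y.
Proof. intros H E. apply H, RtoC_inj, E. Qed.

Lemma exp_le x y : x <= y -> exp x <= exp y.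
Proof. intros [H| ->]; [left; apply exp_increasing; trivial|lra]. Qed.

Lemma ln_le_minus_1 x : 0 < x -> ln x <= x - 1.
Proof.
  intros Hx. pose proof (exp_ineq1_le (ln x)) as H. rewrite exp_ln in H by trivial. lra.
Qed.

Lemma Re_1_plus_pos x : Cmod x < 1 -> 0 < Re (1 + x)%C.
Proof.
  intros H. pose proof (re_le_Cmod x) as R. change (Re (1 + x)%C) with (1 + Re x).
  assert (Rabs (Re x) < 1) as A by lra. apply Rabs_def2 in A. lra.
Qed.

Lemma Cmod_Clog_le z : 0 < Cmod z -> Cmod (Clog z) <= Rabs (ln (Cmod z)) + 2.
Proof.
  intros Hz. eapply Rle_trans; [apply Cmod_le_re_im|]. rewrite Re_Clog.
  pose proof (Im_Clog z). pose proof PI_4. lra.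
Qed.

(** On this disc |1 + x| is between 1/4 and 7/4, so its logarithm is at most 3 in modulus, and the
    argument contributes less than 2. *)
Lemma Clog_1_plus_bound x : Cmod x < 3 / 4 -> Cmod (Clog (1 + x)) <= 5.
Proof.
  intros H. pose proof (Cmod_triangle_inv 1 (- x)) as T1. pose proof (Cmod_triangle 1 x) as T2.
  rewrite Cmod_opp, Cmod_1 in T1. rewrite Cmod_1 in T2.
  replace (1 - - x)%C with (1 + x)%C in T1 by ring.
  set (m := Cmod (1 + x)) in *. assert (Pm : 0 < m) by lra.
  eapply Rle_trans; [apply Cmod_Clog_le; exact Pm|]. fold m.
  assert (Rabs (ln m) <= 3); [|lra].
  apply Rabs_le. split.
  - pose proof (ln_le_minus_1 (/ m) (Rinv_0_lt_compat _ Pm)) as L. rewrite ln_Rinv in L by trivial.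
    assert (/ m <= 4); [|lra]. rewrite <- (Rinv_inv 4). apply Rinv_le_contravar; lra.
  - pose proof (ln_le_minus_1 m Pm). lra.
Qed.

Lemma Clog_1 : Clog 1 = 0.
Proof.
  rewrite <- Cexp_0. apply Clog_Cexp.
  - simpl. rewrite Rabs_R0. pose proof PI_RGT_0. lra.
  - rewrite Cexp_0. simpl. lra.
Qed.

Lemma has_deriv_Clog_1_plus x : Cmod x < 3 / 4 -> has_deriv (fun t => Clog (1 + t)) x (/ (1 + x))%C.
Proof.
  intros H eps He.
  destruct (has_deriv_Clog (1 + x)%C (Re_1_plus_pos x ltac:(lra)) eps He) as [d [Hd B]].
  exists d. split; trivial. intros h Hh.
  replace (1 + (x + h))%C with (1 + x + h)%C by ring. auto.
Qed.

Lemma disc_0 r z : disc 0 r z -> Cmod z < r.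
Proof. unfold disc. replace (z - 0)%C with z by ring. trivial. Qed.

(** [cauchy_second_order] with M = 5 and r = 3/4: 128 times 5, divided by 9/16, is below 1200, and
    3/16 is r/4. *)
Lemma Clog_second_order x : Cmod x < 3 / 16 ->
  Cmod (Clog (1 + x) - x) <= 1200 * (Cmod x * Cmod x).
Proof.
  intros H. pose proof (cauchy_second_order (fun t => Clog (1 + t)) 0 (3 / 4) 5 1 x) as Q.
  cbv beta in Q. replace (1 + 0)%C with (RtoC 1) in Q by ring. rewrite Clog_1 in Q.
  replace (Clog (1 + x) - 0 - 1 * (x - 0))%C with (Clog (1 + x) - x)%C in Q by ring.
  replace (x - 0)%C with x in Q by ring.
  eapply Rle_trans; [apply Q|].
  - lra.
  - intros z Hz. eexists. apply has_deriv_Clog_1_plus, disc_0; trivial.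
  - intros z Hz. apply Clog_1_plus_bound, disc_0; trivial.
  - pose proof (has_deriv_Clog_1_plus 0 ltac:(rewrite Cmod_0; lra)) as D.
    replace (/ (1 + 0))%C with (RtoC 1) in D; [exact D|].
    rewrite Cplus_0_r. rewrite <- RtoC_inv by lra. f_equal. lra.
  - unfold disc. replace (x - 0)%C with x by ring. lra.
  - pose proof (Cmod_ge_0 x). nra.
Qed.

(** 226 = 1200 (3/16) + 1. *)
Lemma Clog_1_plus_le x : Cmod x < 3 / 16 -> Cmod (Clog (1 + x)) <= 226 * Cmod x.
Proof.
  intros H. pose proof (Clog_second_order x H) as S. pose proof (Cmod_ge_0 x).
  replace (Clog (1 + x)) with ((Clog (1 + x) - x) + x)%C by ring.
  eapply Rle_trans; [apply Cmod_triangle|]. nra.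
Qed.

(** With b = a (1 + x) and |x| <= [eta], the difference of the logarithms is [Clog (1 + x)]. Only
    the relative distance matters, so points far out in the half-plane may be some distance
    apart. *)
Lemma Clog_diff a b eta : 0 < Re a -> 0 < Re b -> eta < 3 / 16 -> Cmod (b - a) <= eta * Cmod a ->
  Cmod (Clog b - Clog a) <= 226 * eta.
Proof.
  intros Ha Hb He H.
  assert (Pa : 0 < Cmod a) by (pose proof (re_le_Cmod a); rewrite Rabs_pos_eq in *; lra).
  assert (Na : a <> 0) by (apply Cmod_gt_0; trivial).
  set (x := ((b - a) / a)%C).
  assert (Hx : Cmod x <= eta).
  { unfold x. rewrite Cmod_div by trivial. apply Rmult_le_reg_r with (Cmod a); trivial.
    unfold Rdiv. rewrite Rmult_assoc, Rinv_l by lra. lra. }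
  assert (Eb : b = (a * (1 + x))%C) by (unfold x; field; trivial).
  rewrite Eb, Clog_mult; trivial.
  - replace (Clog a + Clog (1 + x) - Clog a)%C with (Clog (1 + x)) by ring.
    eapply Rle_trans; [apply Clog_1_plus_le; lra|]. lra.
  - apply Re_1_plus_pos. lra.
  - rewrite <- Eb. trivial.
Qed.

Lemma Cmod_inv_le (q : C) : Cmod (q - 1) <= / 2 -> q <> 0 /\ Cmod (/ q) <= 2.
Proof.
  intros H. pose proof (Cmod_triangle_inv 1 (1 - q)) as T.
  rewrite Cmod_1, (Cmod_minus_sym 1 q) in T.
  replace (1 - (1 - q))%C with q in T by ring.
  assert (Nq : q <> 0) by (apply Cmod_gt_0; lra).
  split; trivial. rewrite Cmod_inv by trivial.
  rewrite <- (Rinv_inv 2). apply Rinv_le_contravar; lra.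
Qed.

(* The quotients q = u'/u and v = lam w'/w of one step determine the increments of
   1/u and of log w; the combinations below are chosen so that the terms of order u cancel. *)
Lemma step_increments K : 0 < K -> exists d K', 0 < d /\ 0 < K' /\
  forall u q v : C, u <> 0 -> Cmod u < d ->
    Cmod (q - (1 - u + u * u / 4)) <= K * Cmod u ^ 3 ->
    Cmod (v - (1 - u / 2)) <= K * Cmod u ^ 2 ->
    q <> 0 /\ v <> 0 /\ 0 < Re q /\ 0 < Re v /\
    Cmod (/ (u * q) - / u - 1) <= / 2 /\
    Cmod (/ (u * q) - / u - 1 + 3 / 4 * Clog q) <= K' * Cmod u ^ 2 /\
    Cmod (Clog v - 1 / 2 * Clog q) <= K' * Cmod u ^ 2.
Proof.
  intros HK.
  (* [A] is the constant of the quadratic error in 1/(uq), namely 2 + 2 K doubled by |1/q| <= 2; [d]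
     makes A |u| <= 1/100. In [K'] the term 1200 times 4 comes from the second-order bound for the
     logarithm with |q - 1| <= 2 |u|. *)
  set (A := 4 + 4 * K).
  set (K' := A + (1200 * 4 + 1 + K) + (1200 * 4 + 1 + K)).
  set (d := Rmin (/ 100) (/ (100 * A))).
  exists d, K'.
  assert (Hd : 0 < d) by (apply Rmin_glb_lt; [lra|apply Rinv_0_lt_compat; unfold A; lra]).
  split; trivial. split; [unfold K', A; lra|].
  intros u q v Nu Hu Hq Hv.
  assert (D1 : d <= / 100) by apply Rmin_l. assert (D2 : d <= / (100 * A)) by apply Rmin_r.
  pose proof (proj1 (Cmod_gt_0 u) Nu) as Pu. set (a := Cmod u) in *.
  assert (Ka : A * a <= / 100).
  { apply Rle_trans with (A * / (100 * A)).
    - apply Rmult_le_compat_l; unfold A in *; lra.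
    - right. field. unfold A; lra. }
  assert (Ka' : K * a <= / 400) by (unfold A in Ka; nra).
  assert (Ca2 : Cmod (u * u) = a * a) by (rewrite Cmod_mult; trivial).
  assert (C4 : forall z : C, Cmod (z / 4) = Cmod z / 4).
  { intros z. rewrite Cmod_div by (apply RtoC_neq; lra). rewrite Cmod_R, Rabs_pos_eq by lra. trivial. }
  assert (C2' : forall z : C, Cmod (z / 2) = Cmod z / 2).
  { intros z. rewrite Cmod_div by (apply RtoC_neq; lra). rewrite Cmod_R, Rabs_pos_eq by lra. trivial. }
  assert (Cq : forall x y : R, 0 < y -> 0 <= x -> Cmod (x / y) = x / y).
  { intros x y Hy Hx. rewrite <- RtoC_div by lra. rewrite Cmod_R. apply Rabs_pos_eq.
    apply Rdiv_le_0_compat; lra. }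
  assert (C34 : Cmod (3 / 4) = 3 / 4) by (apply Cq; lra).
  assert (C316 : Cmod (3 / 16) = 3 / 16) by (apply Cq; lra).
  assert (C12 : Cmod (1 / 2) = 1 / 2) by (apply Cq; lra).
  assert (a2 : a ^ 3 <= a ^ 2 * / 100) by (simpl; nra).
  assert (Ka3 : K * a ^ 3 <= / 400 * a ^ 2) by (simpl; nra).
  assert (Ka2 : K * a ^ 2 <= / 400 * a) by (simpl; nra).
  set (dq := (q - (1 - u + u * u / 4))%C) in *. set (dv := (v - (1 - u / 2))%C) in *.
  assert (Hq1u : Cmod (q - 1 + u) <= (1 + K) * a ^ 2).
  { replace (q - 1 + u)%C with (dq + u * u / 4)%C by (unfold dq; ring).
    eapply Rle_trans; [apply Cmod_triangle|]. rewrite C4, Ca2. simpl in *. nra. }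
  assert (Hq1 : Cmod (q - 1) <= 2 * a).
  { replace (q - 1)%C with ((q - 1 + u) - u)%C by ring.
    eapply Rle_trans; [apply Cmod_minus_triangle|]. fold a. simpl in *. nra. }
  assert (Hv1 : Cmod (v - 1) <= 2 * a).
  { replace (v - 1)%C with (dv - u / 2)%C by (unfold dv; ring).
    eapply Rle_trans; [apply Cmod_minus_triangle|]. rewrite C2'. fold a. lra. }
  destruct (Cmod_inv_le q ltac:(lra)) as [Nq Bq]. destruct (Cmod_inv_le v ltac:(lra)) as [Nv _].
  assert (Lq : Cmod (Clog q - (q - 1)) <= 1200 * 4 * a ^ 2).
  { pose proof (Clog_second_order (q - 1) ltac:(lra)) as S.
    replace (1 + (q - 1))%C with q in S by ring.
    eapply Rle_trans; [exact S|]. pose proof (Cmod_ge_0 (q - 1)). simpl; nra. }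
  assert (Lv : Cmod (Clog v - (v - 1)) <= 1200 * 4 * a ^ 2).
  { pose proof (Clog_second_order (v - 1) ltac:(lra)) as S.
    replace (1 + (v - 1))%C with v in S by ring.
    eapply Rle_trans; [exact S|]. pose proof (Cmod_ge_0 (v - 1)). simpl; nra. }
  (* 1/q = 1 + u + (3/4) u^2 + O(u^3) *)
  assert (I3 : Cmod (/ (u * q) - / u - 1 - 3 / 4 * u) <= A * a ^ 2).
  (* (1 - u + u^2/4) (1 + u + (3/4) u^2) = 1 - u^3/2 + (3/16) u^4. Hence [E] is (1 - q (1 + u +
     (3/4) u^2))/u, and dividing it by q gives the quantity to be bounded. *)
  { set (E := (1 / 2 * (u * u) - 3 / 16 * (u * u * u) - dq / u * (1 + u + 3 / 4 * (u * u)))%C).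
    replace (/ (u * q) - / u - 1 - 3 / 4 * u)%C with (/ q * E)%C.
    2:{ unfold E, dq. field. repeat split; trivial; apply RtoC_neq; lra. }
    rewrite Cmod_mult.
    assert (HE : Cmod E <= (2 + 2 * K) * a ^ 2).
    { unfold E. eapply Rle_trans; [apply Cmod_minus_triangle|].
      assert (Cmod (1 / 2 * (u * u) - 3 / 16 * (u * u * u)) <= a ^ 2).
      { eapply Rle_trans; [apply Cmod_minus_triangle|]. rewrite !Cmod_mult. fold a.
        rewrite ?C34, ?C316, ?C12. simpl; nra. }
      assert (Cmod (dq / u * (1 + u + 3 / 4 * (u * u))) <= K * a ^ 2 * 2).
      { rewrite Cmod_mult. apply Rmult_le_compat; try apply Cmod_ge_0.
        - rewrite Cmod_div by trivial. fold a. apply Rmult_le_reg_r with a; trivial.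
          unfold Rdiv. rewrite Rmult_assoc, Rinv_l by lra. simpl in *. lra.
        - eapply Rle_trans; [apply Cmod_triangle|].
          pose proof (Cmod_triangle 1 u) as T. rewrite Cmod_1 in T. fold a in T.
          rewrite !Cmod_mult. fold a. rewrite ?C34, ?C316, ?C12. nra. }
      pose proof (pow2_ge_0 a). lra. }
    apply Rle_trans with (2 * ((2 + 2 * K) * a ^ 2)).
    - apply Rmult_le_compat; try apply Cmod_ge_0; trivial.
    - unfold A. right. ring. }
  assert (Lqu : Cmod (Clog q + u) <= (1200 * 4 + 1 + K) * a ^ 2).
  { replace (Clog q + u)%C with ((Clog q - (q - 1)) + (q - 1 + u))%C by ring.
    eapply Rle_trans; [apply Cmod_triangle|]. lra. }
  assert (Rq : 0 < Re q).
  { replace q with (1 + (q - 1))%C by ring. apply Re_1_plus_pos. lra. }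
  assert (Rv : 0 < Re v).
  { replace v with (1 + (v - 1))%C by ring. apply Re_1_plus_pos. lra. }
  repeat split; trivial.
  - replace (/ (u * q) - / u - 1)%C with ((/ (u * q) - / u - 1 - 3 / 4 * u) + 3 / 4 * u)%C by ring.
    eapply Rle_trans; [apply Cmod_triangle|]. rewrite Cmod_mult. fold a.
    rewrite ?C34, ?C316, ?C12.
    assert (A * a ^ 2 <= / 100 * a).
    { replace (A * a ^ 2) with (A * a * a) by ring. apply Rmult_le_compat_r; lra. }
    lra.
  - replace (/ (u * q) - / u - 1 + 3 / 4 * Clog q)%C with
      ((/ (u * q) - / u - 1 - 3 / 4 * u) + 3 / 4 * (Clog q + u))%C by ring.
    eapply Rle_trans; [apply Cmod_triangle|]. rewrite Cmod_mult.
    rewrite ?C34, ?C316, ?C12.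
    pose proof (Cmod_ge_0 (Clog q + u)). unfold K'.
    assert (0 <= (1200 * 4 + 1 + K) * a ^ 2) by (simpl; nra). lra.
  - replace (Clog v - 1 / 2 * Clog q)%C with
      (((Clog v - (v - 1)) + dv) - 1 / 2 * (Clog q + u))%C
      by (unfold dv; field; repeat split; apply RtoC_neq; lra).
    eapply Rle_trans; [apply Cmod_minus_triangle|].
    pose proof (Cmod_triangle (Clog v - (v - 1)) dv) as T.
    rewrite Cmod_mult. rewrite ?C34, ?C316, ?C12.
    pose proof (Cmod_ge_0 (Clog q + u)). unfold K'.
    assert (0 <= A * a ^ 2) by (unfold A; simpl; nra).
    assert (0 <= a ^ 2) by (simpl; nra). lra.
Qed.

(** With b = |u|^beta bounding |z| and |w|, the hypothesis on beta (l + 1) gives b^(l + 1) <= |u|^4,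
    and |u| <= b then gives b^l <= |u|^3. The factor w in front of the remainder is what allows the
    second coordinate to be divided by w. *)
Lemma step_quotients lam l Fc beta : Cmod lam = 1 -> has_expansion lam l Fc ->
  0 < beta < 1 / 2 -> beta * INR (l + 1) >= 4 ->
  exists d K, 0 < d /\ 0 < K /\ forall z w : C,
    (z * w)%C <> 0 -> Cmod (z * w) < d ->
    Cmod z < Rpower (Cmod (z * w)) beta -> Cmod w < Rpower (Cmod (z * w)) beta ->
    exists q v : C,
     (fst (Fc (z, w)) * snd (Fc (z, w)))%C = (z * w * q)%C /\
     (lam * snd (Fc (z, w)))%C = (w * v)%C /\
     Cmod (q - (1 - z * w + z * w * (z * w) / 4)) <= K * Cmod (z * w) ^ 3 /\
     Cmod (v - (1 - z * w / 2)) <= K * Cmod (z * w) ^ 2.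
Proof.
  intros Hlam [h [M0 [delta [Hdelta Hexp]]]] Hbeta Hbl.
  set (M := Rabs M0 + 1). assert (HM : 0 < M) by (unfold M; pose proof (Rabs_pos M0); lra).
  set (K := M * 2 ^ l). assert (HK : 0 < K) by (apply Rmult_lt_0_compat; [trivial|apply pow_lt; lra]).
  (* The second entry is the value of |u| at which b = delta/4; below it the norm of (z, w) is at
     most 2 b < delta, so the expansion applies. *)
  set (d := Rmin (/ 2) (Rpower (delta / 4) (/ beta))).
  exists d, (3 * K + K * K).
  assert (Hd : 0 < d) by (apply Rmin_glb_lt; [lra|apply exp_pos]).
  split; trivial. split; [nra|]. intros z w Nzw Hu Hz Hw.
  set (u := (z * w)%C) in *. pose proof (proj1 (Cmod_gt_0 u) Nzw) as Pu.
  set (a := Cmod u) in *. set (b := Rpower a beta) in *.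
  assert (D1 : a < / 2) by (eapply Rlt_le_trans; [exact Hu|apply Rmin_l]).
  assert (D2 : a < Rpower (delta / 4) (/ beta)) by (eapply Rlt_le_trans; [exact Hu|apply Rmin_r]).
  assert (Pb : 0 < b) by apply exp_pos.
  assert (Bd : b < delta / 4).
  { unfold b. replace (delta / 4) with (Rpower (Rpower (delta / 4) (/ beta)) beta).
    - apply Rlt_Rpower_l; lra.
    - rewrite Rpower_mult, Rinv_l, Rpower_1 by lra. trivial. }
  assert (Lna : ln a < 0) by (rewrite <- ln_1; apply ln_increasing; lra).
  assert (Bab : a <= b).
  { unfold b, Rpower. rewrite <- (exp_ln a) at 1 by trivial. apply exp_le. nra. }
  assert (Bb1 : b <= 1).
  { unfold b, Rpower. rewrite <- exp_0. apply exp_le. nra. }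
  assert (Bl1 : b ^ (l + 1) <= a ^ 4).
  { rewrite <- Rpower_pow by trivial. rewrite <- (Rpower_pow 4 a) by trivial.
    unfold b. rewrite Rpower_mult. unfold Rpower. apply exp_le.
    replace (INR 4) with 4 by (simpl; ring). nra. }
  assert (Bl : b ^ l <= a ^ 3).
  { rewrite pow_add, pow_1 in Bl1. apply Rmult_le_reg_r with b; trivial.
    eapply Rle_trans; [exact Bl1|]. change (a ^ 4) with (a * a ^ 3).
    assert (0 < a ^ 3) by (apply pow_lt; trivial). nra. }
  set (N := norm2 (z, w)).
  assert (BN : N <= 2 * b).
  { unfold N. eapply Rle_trans; [apply norm2_le|]. simpl. lra. }
  assert (PN : 0 <= N) by (eapply Rle_trans; [apply Cmod_ge_0|apply (norm2_fst (z, w))]).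
  destruct (Hexp z w) as [Hh EF]; [fold N; lra|].
  set (h1 := fst (h (z, w))) in *. set (h2 := snd (h (z, w))) in *.
  assert (BH : norm2 (h (z, w)) <= K * b ^ l).
  { eapply Rle_trans; [exact Hh|]. fold N. unfold K. rewrite Rmult_assoc, <- Rpow_mult_distr.
    assert (0 <= N ^ l) by (apply pow_le; trivial).
    assert (N ^ l <= (2 * b) ^ l) by (apply pow_incr; split; trivial).
    assert (M0 <= M) by (unfold M; pose proof (Rle_abs M0); lra).
    apply Rle_trans with (M * N ^ l); [apply Rmult_le_compat_r; lra|].
    apply Rmult_le_compat_l; lra. }
  assert (H1l : Cmod h1 <= K * b ^ l) by (eapply Rle_trans; [apply norm2_fst|exact BH]).
  assert (H2l : Cmod h2 <= K * b ^ l) by (eapply Rle_trans; [apply norm2_snd|exact BH]).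
  assert (H1 : Cmod h1 <= K * a ^ 3) by nra. assert (H2 : Cmod h2 <= K * a ^ 3) by nra.
  (* Needed for the terms with w^2, which is not a multiple of u: |w|^2 can only be bounded by b^2,
     and b^(l + 2) <= b^(l + 1) <= |u|^4 because b <= 1. *)
  assert (Hbb : K * b ^ l * (b * b) <= K * a ^ 4).
  { rewrite Rmult_assoc. apply Rmult_le_compat_l; [lra|].
    rewrite pow_add, pow_1 in Bl1. assert (0 <= b ^ l) by (apply pow_le; lra).
    assert (0 <= b ^ l * b) by nra. nra. }
  assert (Nw : w <> 0). { intros E. apply Nzw. unfold u. rewrite E. ring. }
  rewrite EF. simpl fst. simpl snd. fold u.
  assert (Ell : (lam * Cconj lam)%C = 1).
  { rewrite <- Cmod2_conj, Hlam. apply (f_equal RtoC). ring. }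
  (* What the product of the two coordinates contains besides u (1 - u/2)^2. *)
  set (rem := (lam * u * (1 - u / 2) * h2 + Cconj lam * (w * w) * (1 - u / 2) * h1 + w * w * h1 * h2)%C).
  exists ((1 - u / 2) * (1 - u / 2) + rem / u)%C, (1 - u / 2 + lam * h2)%C.
  assert (N2 : RtoC 2 <> 0) by (apply RtoC_neq; lra). assert (N4 : RtoC 4 <> 0) by (apply RtoC_neq; lra).
  assert (Bu2 : Cmod (1 - u / 2) <= 3 / 2).
  { eapply Rle_trans; [apply Cmod_minus_triangle|]. rewrite Cmod_1, Cmod_div by trivial.
    rewrite Cmod_R, Rabs_pos_eq by lra. fold a. lra. }
  pose proof (Cmod_ge_0 h1) as P1. pose proof (Cmod_ge_0 h2) as P2.
  pose proof (Cmod_ge_0 z) as Pz. pose proof (Cmod_ge_0 w) as Pw.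
  pose proof (Cmod_ge_0 (1 - u / 2)) as Pu2.
  assert (A3 : 0 < a ^ 3) by (apply pow_lt; trivial).
  assert (A4 : 0 < a ^ 4) by (apply pow_lt; trivial).
  repeat split.
  - transitivity ((lam * Cconj lam) * u * ((1 - u / 2) * (1 - u / 2)) + rem)%C.
    + unfold rem, u. ring.
    + rewrite Ell. field. trivial.
  - transitivity ((lam * Cconj lam) * w * (1 - u / 2) + w * lam * h2)%C; [ring|].
    rewrite Ell. ring.
  - replace ((1 - u / 2) * (1 - u / 2) + rem / u - (1 - u + u * u / 4))%C with (rem / u)%C
      by (field; repeat split; trivial).
    rewrite Cmod_div by trivial. fold a.
    apply Rmult_le_reg_r with a; trivial. unfold Rdiv. rewrite Rmult_assoc, Rinv_l, Rmult_1_r by lra.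
    assert (Bww : Cmod w * Cmod w <= b * b) by nra.
    assert (Ba : a <= b * b). { unfold a, u. rewrite Cmod_mult. nra. }
    assert (T1 : Cmod (lam * u * (1 - u / 2) * h2) <= 3 / 2 * (K * a ^ 4)).
    { rewrite !Cmod_mult, Hlam, Rmult_1_l. fold a.
      assert (a * Cmod h2 <= K * a ^ 4) by (change (a ^ 4) with (a * a ^ 3); nra).
      assert (0 <= a * Cmod h2) by nra. nra. }
    assert (W1 : Cmod w * Cmod w * Cmod h1 <= K * a ^ 4).
    { eapply Rle_trans; [|exact Hbb]. rewrite Rmult_comm. apply Rmult_le_compat; trivial. nra. }
    assert (T2 : Cmod (Cconj lam * (w * w) * (1 - u / 2) * h1) <= 3 / 2 * (K * a ^ 4)).
    { rewrite !Cmod_mult, Cmod_conj, Hlam, Rmult_1_l.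
      assert (0 <= Cmod w * Cmod w * Cmod h1) by (repeat apply Rmult_le_pos; trivial). nra. }
    assert (T3 : Cmod (w * w * h1 * h2) <= K * K * a ^ 4).
    { rewrite !Cmod_mult.
      assert (Cmod h2 <= K).
      { eapply Rle_trans; [exact H2|]. assert (a ^ 3 <= 1); [|nra].
        rewrite <- (pow1 3). apply pow_incr. lra. }
      assert (0 <= Cmod w * Cmod w * Cmod h1) by (repeat apply Rmult_le_pos; trivial). nra. }
    pose proof (Cmod_triangle (lam * u * (1 - u / 2) * h2 + Cconj lam * (w * w) * (1 - u / 2) * h1) (w * w * h1 * h2)).
    pose proof (Cmod_triangle (lam * u * (1 - u / 2) * h2) (Cconj lam * (w * w) * (1 - u / 2) * h1)).
    fold rem in H. replace ((3 * K + K * K) * a ^ 3 * a) with (3 * (K * a ^ 4) + K * K * a ^ 4) by ring.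
    lra.
  - replace (1 - u / 2 + lam * h2 - (1 - u / 2))%C with (lam * h2)%C by ring.
    rewrite Cmod_mult, Hlam, Rmult_1_l.
    assert (a ^ 3 <= a ^ 2).
    { change (a ^ 3) with (a * a ^ 2). assert (0 <= a ^ 2) by (apply pow_le; lra). nra. }
    assert (0 <= a ^ 2) by (apply pow_le; lra).
    assert (K * a ^ 3 <= K * a ^ 2) by nra. nra.
Qed.

(** * The cohomological equation *)

Section Coboundary.

Variables (f : C2 -> C2) (B : C2 -> Prop) (x : C2 -> R) (g : C2 -> C) (K : R).
Hypothesis Hf : forall p, diffable2 f p.
Hypothesis Bopen : forall p, B p -> exists r, 0 < r /\ forall q, polydisc p r q -> B q.
Hypothesis Binv : forall p, B p -> B (f p) /\ x p + / 2 <= x (f p).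
Hypothesis Bx : forall p, B p -> 1 <= x p.
Hypothesis Hg : forall p, B p -> diffable g p /\ Cmod (g p) <= K / (x p * x p).

(** Recursion on the first term makes the functional equation of the limit immediate;
    [birkhoff_sum_step] recovers the last term, which the convergence proof needs. *)
Fixpoint birkhoff_sum (n : nat) (p : C2) : C :=
  match n with O => 0 | S n => (g p + birkhoff_sum n (f p))%C end.

Lemma birkhoff_sum_step n p : (birkhoff_sum (S n) p - birkhoff_sum n p)%C = g (iterate f n p).
Proof.
  revert p. induction n as [|n IH]; intros p.
  - simpl. unfold iterate. simpl. ring.
  - change (birkhoff_sum (S (S n)) p) with (g p + birkhoff_sum (S n) (f p))%C.
    change (birkhoff_sum (S n) p) with (g p + birkhoff_sum n (f p))%C.
    replace (g p + birkhoff_sum (S n) (f p) - (g p + birkhoff_sum n (f p)))%C with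
      (birkhoff_sum (S n) (f p) - birkhoff_sum n (f p))%C by ring.
    rewrite IH. unfold iterate. rewrite <- Nat.iter_succ_r. reflexivity.
Qed.

Lemma iterate_growth n p : B p -> B (iterate f n p) /\ x p + INR n / 2 <= x (iterate f n p).
Proof.
  intros Hp. induction n as [|n [IH1 IH2]].
  - simpl. split; [trivial|]. unfold iterate; simpl. lra.
  - destruct (Binv _ IH1) as [A D]. split; [exact A|].
    rewrite S_INR. change (iterate f (S n) p) with (f (iterate f n p)). lra.
Qed.

Lemma birkhoff_sum_diffable n p : B p -> diffable (birkhoff_sum n) p.
Proof.
  revert p. induction n as [|n IH]; intros p Hp.
  - apply (diffable_const 0).
  - apply (diffable_plus g (fun q => birkhoff_sum n (f q))); [apply Hg; trivial|].
    apply (diffable_comp2 (birkhoff_sum n) f); trivial. apply IH. apply (Binv p Hp).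
Qed.

(** Tails of a telescoping majorant: with a = x p + n/2, consecutive values differ by K/(a (a -
    1/2)), which dominates the bound K/a^2 on the n-th term. *)
Definition majorant (p : C2) (n : nat) : R := 2 * K / (x p + INR n / 2 - / 2).

Lemma coboundary_const_nonneg p : B p -> 0 <= K.
Proof.
  intros Hp. destruct (Hg p Hp) as [_ H]. pose proof (Cmod_ge_0 (g p)). pose proof (Bx p Hp).
  apply Rnot_lt_le. intros L.
  assert (K / (x p * x p) < 0); [|lra].
  unfold Rdiv. assert (0 < / (x p * x p)) by (apply Rinv_0_lt_compat; nra). nra.
Qed.

Lemma majorant_nonneg p n : B p -> 0 <= majorant p n.
Proof.
  intros Hp. pose proof (coboundary_const_nonneg p Hp). pose proof (Bx p Hp). pose proof (pos_INR n).
  apply Rdiv_le_0_compat; lra.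
Qed.

Lemma birkhoff_sum_majorant p n : B p ->
  Cmod (birkhoff_sum (S n) p - birkhoff_sum n p) <= majorant p n - majorant p (S n).
Proof.
  intros Hp. pose proof (coboundary_const_nonneg p Hp) as HK. pose proof (Bx p Hp).
  pose proof (pos_INR n). rewrite birkhoff_sum_step.
  destruct (iterate_growth n p Hp) as [H1 H2].
  eapply Rle_trans; [apply Hg; trivial|].
  unfold majorant. rewrite S_INR. set (a := x p + INR n / 2) in *.
  assert (1 <= a) by (unfold a; lra).
  replace (x p + (INR n + 1) / 2 - / 2) with a by (unfold a; field).
  replace (2 * K / (a - / 2) - 2 * K / a) with (K / (a * (a - / 2))) by (field; lra).
  unfold Rdiv. apply Rmult_le_compat_l; trivial. apply Rinv_le_contravar; nra.
Qed.

Lemma majorant_0 p : B p -> majorant p 0 <= 4 * K / x p.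
Proof.
  intros Hp. pose proof (coboundary_const_nonneg p Hp) as HK. pose proof (Bx p Hp).
  unfold majorant. simpl. replace (x p + 0 / 2 - / 2) with (x p - / 2) by field.
  apply Rmult_le_reg_r with (x p * (x p - / 2)); [nra|].
  field_simplify; try lra. nra.
Qed.

(** The solution is the sum of g along the forward orbit. Since x >= 1 on B, the partial sums are
    bounded by 4 K uniformly, which is what [weierstrass] asks for. *)
Lemma coboundary : exists e : C2 -> C, forall p, B p ->
  diffable e p /\ Cmod (e p) <= 4 * K / x p /\ e p = (g p + e (f p))%C.
Proof.
  assert (L : forall p, exists l, B p ->
    Ccv (fun n => birkhoff_sum n p) l /\ Cmod l <= 4 * K / x p).
  { intros p. destruct (classic (B p)) as [Hp|Hp].
    - destruct (Ccv_telescoping (fun n => birkhoff_sum n p) (majorant p)) as [l [H1 H2]].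
      + intros n; apply majorant_nonneg; trivial.
      + intros n; apply birkhoff_sum_majorant; trivial.
      + exists l. intros _. split; trivial. simpl in H2. replace (l - 0)%C with l in H2 by ring.
        pose proof (majorant_0 p Hp). lra.
    - exists 0. intros; contradiction. }
  set (e := fun p => proj1_sig (constructive_indefinite_description _ (L p))).
  assert (He : forall p, B p -> Ccv (fun n => birkhoff_sum n p) (e p) /\ Cmod (e p) <= 4 * K / x p).
  { intros p. unfold e. destruct (constructive_indefinite_description _ (L p)); trivial. }
  clearbody e. clear L. exists e. intros p Hp. destruct (He p Hp) as [H1 H2].
  split; [|split; trivial].
  - destruct (Bopen p Hp) as [r [Hr HB]].
    pose proof (coboundary_const_nonneg p Hp) as HK.
    apply (weierstrass birkhoff_sum e p r (4 * K)); trivial.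
    + intros n q Hq. apply birkhoff_sum_diffable; auto.
    + intros n q Hq. assert (Bq : B q) by auto.
      pose proof (telescoping_bound (fun n => birkhoff_sum n q) (majorant q)
        (fun n => birkhoff_sum_majorant q n Bq) O n ltac:(lia)) as T.
      simpl in T. replace (birkhoff_sum n q - 0)%C with (birkhoff_sum n q) in T by ring.
      pose proof (majorant_nonneg q n Bq). pose proof (majorant_0 q Bq). pose proof (Bx q Bq).
      assert (4 * K / x q <= 4 * K); [|lra].
      apply Rmult_le_reg_r with (x q); [lra|]. field_simplify; nra.
    + intros q Hq. apply He. auto.
  - apply (Ccv_unique (fun n => birkhoff_sum (S n) p)).
    + apply (Ccv_shift (fun n => birkhoff_sum n p)). trivial.
    + simpl. apply Ccv_plus; [apply Ccv_const|]. apply He. apply Binv; trivial.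
Qed.

End Coboundary.

(** * The invariant region in terms of 1/(zw) *)

Definition uinv (p : C2) : C := (/ (fst p * snd p))%C.

(** [Bcheck] seen through U = 1/(zw): inversion turns the disc |zw - r| < r into the half-plane Re U
    > 1/(2r) and preserves the sector. Freeing the threshold [rho] allows the region to shrink until
    the asymptotics hold. *)
Definition region (theta0 beta0 rho : R) (p : C2) : Prop :=
  (fst p * snd p)%C <> 0 /\ rho < Re (uinv p) /\
  Rabs (Im (uinv p)) < tan theta0 * Re (uinv p) /\
  Cmod (fst p) < Rpower (Cmod (fst p * snd p)) beta0 /\
  Cmod (snd p) < Rpower (Cmod (fst p * snd p)) beta0.

Lemma Cinv_parts (x y : R) : (x, y) <> RtoC 0 ->
  0 < x * x + y * y /\ Re (/ (x, y))%C = x / (x * x + y * y) /\ Im (/ (x, y))%C = - y / (x * x + y * y).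
Proof.
  intros N. assert (0 < x * x + y * y).
  { apply Rnot_le_lt. intros L. apply N. pose proof (Rle_0_sqr x). pose proof (Rle_0_sqr y).
    unfold Rsqr in *. assert (x = 0) by (apply Rsqr_0_uniq; unfold Rsqr; lra).
    assert (y = 0) by (apply Rsqr_0_uniq; unfold Rsqr; lra).
    subst. reflexivity. }
  split; trivial. unfold Cinv, Re, Im; simpl. rewrite !Rmult_1_r. split; reflexivity.
Qed.

Lemma Bcheck_of_region r rho theta0 beta0 p : 0 < r -> / (2 * r) <= rho -> 0 < theta0 < PI / 2 ->
  region theta0 beta0 rho p -> Bcheck r theta0 beta0 p.
Proof.
  intros Hr Hrho Hth [N [H1 [H2 [H3 H4]]]]. unfold uinv in *. unfold Bcheck.
  split; [trivial|]. split; [trivial|].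
  destruct (fst p * snd p)%C as [x y].
  destruct (Cinv_parts x y N) as [PN [E1 E2]]. rewrite E1 in *. rewrite E2 in *.
  set (n := x * x + y * y) in *.
  assert (Pr : 0 < / (2 * r)) by (apply Rinv_0_lt_compat; lra).
  assert (Hx : n < 2 * r * x).
  { assert (/ (2 * r) < x / n) by lra.
    apply Rmult_lt_compat_r with (r := 2 * r * n) in H; [|nra].
    replace (/ (2 * r) * (2 * r * n)) with n in H by (field; lra).
    replace (x / n * (2 * r * n)) with (2 * r * x) in H by (field; lra). trivial. }
  assert (Px : 0 < x) by nra.
  assert (Hy : Rabs (y / x) < tan theta0).
  { unfold Rdiv in *. rewrite Rabs_mult, Rabs_Ropp, Rabs_inv, (Rabs_pos_eq n) in H2 by lra.
    rewrite Rabs_mult, Rabs_inv, (Rabs_pos_eq x) by lra.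
    apply Rmult_lt_compat_r with (r := n / x) in H2; [|apply Rdiv_lt_0_compat; lra].
    replace (Rabs y * / n * (n / x)) with (Rabs y * / x) in H2 by (field; lra).
    replace (tan theta0 * (x * / n) * (n / x)) with (tan theta0) in H2 by (field; lra). trivial. }
  split.
  - exists (atan (y / x)). pose proof (atan_bound (y / x)) as AB. split.
    + split; [trivial|]. split; [pose proof PI_RGT_0; lra|].
      assert (Pm : 0 < Cmod (x, y)) by (apply Cmod_gt_0; trivial).
      transitivity (Cexp (Clog (x, y))); [symmetry; apply Cexp_Clog; trivial|].
      unfold Clog, Cexp. simpl fst; simpl snd. rewrite exp_ln by trivial.
      apply injective_projections; simpl; ring.
    + rewrite <- (atan_tan theta0) by lra. apply Rabs_def2 in Hy.
      apply Rabs_def1; [apply atan_increasing; lra|]. rewrite <- atan_opp. apply atan_increasing; lra.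
  - unfold Cmod. apply Rlt_le_trans with (sqrt (r * r)); [|rewrite sqrt_square; lra]. apply sqrt_lt_1_alt. simpl.
    unfold n in Hx. split; [|ring_simplify; ring_simplify in Hx; lra]. apply Rplus_le_le_0_compat; rewrite Rmult_1_r; apply Rle_0_sqr.
Qed.

(** In a sector of half-angle below pi/2, Re U is comparable to |U|; this later converts zw -> 0
    into Re U -> +oo. *)
Lemma Bcheck_sector r theta0 beta0 p : 0 < theta0 < PI / 2 -> Bcheck r theta0 beta0 p ->
  (fst p * snd p)%C <> 0 /\ Rabs (Im (uinv p)) < tan theta0 * Re (uinv p) /\
  cos theta0 * / Cmod (fst p * snd p) <= Re (uinv p).
Proof.
  intros Hth [_ [_ [[t [[N [_ Et]] Ht]] _]]]. unfold uinv. split; trivial.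
  pose proof (proj1 (Cmod_gt_0 _) N) as Pm. set (u := (fst p * snd p)%C) in *.
  set (m := Cmod u) in *.
  assert (Eu : u = (m * cos t, m * sin t)).
  { rewrite Et. apply injective_projections; simpl; ring. }
  rewrite Eu in N. destruct (Cinv_parts _ _ N) as [_ [E1 E2]]. rewrite <- Eu in E1, E2.
  pose proof (sin2_cos2 t) as SC. unfold Rsqr in SC.
  assert (En : m * cos t * (m * cos t) + m * sin t * (m * sin t) = m * m).
  { transitivity (m * m * (sin t * sin t + cos t * cos t)); [ring|]. rewrite SC. ring. }
  rewrite En in E1, E2. rewrite E1, E2.
  assert (Ect : cos t = cos (Rabs t)).
  { unfold Rabs. destruct (Rcase_abs t); [rewrite cos_neg|]; trivial. }
  pose proof (Rabs_pos t) as Pt.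
  assert (Est : Rabs (sin t) = sin (Rabs t)).
  { assert (0 <= sin (Rabs t)) by (apply sin_ge_0; lra).
    revert H. unfold Rabs at 1 3. destruct (Rcase_abs t).
    - rewrite sin_neg. intros. rewrite Rabs_left1; lra.
    - intros. apply Rabs_pos_eq; trivial. }
  assert (Pc : 0 < cos (Rabs t)) by (apply cos_gt_0; lra).
  assert (Im1 : 0 < / m) by (apply Rinv_0_lt_compat; trivial).
  replace (m * cos t / (m * m)) with (cos t * / m) by (field; lra).
  replace (- (m * sin t) / (m * m)) with (- sin t * / m) by (field; lra).
  split.
  - rewrite Rabs_mult, Rabs_Ropp, Est, (Rabs_pos_eq (/ m)) by lra.
    rewrite <- Rmult_assoc. apply Rmult_lt_compat_r; trivial. rewrite Ect.
    assert (T : tan (Rabs t) < tan theta0).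
    { apply tan_increasing; lra. }
    unfold tan at 1 in T. apply Rmult_lt_compat_r with (r := cos (Rabs t)) in T; trivial.
    replace (sin (Rabs t) / cos (Rabs t) * cos (Rabs t)) with (sin (Rabs t)) in T by (field; lra).
    trivial.
  - apply Rmult_le_compat_r; [lra|]. rewrite Ect. apply cos_decr_1; lra.
Qed.

Lemma region_of_Bcheck r rho theta0 beta0 p : 0 < theta0 < PI / 2 ->
  Bcheck r theta0 beta0 p -> rho < Re (uinv p) -> region theta0 beta0 rho p.
Proof.
  intros Hth HB Hrho. destruct (Bcheck_sector _ _ _ _ Hth HB) as [N [S _]].
  destruct HB as [B1 [B2 _]]. repeat split; trivial.
Qed.

Lemma uinv_diffable p : (fst p * snd p)%C <> 0 -> diffable uinv p.
Proof.
  intros N. apply diffable_inv; trivial. apply diffable_mult; [apply diffable_fst|apply diffable_snd].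
Qed.

Lemma region_open theta0 beta0 rho p : region theta0 beta0 rho p ->
  exists r, 0 < r /\ forall q, polydisc p r q -> region theta0 beta0 rho q.
Proof.
  intros [N [H1 [H2 [H3 H4]]]]. apply locally_polydisc.
  assert (Du : diffable (fun q => fst q * snd q)%C p).
  { apply diffable_mult; [apply diffable_fst|apply diffable_snd]. }
  pose proof (uinv_diffable p N) as Di.
  pose proof (proj1 (Cmod_gt_0 _) N) as Pm.
  assert (CP : contR (fun q => Rpower (Cmod (fst q * snd q)) beta0) p).
  { apply (contR_comp (fun t => Rpower t beta0) (fun q => Cmod (fst q * snd q))).
    - apply contR_Cmod; trivial.
    - apply derivable_continuous_pt. eexists. apply derivable_pt_lim_power. trivial. }
  assert (CT : contR (fun q => tan theta0 * Re (uinv q)) p).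
  { apply (contR_comp (fun t => tan theta0 * t) (fun q => Re (uinv q))); [apply contR_re; trivial|].
    apply derivable_continuous_pt. apply derivable_pt_mult; [apply derivable_pt_const|apply derivable_pt_id]. }
  assert (CA : contR (fun q => Rabs (Im (uinv q))) p).
  { apply (contR_comp Rabs (fun q => Im (uinv q))); [apply contR_im; trivial|]. apply Rcontinuity_abs. }
  pose proof (contR_pos_open _ _ p (contR_const 0 p) (contR_Cmod _ p Du) Pm) as O0.
  pose proof (contR_pos_open _ _ p (contR_const rho p) (contR_re _ p Di) H1) as O1.
  pose proof (contR_pos_open _ _ p CA CT H2) as O2.
  pose proof (contR_pos_open _ _ p (contR_Cmod _ p (diffable_fst p)) CP H3) as O3.
  pose proof (contR_pos_open _ _ p (contR_Cmod _ p (diffable_snd p)) CP H4) as O4.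
  apply locally_polydisc in O0. apply locally_polydisc in O1. apply locally_polydisc in O2.
  apply locally_polydisc in O3. apply locally_polydisc in O4.
  assert (Fl : @Filter C2_NM (@locally C2_NM p)) by apply (@locally_filter C2_NM).
  generalize (@filter_and C2_NM _ Fl _ _ O0 (@filter_and C2_NM _ Fl _ _ O1
    (@filter_and C2_NM _ Fl _ _ O2 (@filter_and C2_NM _ Fl _ _ O3 O4)))).
  apply (@filter_imp C2_NM _ Fl). intros q [Q0 [Q1 [Q2 [Q3 Q4]]]].
  split; [apply Cmod_gt_0; exact Q0|]. repeat split; trivial.
Qed.

(** Invariance splits in two: the sector and the bounds on |z| and |w| are inherited from the
    assumed invariance of [Bcheck], and only the growth of Re U comes from the estimates. *)
Lemma region_step lam l Fc theta0 beta0 r0 : Cmod lam = 1 -> has_expansion lam l Fc ->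
  0 < theta0 < PI / 2 -> 0 < beta0 < 1 / 2 -> beta0 * INR (l + 1) >= 4 -> 0 < r0 ->
  (forall p, Bcheck r0 theta0 beta0 p -> Bcheck r0 theta0 beta0 (Fc p)) ->
  exists rho K, 1 <= rho /\ / (2 * r0) <= rho /\ 0 < K /\ forall p, region theta0 beta0 rho p ->
    region theta0 beta0 rho (Fc p) /\ Re (uinv p) + / 2 <= Re (uinv (Fc p)) /\
    0 < Re (lam * snd (Fc p) / snd p)%C /\
    Cmod (uinv (Fc p) - uinv p - 1 - 3 / 4 * (Clog (uinv (Fc p)) - Clog (uinv p)))
      <= K / (Re (uinv p) * Re (uinv p)) /\
    Cmod (Clog (lam * snd (Fc p) / snd p) + 1 / 2 * (Clog (uinv (Fc p)) - Clog (uinv p)))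
      <= K / (Re (uinv p) * Re (uinv p)).
Proof.
  intros Hlam Hexp Hth Hb Hbl Hr0 Hinv.
  destruct (step_quotients lam l Fc beta0 Hlam Hexp Hb Hbl) as [d1 [K1 [Hd1 [HK1 Q]]]].
  destruct (step_increments K1 HK1) as [d2 [K [Hd2 [HK St]]]].
  assert (P0 : 0 < / (2 * r0)) by (apply Rinv_0_lt_compat; lra).
  assert (P1 : 0 < / d1) by (apply Rinv_0_lt_compat; lra).
  assert (P2 : 0 < / d2) by (apply Rinv_0_lt_compat; lra).
  (* 1 gives Re U >= 1, 1/(2 r0) puts the region inside [Bcheck], and the last two summands push |u|
     <= 1/Re U below the radii [d1] and [d2]. *)
  exists (1 + / (2 * r0) + / d1 + / d2), K. split; [lra|]. split; [lra|].
  split; [trivial|].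
  set (rho := 1 + / (2 * r0) + / d1 + / d2).
  intros p Hp. pose proof Hp as [N [H1 [H2 [H3 H4]]]].
  assert (HB : Bcheck r0 theta0 beta0 p).
  { apply (Bcheck_of_region r0 rho); trivial. unfold rho; lra. }
  set (u := (fst p * snd p)%C) in *. pose proof (proj1 (Cmod_gt_0 u) N) as Pu.
  set (X := Re (uinv p)) in *.
  assert (PX : 0 < X) by (unfold rho in H1; lra).
  assert (HuX : Cmod u <= / X).
  { assert (X <= / Cmod u).
    { rewrite <- Cmod_inv by trivial. unfold X, uinv. fold u.
      eapply Rle_trans; [apply Rle_abs|apply re_le_Cmod]. }
    rewrite <- (Rinv_inv (Cmod u)). apply Rinv_le_contravar; trivial. }
  assert (Hd : forall d, 0 < d -> / d < X -> / X < d).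
  { intros d Pd L. rewrite <- (Rinv_inv d). apply Rinv_lt_contravar; trivial.
    apply Rmult_lt_0_compat; trivial. apply Rinv_0_lt_compat; trivial. }
  assert (/ X < d1) by (apply Hd; unfold rho in H1; lra).
  assert (/ X < d2) by (apply Hd; unfold rho in H1; lra).
  destruct (Q (fst p) (snd p)) as [q [v [E1 [E2 [B1 B2]]]]]; trivial.
  { unfold u in HuX. lra. }
  rewrite <- surjective_pairing in E1, E2. fold u in E1, B1, B2.
  destruct (St u q v N ltac:(lra) B1 B2) as [Nq [Nv [Rq [Rv [S1 [S2 S3]]]]]].
  assert (Nw : snd p <> 0). { intros E. apply N. unfold u. rewrite E. ring. }
  assert (EU1 : uinv (Fc p) = (/ (u * q))%C) by (unfold uinv; rewrite E1; reflexivity).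
  assert (EU : uinv p = (/ u)%C) by reflexivity.
  assert (Ev : (lam * snd (Fc p) / snd p)%C = v) by (rewrite E2; field; trivial).
  rewrite <- EU1, <- EU in S1, S2.
  assert (G : X + / 2 <= Re (uinv (Fc p))).
  { pose proof (re_le_Cmod (uinv (Fc p) - uinv p - 1)) as Rr.
    change (Re (uinv (Fc p) - uinv p - 1)%C) with (Re (uinv (Fc p)) + - Re (uinv p) + - 1) in Rr.
    fold X in Rr. assert (A : Rabs (Re (uinv (Fc p)) + - X + - 1) <= / 2) by lra.
    apply Rabs_le_between in A. lra. }
  assert (HL : Clog (uinv (Fc p)) = (Clog (uinv p) - Clog q)%C).
  { assert (EL : uinv p = (uinv (Fc p) * q)%C).
    { rewrite EU1, EU. field. split; trivial. }
    assert (Clog (uinv p) = (Clog (uinv (Fc p)) + Clog q)%C) as ->; [|ring].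
    rewrite EL at 1. apply Clog_mult; trivial; [lra|]. rewrite <- EL. exact PX. }
  assert (BX : K * Cmod u ^ 2 <= K / (X * X)).
  { unfold Rdiv. apply Rmult_le_compat_l; [lra|]. rewrite Rinv_mult. simpl. rewrite Rmult_1_r.
    apply Rmult_le_compat; lra. }
  split; [|split; [|split; [|split]]].
  - apply (region_of_Bcheck r0); auto. lra.
  - exact G.
  - rewrite Ev. trivial.
  - rewrite HL. replace (uinv (Fc p) - uinv p - 1 - 3 / 4 * (Clog (uinv p) - Clog q - Clog (uinv p)))%C
      with (uinv (Fc p) - uinv p - 1 + 3 / 4 * Clog q)%C by ring. lra.
  - rewrite HL, Ev. replace (Clog v + 1 / 2 * (Clog (uinv p) - Clog q - Clog (uinv p)))%C with
      (Clog v - 1 / 2 * Clog q)%C by ring. lra.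
Qed.

(** * The logarithmic chart (U, S), with S = (log w - log z)/2 *)

Definition chart (v : C2) : C2 :=
  (Cexp (- snd v - 1 / 2 * Clog (fst v)), Cexp (snd v - 1 / 2 * Clog (fst v)))%C.

Lemma chart_mult v : 0 < Re (fst v) -> (fst (chart v) * snd (chart v))%C = (/ fst v)%C.
Proof.
  intros H. unfold chart; simpl. rewrite <- Cexp_plus.
  replace (- snd v - 1 / 2 * Clog (fst v) + (snd v - 1 / 2 * Clog (fst v)))%C with (- Clog (fst v))%C
    by (field; apply RtoC_neq; lra).
  rewrite Cexp_opp, Cexp_Clog; trivial.
Qed.

Lemma neq_0_of_Re_pos (z : C) : 0 < Re z -> z <> 0.
Proof. intros H E. rewrite E in H. simpl in H. lra. Qed.

Lemma chart_uinv v : 0 < Re (fst v) -> uinv (chart v) = fst v.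
Proof.
  intros H. unfold uinv. rewrite chart_mult by trivial. field.
  apply neq_0_of_Re_pos; trivial.
Qed.

Lemma chart_diffable v : 0 < Re (fst v) -> diffable2 chart v.
Proof.
  intros H. split; apply diffable_Cexp; apply diffable_minus; try apply diffable_opp;
    try apply diffable_snd; (apply diffable_mult; [apply diffable_const|]);
    apply diffable_Clog; trivial; apply diffable_fst.
Qed.

(** The bounds on |z| and |w| read |Re S| < (1/2 - beta0) log |U|, and the sector reads |Im U| < tan
    theta0 Re U. Both are satisfied for bounded Im U and Re S once Re U is large; the maximum
    collects these thresholds. *)
Lemma chart_region theta0 beta0 rho K : 0 < theta0 < PI / 2 -> 0 < beta0 < 1 / 2 ->
  exists X, forall v, X <= Re (fst v) -> Rabs (Im (fst v)) <= K -> Rabs (Re (snd v)) <= K ->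
    region theta0 beta0 rho (chart v).
Proof.
  intros Hth Hb.
  assert (Pt : 0 < tan theta0) by (apply tan_gt_0; lra).
  exists (Rmax (Rmax 1 (rho + 1)) (Rmax (K / tan theta0 + 1) (exp (K / (1 / 2 - beta0)) + 1))).
  intros v HX HI HR.
  assert (A1 := Rle_trans _ _ _ (Rmax_l _ _) HX). assert (A2 := Rle_trans _ _ _ (Rmax_r _ _) HX).
  assert (X1 := Rle_trans _ _ _ (Rmax_l _ _) A1). assert (X2 := Rle_trans _ _ _ (Rmax_r _ _) A1).
  assert (X3 := Rle_trans _ _ _ (Rmax_l _ _) A2). assert (X4 := Rle_trans _ _ _ (Rmax_r _ _) A2).
  clear A1 A2 HX.
  assert (P : 0 < Re (fst v)) by lra.
  pose proof (neq_0_of_Re_pos _ P) as Nv.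
  unfold region. rewrite chart_uinv, chart_mult by trivial.
  assert (Pm : 0 < Cmod (fst v)) by (apply Cmod_gt_0; trivial).
  assert (Hm : Re (fst v) <= Cmod (fst v)).
  { eapply Rle_trans; [apply Rle_abs|apply re_le_Cmod]. }
  assert (HK : K < (1 / 2 - beta0) * ln (Cmod (fst v))).
  { assert (K / (1 / 2 - beta0) < ln (Cmod (fst v))).
    { rewrite <- (ln_exp (K / _)). apply ln_increasing; [apply exp_pos|lra]. }
    apply Rmult_lt_compat_l with (r := 1 / 2 - beta0) in H; [|lra].
    replace ((1 / 2 - beta0) * (K / (1 / 2 - beta0))) with K in H by (field; lra). trivial. }
  assert (HP : Rpower (Cmod (/ fst v)) beta0 = exp (- (beta0 * ln (Cmod (fst v))))).
  { unfold Rpower. rewrite Cmod_inv, ln_Rinv by trivial. f_equal. ring. }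
  apply Rabs_le_between in HR.
  split; [|split; [|split; [|split]]].
  - intros E. apply Nv. replace (fst v) with (/ / fst v)%C.
    + rewrite E. unfold Cinv, RtoC. simpl. f_equal; unfold Rdiv; ring.
    + field. trivial.
  - lra.
  - apply Rmult_le_compat_l with (r := tan theta0) in X3; [|lra].
    replace (tan theta0 * (K / tan theta0 + 1)) with (K + tan theta0) in X3 by (field; lra). lra.
  - rewrite HP. unfold chart; simpl fst. rewrite Cmod_Cexp. apply exp_increasing.
    replace (Re (- snd v - 1 / 2 * Clog (fst v))%C) with (- Re (snd v) - 1 / 2 * ln (Cmod (fst v))); [lra|].
    unfold Re; simpl. field.
  - rewrite HP. unfold chart; simpl snd. rewrite Cmod_Cexp. apply exp_increasing.
    replace (Re (snd v - 1 / 2 * Clog (fst v))%C) with (Re (snd v) - 1 / 2 * ln (Cmod (fst v))); [lra|].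
    unfold Re; simpl. field.
Qed.

(** With s = sqrt |z|, ln |z| <= 2 s - 2, and the argument adds at most 2. The choice of X gives s
    >= 4/[eta], so 2 s is below [eta] |z|. *)
Lemma Clog_sublinear eta : 0 < eta ->
  exists X, 1 <= X /\ forall z, X <= Re z -> Cmod (Clog z) <= eta * Cmod z.
Proof.
  intros He. exists (1 + 16 / (eta * eta)).
  assert (P : 0 < 16 / (eta * eta)) by (apply Rdiv_lt_0_compat; nra).
  split; [lra|]. intros z Hz.
  assert (Hm : Re z <= Cmod z) by (eapply Rle_trans; [apply Rle_abs|apply re_le_Cmod]).
  set (m := Cmod z) in *. assert (Pm : 1 <= m) by lra.
  eapply Rle_trans; [apply Cmod_Clog_le; fold m; lra|]. fold m.
  set (s := sqrt m). assert (Es : s * s = m) by (apply sqrt_sqrt; lra).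
  assert (Ps : 1 <= s) by (unfold s; rewrite <- sqrt_1; apply sqrt_le_1_alt; lra).
  assert (L1 : 0 <= ln m) by (rewrite <- ln_1; apply ln_le; lra).
  rewrite Rabs_pos_eq by trivial.
  assert (L2 : ln m <= 2 * s - 2).
  { rewrite <- Es, ln_mult by lra. pose proof (ln_le_minus_1 s ltac:(lra)). lra. }
  assert (4 / eta <= s).
  { unfold s. rewrite <- (sqrt_square (4 / eta)) by (apply Rdiv_le_0_compat; lra).
    apply sqrt_le_1_alt. replace (4 / eta * (4 / eta)) with (16 / (eta * eta)) by (field; lra). lra. }
  assert (4 <= eta * s).
  { apply Rmult_le_compat_l with (r := eta) in H; [|lra].
    replace (eta * (4 / eta)) with 4 in H by (field; lra). trivial. }
  assert (eta * m = eta * s * s) by (rewrite Rmult_assoc, Es; trivial). assert (4 * s <= eta * s * s) by (apply Rmult_le_compat_r; lra). lra.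
Qed.

(** * Fatou coordinates *)

Section Coordinates.

Variables (F G : C2 -> C2) (Om B : C2 -> Prop) (y : C) (e1 e2 : C2 -> C) (K0 : R).
Hypothesis FG : forall p, F (G p) = p.
Hypothesis GF : forall p, G (F p) = p.
Hypothesis HF : forall p, diffable2 F p.
Hypothesis HG : forall p, diffable2 G p.
Hypothesis Om_open : @open C2_NM Om.
Hypothesis Om_B : forall n p, B (iterate F n p) -> Om p.
Hypothesis Om_enter : forall p X, Om p -> exists N : nat, forall n, (N <= n)%nat ->
  B (iterate F n p) /\ X <= Re (uinv (iterate F n p)).
Hypothesis B_neq : forall p, B p -> (fst p * snd p)%C <> 0 /\ 1 <= Re (uinv p).
Hypothesis B_open : forall p, B p -> exists r, 0 < r /\ forall q, polydisc p r q -> B q.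
Hypothesis B_inv : forall p, B p -> B (F p).
Hypothesis B_chart : forall K, exists X, forall v, X <= Re (fst v) ->
  Rabs (Im (fst v)) <= K -> Rabs (Re (snd v)) <= K -> B (chart v).
Hypothesis Hy : Re y = 0.
Hypothesis B_step : forall p, B p -> 0 < Re (Cexp y * snd (F p) / snd p)%C.
Hypothesis HK0 : 0 <= K0.
Hypothesis He1 : forall p, B p -> diffable e1 p /\ Cmod (e1 p) <= K0 / Re (uinv p) /\
  e1 p = (uinv (F p) - uinv p - 1 - 3 / 4 * (Clog (uinv (F p)) - Clog (uinv p)) + e1 (F p))%C.
Hypothesis He2 : forall p, B p -> diffable e2 p /\ Cmod (e2 p) <= K0 / Re (uinv p) /\
  e2 p = (Clog (Cexp y * snd (F p) / snd p) + 1 / 2 * (Clog (uinv (F p)) - Clog (uinv p)) + e2 (F p))%C.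

Definition psi_local (p : C2) : C := (uinv p - 3 / 4 * Clog (uinv p) + e1 p)%C.

(* The factor exp (y psi) turns the multiplier conj lam of the second coordinate into 1. *)
Definition tau_local (p : C2) : C :=
  (snd p * Cexp (1 / 2 * Clog (uinv p) + y * psi_local p + e2 p))%C.

Lemma B_snd p : B p -> snd p <> 0.
Proof. intros Hp E. apply (B_neq p Hp). rewrite E. ring. Qed.

Lemma B_Re p : B p -> 0 < Re (uinv p).
Proof. intros Hp. destruct (B_neq p Hp). lra. Qed.

Lemma psi_local_F p : B p -> psi_local (F p) = (psi_local p + 1)%C.
Proof.
  intros Hp. unfold psi_local. destruct (He1 p Hp) as [_ [_ E]]. rewrite E. ring.
Qed.

(** One step multiplies w by v/exp y, while the exponent gains y - log v; the two changes cancel. *)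
Lemma tau_local_F p : B p -> tau_local (F p) = tau_local p.
Proof.
  intros Hp. unfold tau_local. rewrite psi_local_F by trivial.
  destruct (He2 p Hp) as [_ [_ E]].
  set (v := (Cexp y * snd (F p) / snd p)%C) in *.
  assert (Ee : (1 / 2 * Clog (uinv (F p)) + y * (psi_local p + 1) + e2 (F p))%C =
    ((1 / 2 * Clog (uinv p) + y * psi_local p + e2 p) + y - Clog v)%C) by (rewrite E; ring).
  rewrite Ee, Cexp_minus, Cexp_plus, Cexp_Clog by (apply B_step; trivial).
  unfold v. field. repeat split.
  - apply B_snd; trivial.
  - apply B_snd, B_inv; trivial.
  - apply Cexp_neq_0.
Qed.

Lemma iterate_local n m p : (n <= m)%nat -> B (iterate F n p) ->
  B (iterate F m p) /\
  (psi_local (iterate F m p) - INR m)%C = (psi_local (iterate F n p) - INR n)%C /\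
  tau_local (iterate F m p) = tau_local (iterate F n p).
Proof.
  intros L Hn. induction L as [|m L [IH1 [IH2 IH3]]]; [auto|].
  change (iterate F (S m) p) with (F (iterate F m p)).
  split; [apply B_inv; trivial|]. split.
  - rewrite psi_local_F, <- IH2, S_INR, RtoC_plus by trivial. ring.
  - rewrite tau_local_F; trivial.
Qed.

(** * Extension from the local basin to the whole basin *)

Definition entry (p : C2) : nat := epsilon (inhabits O) (fun n => B (iterate F n p)).

Definition psi (p : C2) : C := (psi_local (iterate F (entry p) p) - INR (entry p))%C.

Definition tau (p : C2) : C := tau_local (iterate F (entry p) p).

(** Any time spent in B may replace the chosen entry time. Near a given point one fixed n therefore
    works, and differentiability follows although [entry] itself may jump. *)
Lemma psi_tau_eq n p : B (iterate F n p) ->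
  psi p = (psi_local (iterate F n p) - INR n)%C /\ tau p = tau_local (iterate F n p).
Proof.
  intros Hn. assert (He : B (iterate F (entry p) p)).
  { unfold entry. apply epsilon_spec. exists n. trivial. }
  unfold psi, tau. destruct (Nat.le_ge_cases (entry p) n) as [L|L].
  - destruct (iterate_local _ _ p L He) as [_ [E1 E2]]. split; congruence.
  - destruct (iterate_local _ _ p L Hn) as [_ [E1 E2]]. split; congruence.
Qed.

Lemma Om_entry p : Om p -> exists n, B (iterate F n p).
Proof. intros Hp. destruct (Om_enter p 0 Hp) as [N HN]. exists N. apply HN. lia. Qed.

Lemma psi_tau_F p : Om p -> psi (F p) = (psi p + 1)%C /\ tau (F p) = tau p.
Proof.
  intros Hp. destruct (Om_entry p Hp) as [n Hn].
  assert (E : iterate F n (F p) = F (iterate F n p)).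
  { unfold iterate. rewrite <- Nat.iter_succ_r. reflexivity. }
  destruct (psi_tau_eq n p Hn) as [E1 E2].
  destruct (psi_tau_eq n (F p)) as [E3 E4]; [rewrite E; apply B_inv; trivial|].
  rewrite E in E3, E4. rewrite E1, E2, E3, E4, psi_local_F, tau_local_F by trivial.
  split; [ring|trivial].
Qed.

Lemma psi_local_diffable p : B p -> diffable psi_local p.
Proof.
  intros Hp. pose proof (uinv_diffable p (proj1 (B_neq p Hp))) as Du.
  apply diffable_plus; [apply diffable_minus; [trivial|]|apply He1; trivial].
  apply diffable_mult; [apply diffable_const|]. apply diffable_Clog; [trivial|]. apply B_Re; trivial.
Qed.

Lemma tau_local_diffable p : B p -> diffable tau_local p.
Proof.
  intros Hp. pose proof (uinv_diffable p (proj1 (B_neq p Hp))) as Du.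
  apply diffable_mult; [apply diffable_snd|]. apply diffable_Cexp.
  apply diffable_plus; [apply diffable_plus|apply He2; trivial];
    (apply diffable_mult; [apply diffable_const|]).
  - apply diffable_Clog; [trivial|]. apply B_Re; trivial.
  - apply psi_local_diffable; trivial.
Qed.

Lemma psi_tau_diffable p : Om p -> diffable psi p /\ diffable tau p.
Proof.
  intros Hp. destruct (Om_entry p Hp) as [n Hn].
  destruct (B_open _ Hn) as [r [Hr HB]].
  destruct (diffable2_continuous (iterate F n) p r (diffable2_iterate F n p HF) Hr) as [d [Hd Hc]].
  split.
  - apply (diffable_ext_loc (fun q => psi_local (iterate F n q) - INR n)%C).
    + exists d. split; trivial. intros q Hq. symmetry. apply psi_tau_eq. auto.
    + apply diffable_minus; [|apply diffable_const].
      apply (diffable_comp2 psi_local (iterate F n)); [apply diffable2_iterate; trivial|].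
      apply psi_local_diffable; trivial.
  - apply (diffable_ext_loc (fun q => tau_local (iterate F n q))).
    + exists d. split; trivial. intros q Hq. symmetry. apply psi_tau_eq. auto.
    + apply (diffable_comp2 tau_local (iterate F n)); [apply diffable2_iterate; trivial|].
      apply tau_local_diffable; trivial.
Qed.

Lemma tau_neq_0 p : Om p -> tau p <> 0.
Proof.
  intros Hp. destruct (Om_entry p Hp) as [n Hn]. destruct (psi_tau_eq n p Hn) as [_ ->].
  apply Cmult_neq_0; [apply B_snd; trivial|apply Cexp_neq_0].
Qed.

(** * The Fatou coordinates in the chart *)

Lemma chart_surjective p : B p -> exists s, chart (uinv p, s) = p.
Proof.
  intros Hp. pose proof (B_snd p Hp) as Nw. destruct (Cexp_surj (snd p) Nw) as [t Ht].
  exists (t + 1 / 2 * Clog (uinv p))%C.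
  set (v := (uinv p, t + 1 / 2 * Clog (uinv p))%C).
  assert (E2 : snd (chart v) = snd p).
  { unfold chart, v; simpl. rewrite <- Ht. f_equal. ring. }
  apply injective_projections; [|exact E2].
  assert (M : (fst (chart v) * snd p)%C = (fst p * snd p)%C).
  { rewrite <- E2 at 1. rewrite (chart_mult v (B_Re p Hp)).
    change (/ / (fst p * snd p) = fst p * snd p)%C. pose proof (proj1 (B_neq p Hp)). field.
    split; intros E; apply H; rewrite E; ring. }
  apply Cminus_diag_uniq. replace (fst (chart v) - fst p)%C with
    ((fst (chart v) * snd p - fst p * snd p) / snd p)%C by (field; trivial).
  rewrite M. field. trivial.
Qed.

(** The factor exp ((log U)/2) cancels the half logarithm in w, so in the chart log tau - y psi is S
    + e2. *)
Lemma tau_local_chart v : 0 < Re (fst v) ->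
  tau_local (chart v) = Cexp (snd v + y * psi_local (chart v) + e2 (chart v)).
Proof.
  intros H. unfold tau_local. rewrite chart_uinv by trivial.
  unfold chart at 1; simpl snd. rewrite <- Cexp_plus. f_equal. ring.
Qed.

(** log U is unbounded, but its variation over a bidisc is small; hence the value at the centre is
    subtracted and has to be added back to the target. *)
Definition perturb1 (c : C2) (v : C2) : C := (- (3 / 4) * (Clog (fst v) - Clog (fst c)) + e1 (chart v))%C.

Definition perturb2 (v : C2) : C := e2 (chart v).

Lemma Cmod_34 : Cmod (3 / 4) = 3 / 4.
Proof. rewrite <- RtoC_div by lra. rewrite Cmod_R. apply Rabs_pos_eq. lra. Qed.

(* In the chart, (psi, log tau - y psi) is, up to an additive constant, a small
   perturbation of the identity near the point (M + 3/4 log M, s) when Re M is large. *)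
Lemma chart_perturbation K : exists X, 1 <= X /\ forall M s, X <= Re M ->
  Rabs (Im M) <= K -> Rabs (Re s) <= K ->
  (forall v, polydisc (M + 3 / 4 * Clog M, s)%C 2 v ->
     B (chart v) /\ 0 < Re (fst v) /\
     Cmod (perturb1 (M + 3 / 4 * Clog M, s)%C v) <= / 32 /\ Cmod (perturb2 v) <= / 32) /\
  0 < Re (M + 3 / 4 * Clog M)%C /\
  Cmod (3 / 4 * (Clog (M + 3 / 4 * Clog M) - Clog M)) <= / 8 /\
  (forall v, X <= Re (fst v) -> B (chart v) -> psi_local (chart v) = M ->
     (snd v + e2 (chart v))%C = s -> polydisc (M + 3 / 4 * Clog M, s)%C 1 v).
Proof.
  (* Small enough that (3/4) 226 [eta] + 1/64 <= 1/32: the variation of the logarithm together with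
     e1 fits the Picard hypothesis. *)
  set (eta := / 20000).
  destruct (Clog_sublinear eta) as [X1 [HX1 L1]]; [unfold eta; lra|].
  (* The centre has imaginary part at most K + 2 in modulus, as |Im log M| < pi/2, and the bidisc of
     radius 2 adds 2. *)
  destruct (B_chart (K + 4)) as [X2 HX2].
  pose proof (Rabs_pos X2) as PX2. pose proof (Rle_abs X2) as AX2.
  (* 64 [K0] makes e1 and e2 at most 1/64; 2/[eta] makes the radius 2 small relative to the centre,
     as [Clog_diff] demands; 10 leaves room for the real part to drop inside the bidisc. *)
  set (X := X1 + Rabs X2 + 64 * K0 + 2 / eta + 10).
  assert (Eeta : 2 / eta = 40000) by (unfold eta; lra).
  exists X. split; [unfold X; lra|]. intros M s HM HI Hs.
  assert (Ceta : forall z, X <= Re z -> 2 <= eta * Cmod z /\ 0 < Re z /\ Cmod (Clog z) <= eta * Cmod z).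
  { intros z Hz. assert (Re z <= Cmod z) by (eapply Rle_trans; [apply Rle_abs|apply re_le_Cmod]).
    unfold X in Hz. rewrite Eeta in Hz.
    split; [unfold eta; lra|]. split; [lra|]. apply L1. lra. }
  destruct (Ceta M HM) as [M1 [M2 M3]].
  set (c1 := (M + 3 / 4 * Clog M)%C).
  assert (Pm : 1 <= Cmod M).
  { eapply Rle_trans; [|eapply Rle_trans; [apply Rle_abs|apply (re_le_Cmod M)]].
    unfold X in HM. lra. }
  assert (Ec1 : Re c1 = Re M + 3 / 4 * ln (Cmod M) /\ Im c1 = Im M + 3 / 4 * Im (Clog M)).
  { unfold c1, Re, Im; simpl. split; field. }
  destruct Ec1 as [Ec1 Ec2].
  assert (L0 : 0 <= ln (Cmod M)) by (rewrite <- ln_1; apply ln_le; lra).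
  assert (Rc1 : X <= Re c1) by lra.
  destruct (Ceta c1 Rc1) as [C1 [C2' C3]].
  assert (Ic1 : Rabs (Im c1) <= K + 2).
  { rewrite Ec2. pose proof (Im_Clog M) as IL. pose proof PI_4. apply Rabs_def2 in IL.
    apply Rabs_le_between in HI. apply Rabs_le. lra. }
  assert (He : forall e v, X - 10 <= Re (fst v) -> 0 < Re (fst v) ->
     Cmod (e (chart v)) <= K0 / Re (uinv (chart v)) -> Cmod (e (chart v)) <= / 64).
  { intros e v Hv Pv H. rewrite chart_uinv in H by trivial. eapply Rle_trans; [exact H|].
    apply Rmult_le_reg_r with (Re (fst v)); trivial. unfold Rdiv. rewrite Rmult_assoc, Rinv_l by lra.
    unfold X in Hv. rewrite Eeta in Hv. lra. }
  split; [|split; [|split]].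
  - intros v [V1 V2]. simpl in V1, V2. fold c1 in V1.
    pose proof (re_le_Cmod (fst v - c1)) as R1. pose proof (im_le_Cmod (fst v - c1)) as R2.
    pose proof (re_le_Cmod (snd v - s)) as R3.
    change (Re (fst v - c1)%C) with (Re (fst v) + - Re c1) in R1.
    change (Im (fst v - c1)%C) with (Im (fst v) + - Im c1) in R2.
    change (Re (snd v - s)%C) with (Re (snd v) + - Re s) in R3.
    assert (A1 : Rabs (Re (fst v) + - Re c1) <= 2) by lra.
    assert (A2 : Rabs (Im (fst v) + - Im c1) <= 2) by lra.
    assert (A3 : Rabs (Re (snd v) + - Re s) <= 2) by lra.
    apply Rabs_le_between in A1, A2, A3, Ic1, Hs.
    assert (RvX : X - 2 <= Re (fst v)) by lra.
    assert (Rv : 0 < Re (fst v)) by (unfold X in RvX; rewrite Eeta in RvX; lra).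
    assert (HB : B (chart v)).
    { apply HX2.
      - unfold X in RvX. rewrite Eeta in RvX. lra.
      - apply Rabs_le. lra.
      - apply Rabs_le. lra. }
    split; trivial. split; trivial.
    destruct (He1 _ HB) as [_ [B1 _]]. destruct (He2 _ HB) as [_ [B2 _]].
    apply He in B1; [|lra|trivial]. apply He in B2; [|lra|trivial].
    split; [|unfold perturb2; lra].
    unfold perturb1. eapply Rle_trans; [apply Cmod_triangle|]. rewrite Cmod_mult, Cmod_opp, Cmod_34.
    pose proof (Clog_diff c1 (fst v) eta C2' Rv ltac:(unfold eta; lra) ltac:(lra)) as D.
    unfold eta in D. simpl fst. fold c1. lra.
  - exact C2'.
  (* The centre M + (3/4) log M is the first iterate towards the solution of U - (3/4) log U = M;
     its defect is bounded here. *)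
  - rewrite Cmod_mult, Cmod_34.
    pose proof (Clog_diff M c1 eta M2 C2' ltac:(unfold eta; lra)) as D.
    replace (c1 - M)%C with (3 / 4 * Clog M)%C in D by (unfold c1; ring).
    rewrite Cmod_mult, Cmod_34 in D.
    assert (Cmod (Clog c1 - Clog M) <= 226 * eta) by (apply D; pose proof (Cmod_ge_0 (Clog M)); lra).
    unfold eta in *. lra.
  (* A priori localisation: M differs from U only by a small fraction of |U|, so log M and log U are
     close and U is near the centre. This brings two points with equal coordinates into one
     polydisc. *)
  - intros v HX HB EM Es. destruct (Ceta (fst v) HX) as [V1 [V2 V3]].
    destruct (He1 _ HB) as [_ [B1 _]]. destruct (He2 _ HB) as [_ [B2 _]].
    apply He in B1; [|lra|trivial]. apply He in B2; [|lra|trivial].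
    unfold psi_local in EM. rewrite chart_uinv in EM by trivial.
    assert (D : Cmod (Clog M - Clog (fst v)) <= 226 * eta).
    { apply Clog_diff; trivial; [unfold eta; lra|]. rewrite <- EM.
      replace (fst v - 3 / 4 * Clog (fst v) + e1 (chart v) - fst v)%C with
        (e1 (chart v) - 3 / 4 * Clog (fst v))%C by ring.
      eapply Rle_trans; [apply Cmod_minus_triangle|]. rewrite Cmod_mult, Cmod_34. lra. }
    split; simpl.
    + fold c1. replace (fst v - c1)%C with (3 / 4 * (Clog (fst v) - Clog M) - e1 (chart v))%C.
      * eapply Rle_lt_trans; [apply Cmod_minus_triangle|].
        rewrite Cmod_mult, Cmod_34, (Cmod_minus_sym (Clog (fst v))). unfold eta in D. lra.
      * unfold c1. rewrite <- EM at 2. ring.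
    + rewrite <- Es. replace (snd v - (snd v + e2 (chart v)))%C with (- e2 (chart v))%C by ring.
      rewrite Cmod_opp. lra.
Qed.

Lemma perturb_diffable c v : B (chart v) -> 0 < Re (fst v) ->
  diffable (perturb1 c) v /\ diffable perturb2 v.
Proof.
  intros HB Hv. pose proof (chart_diffable v Hv) as Dc. split.
  - apply diffable_plus.
    + apply diffable_mult; [apply diffable_const|]. apply diffable_minus; [|apply diffable_const].
      apply diffable_Clog; [apply diffable_fst|trivial].
    + apply (diffable_comp2 e1 chart); trivial. apply He1; trivial.
  - apply (diffable_comp2 e2 chart); trivial. apply He2; trivial.
Qed.

(** * Injectivity and local inverses *)

Lemma GF_iterate n p : iterate G n (iterate F n p) = p.
Proof.
  revert p. induction n as [|n IH]; intros p; [reflexivity|].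
  unfold iterate in *. rewrite (Nat.iter_succ_r n _ G). simpl. rewrite GF. apply IH.
Qed.

Lemma FG_iterate n p : iterate F n (iterate G n p) = p.
Proof.
  revert p. induction n as [|n IH]; intros p; [reflexivity|].
  unfold iterate in *. rewrite (Nat.iter_succ_r n _ F). simpl. rewrite FG. apply IH.
Qed.

Lemma Re_y_mult (a : C) : Re (y * a)%C = - Im y * Im a.
Proof. change (Re (y * a)%C) with (Re y * Re a - Im y * Im a). rewrite Hy. ring. Qed.

(** Both points are moved forward by the same n until their chart coordinates lie in one polydisc,
    where [picard_unique] identifies them; F is invertible, so the original points agree. *)
Lemma psi_tau_injective p q : Om p -> Om q -> psi p = psi q -> tau p = tau q -> p = q.
Proof.
  intros Hp Hq Epsi Etau. set (zeta := psi p) in *.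
  (* These terms bound Im M and Re s0 = log |tau| + Im y Im zeta. Neither depends on n because Re y
     = 0, so X can be fixed before n. *)
  set (K := Rabs (Im zeta) + Rabs (ln (Cmod (tau p))) + Rabs (Im y * Im zeta)).
  destruct (chart_perturbation K) as [X [HX1 HX]].
  destruct (Om_enter p X Hp) as [N1 H1]. destruct (Om_enter q X Hq) as [N2 H2].
  destruct (INR_unbounded (X - Re zeta)) as [N3 H3].
  set (n := (N1 + N2 + N3)%nat).
  destruct (H1 n ltac:(unfold n; lia)) as [Bp Xp]. destruct (H2 n ltac:(unfold n; lia)) as [Bq Xq].
  destruct (psi_tau_eq n p Bp) as [P1 P2]. destruct (psi_tau_eq n q Bq) as [Q1 Q2].
  fold zeta in P1. rewrite <- Epsi in Q1. rewrite <- Etau in Q2.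
  set (p' := iterate F n p) in *. set (q' := iterate F n q) in *.
  set (M := (zeta + INR n)%C).
  assert (EMp : psi_local p' = M) by (unfold M; rewrite P1; ring).
  assert (EMq : psi_local q' = M) by (unfold M; rewrite Q1; ring).
  destruct (chart_surjective p' Bp) as [s Es]. destruct (chart_surjective q' Bq) as [t Et].
  assert (Rp : 0 < Re (uinv p')) by (apply B_Re; trivial).
  assert (Rq : 0 < Re (uinv q')) by (apply B_Re; trivial).
  pose proof (tau_local_chart (uinv p', s) Rp) as Tp. simpl in Tp. rewrite Es, EMp in Tp.
  pose proof (tau_local_chart (uinv q', t) Rq) as Tq. simpl in Tq. rewrite Et, EMq in Tq.
  set (s0 := (s + e2 p')%C).
  (* Equality of tau determines the second chart coordinate of q' only modulo 2 pi i. This choice is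
     the branch with the same S + e2 as for p', and it still represents q'. *)
  set (t' := (s0 - e2 q')%C).
  assert (Et' : chart (uinv q', t') = q').
  { transitivity (chart (uinv q', t)); [|exact Et].
    assert (Ee : Cexp t' = Cexp t).
    { assert (Cexp (s + y * M + e2 p') = Cexp (t + y * M + e2 q'))%C by congruence.
      unfold t', s0. replace (s + e2 p' - e2 q')%C with ((s + y * M + e2 p') - (y * M + e2 q'))%C by ring.
      rewrite Cexp_minus, H, <- Cexp_minus. f_equal. ring. }
    unfold chart; simpl. f_equal; rewrite !Cexp_minus, ?Cexp_opp, Ee; trivial. }
  assert (ImM : Im M = Im zeta) by (unfold M, Im; simpl; ring).
  assert (HM : X <= Re M).
  { change (Re M) with (Re zeta + INR n). unfold n. rewrite !plus_INR.
    pose proof (pos_INR N1). pose proof (pos_INR N2). lra. }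
  assert (Hs0 : Rabs (Re s0) <= K).
  { assert (E : Re s0 = ln (Cmod (tau p)) - Re (y * M)%C).
    { rewrite P2, Tp, Cmod_Cexp, ln_exp. unfold s0, Re; simpl. ring. }
    rewrite E, Re_y_mult, ImM. unfold K.
    replace (ln (Cmod (tau p)) - - Im y * Im zeta) with (ln (Cmod (tau p)) + Im y * Im zeta) by ring.
    pose proof (Rabs_triang (ln (Cmod (tau p))) (Im y * Im zeta)).
    pose proof (Rabs_pos (Im zeta)). lra. }
  assert (HIM : Rabs (Im M) <= K).
  { rewrite ImM. unfold K. pose proof (Rabs_pos (ln (Cmod (tau p)))).
    pose proof (Rabs_pos (Im y * Im zeta)). lra. }
  destruct (HX M s0 HM HIM Hs0) as [A1 [_ [_ A3]]].
  set (c := (M + 3 / 4 * Clog M, s0)%C) in *.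
  assert (Ip : polydisc c 1 (uinv p', s)).
  { apply A3; simpl; rewrite ?Es; trivial. }
  assert (Iq : polydisc c 1 (uinv q', t')).
  { apply A3; simpl; rewrite ?Et'; trivial. unfold t'. ring. }
  assert (E : (uinv p', s) = (uinv q', t')).
  { apply (picard_unique c (perturb1 c) perturb2); trivial.
    - intros v Hv. destruct (A1 v Hv) as [? [? _]]. apply perturb_diffable; trivial.
    - intros v Hv. destruct (A1 v Hv) as [? [? _]]. apply (perturb_diffable c); trivial.
    - intros v Hv. apply A1; trivial.
    - intros v Hv. apply A1; trivial.
    - unfold perturb1; simpl fst. rewrite Es, Et'.
      transitivity (psi_local p' + 3 / 4 * Clog (M + 3 / 4 * Clog M))%C; [unfold psi_local; ring|].
      rewrite EMp, <- EMq. unfold psi_local at 1. ring_simplify. unfold psi_local. ring.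
    - unfold perturb2; simpl snd. rewrite Es, Et'. unfold t', s0. ring. }
  assert (E' : p' = q') by (transitivity (chart (uinv p', s)); [symmetry; exact Es|rewrite E; exact Et']).
  rewrite <- (GF_iterate n p), <- (GF_iterate n q). fold p' q'. rewrite E'. trivial.
Qed.

(** The target is translated by n into the range of the chart estimates, solved there by [picard],
    and brought back by the n-th iterate of G; psi and tau undo exactly this shift. *)
Lemma local_inverse (q0 : C2) : snd q0 <> RtoC 0 -> exists (r : R) (h : C2 -> C2), 0 < r /\ diffable2 h q0 /\
  forall q, polydisc q0 r q -> Om (h q) /\ psi (h q) = fst q /\ tau (h q) = snd q.
Proof.
  intros Nq0. destruct (Cexp_surj (snd q0) Nq0) as [th Hth].
  set (zeta := fst q0).
  set (K := Rabs (Im zeta) + Rabs (Re th) + Rabs (Im y * Im zeta)).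
  destruct (chart_perturbation K) as [X [HX1 HX]].
  destruct (INR_unbounded (X - Re zeta)) as [n Hn].
  set (M := (zeta + INR n)%C). set (s0 := (th - y * M)%C).
  assert (ImM : Im M = Im zeta) by (unfold M, Im; simpl; ring).
  assert (HM : X <= Re M) by (change (Re M) with (Re zeta + INR n); lra).
  assert (Hs0 : Rabs (Re s0) <= K).
  { change (Re s0) with (Re th + - Re (y * M)%C). rewrite Re_y_mult, ImM. unfold K.
    replace (Re th + - (- Im y * Im zeta)) with (Re th + Im y * Im zeta) by ring.
    pose proof (Rabs_triang (Re th) (Im y * Im zeta)). pose proof (Rabs_pos (Im zeta)). lra. }
  assert (HIM : Rabs (Im M) <= K).
  { rewrite ImM. unfold K. pose proof (Rabs_pos (Re th)).
    pose proof (Rabs_pos (Im y * Im zeta)). lra. }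
  destruct (HX M s0 HM HIM Hs0) as [A1 [A2 [A3 _]]].
  set (c1 := (M + 3 / 4 * Clog M)%C) in *. set (c := (c1, s0)) in *.
  destruct (picard c (perturb1 c) perturb2) as [V1 [V2 HV]].
  { intros v Hv. destruct (A1 v Hv) as [? [? _]]. apply perturb_diffable; trivial. }
  { intros v Hv. destruct (A1 v Hv) as [? [? _]]. apply (perturb_diffable c); trivial. }
  { intros v Hv. apply A1; trivial. }
  { intros v Hv. apply A1; trivial. }
  (* The right-hand side of the Picard equation: (3/4) log c1 restores the constant removed in
     [perturb1], and the second entry is log tau - y psi, with the branch of log tau near q0 that
     equals [th] there. Its value at q0 is within 1/4 of the centre, leaving 1/4 for nearby q inside
     the Picard radius 1/2. *)
  set (A := fun q : C2 => (fst q + INR n + 3 / 4 * Clog c1,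
    th + Clog (snd q / snd q0) - y * (fst q + INR n))%C).
  assert (E1 : (snd q0 / snd q0)%C = 1) by (field; trivial).
  assert (Dq : diffable (fun q => snd q / snd q0)%C q0).
  { apply diffable_mult; [apply diffable_snd|apply diffable_const]. }
  assert (DA : diffable2 A q0).
  { split; simpl.
    - apply diffable_plus; [|apply diffable_const].
      apply diffable_plus; [apply diffable_fst|apply diffable_const].
    - apply diffable_minus.
      + apply diffable_plus; [apply diffable_const|]. apply diffable_Clog; trivial.
        rewrite E1. simpl. lra.
      + apply diffable_mult; [apply diffable_const|].
        apply diffable_plus; [apply diffable_fst|apply diffable_const]. }
  assert (A0 : polydisc c (/ 4) (A q0)).
  { split; simpl.
    - fold zeta M.
      replace (M + 3 / 4 * Clog c1 - c1)%C with (3 / 4 * (Clog c1 - Clog M))%C by (unfold c1; ring).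
      lra.
    - rewrite E1, Clog_1. fold zeta M.
      replace (th + 0 - y * M - s0)%C with (RtoC 0) by (unfold s0; ring). rewrite Cmod_0. lra. }
  destruct (diffable2_continuous A q0 (/ 4) DA ltac:(lra)) as [d1 [Hd1 B1]].
  destruct (contR_pos_open (fun _ => 0) _ q0 (contR_const 0 q0) (contR_re _ q0 Dq)) as [d2 [Hd2 B2]].
  { rewrite E1. simpl. lra. }
  assert (HA : forall q, polydisc q0 d1 q -> polydisc c (/ 2) (A q)).
  { intros q Hq. apply (polydisc_incl c (/ 4) (A q0) (/ 4)); auto; lra. }
  exists (Rmin d1 d2), (fun q => iterate G n (chart (V1 (A q), V2 (A q)))).
  split; [apply Rmin_glb_lt; trivial|]. split.
  - assert (Hq0 : polydisc c (/ 2) (A q0)) by (apply HA, polydisc_center; trivial).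
    destruct (HV _ Hq0) as [W0 [_ [_ [D1 D2]]]].
    assert (Rv : 0 < Re (fst (V1 (A q0), V2 (A q0)))).
    { apply A1. destruct W0; split; lra. }
    apply (diffable2_comp (iterate G n) (fun q => chart (V1 (A q), V2 (A q)))).
    + apply (diffable2_comp chart (fun q => (V1 (A q), V2 (A q)))).
      * split; simpl; [apply (diffable_comp2 V1 A)|apply (diffable_comp2 V2 A)]; trivial.
      * apply chart_diffable; trivial.
    + apply diffable2_iterate; trivial.
  - intros q Hq.
    assert (Hq1 : polydisc q0 d1 q) by (destruct Hq; pose proof (Rmin_l d1 d2); split; lra).
    assert (Hq2 : polydisc q0 d2 q) by (destruct Hq; pose proof (Rmin_r d1 d2); split; lra).
    specialize (B2 q Hq2). simpl in B2.
    destruct (HV _ (HA q Hq1)) as [W0 [W1 [W2 _]]].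
    set (v := (V1 (A q), V2 (A q))) in *.
    destruct (A1 v) as [HB [Rv _]]; [destruct W0; split; lra|].
    assert (Eit : iterate F n (iterate G n (chart v)) = chart v) by apply FG_iterate.
    assert (HB' : B (iterate F n (iterate G n (chart v)))) by (rewrite Eit; trivial).
    split; [apply (Om_B n); trivial|].
    destruct (psi_tau_eq n _ HB') as [P1 P2]. rewrite P1, P2, Eit.
    assert (EM : psi_local (chart v) = (fst q + INR n)%C).
    { unfold psi_local. rewrite chart_uinv by trivial.
      unfold perturb1 in W1. simpl fst in W1.
      transitivity (V1 (A q) + (- (3 / 4) * (Clog (V1 (A q)) - Clog c1) + e1 (chart v)) - 3 / 4 * Clog c1)%C.
      - unfold v at 1 2; simpl fst. ring.
      - rewrite W1. ring. }
    split.
    + rewrite EM. ring.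
    + rewrite tau_local_chart, EM by trivial. unfold perturb2 in W2. simpl snd in W2.
      transitivity (Cexp (th + Clog (snd q / snd q0))).
      * f_equal. unfold v at 1; simpl snd.
        transitivity (V2 (A q) + e2 (chart v) + y * (fst q + INR n))%C; [ring|].
        rewrite W2. ring.
      * rewrite Cexp_plus, Cexp_Clog, Hth by exact B2. field. trivial.
Qed.

Lemma Fatou_coordinates : exists Psi : C2 -> C2, biholomorphic Om C_times_Cstar Psi /\
  forall p, Om p -> Psi (F p) = translation (Psi p).
Proof.
  exists (fun p => (psi p, tau p)). split.
  (* The global inverse is chosen pointwise, with no regularity; injectivity later makes it coincide
     locally with the holomorphic inverses. *)
  - assert (L : forall q : C2, exists p : C2, snd q <> RtoC 0 -> Om p /\ psi p = fst q /\ tau p = snd q).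
    { intros q. destruct (classic (snd q = RtoC 0)) as [E|N].
      - exists q. intros; contradiction.
      - destruct (local_inverse q N) as [r [h [Hr [_ Hh]]]].
        exists (h q). intros _. apply Hh, polydisc_center; trivial. }
    set (g := fun q => proj1_sig (constructive_indefinite_description _ (L q))).
    assert (Hg : forall q : C2, snd q <> RtoC 0 -> Om (g q) /\ psi (g q) = fst q /\ tau (g q) = snd q).
    { intros q. unfold g. destruct (constructive_indefinite_description _ (L q)); trivial. }
    clearbody g. clear L. exists g.
    split; [|split; [|split; [|split; [|split]]]].
    + apply holomorphic_on_diffable2. split; trivial. intros p Hp.
      destruct (psi_tau_diffable p Hp). split; trivial.
    + apply holomorphic_on_diffable2. split.
      * apply open_polydisc. intros p Hp. pose proof (proj1 (Cmod_gt_0 _) Hp) as P.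
        destruct (contR_pos_open _ _ p (contR_const 0 p) (contR_Cmod _ p (diffable_snd p)) P)
          as [d [Hd Hq]].
        exists d. split; trivial. intros q Q. apply Cmod_gt_0. exact (Hq q Q).
      * intros q Hq. destruct (local_inverse q Hq) as [r [h [Hr [[D1 D2] Hh]]]].
        pose proof (proj1 (Cmod_gt_0 _) Hq) as P.
        destruct (contR_pos_open _ _ q (contR_const 0 q) (contR_Cmod _ q (diffable_snd q)) P)
          as [d [Hd Hn]].
        (* Both preimages lie in the basin and have the same psi and tau. The radius [d] keeps the
           second coordinate nonzero, where g is specified. *)
        assert (E : forall x, polydisc q (Rmin r d) x -> h x = g x).
        { intros x [X1 X2]. pose proof (Rmin_l r d). pose proof (Rmin_r r d).
          assert (Nx : snd x <> 0) by (apply Cmod_gt_0, Hn; split; lra).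
          destruct (Hg x Nx) as [G1 [G2 G3]]. destruct (Hh x) as [H1 [H2 H3]]; [split; lra|].
          apply psi_tau_injective; trivial; congruence. }
        split.
        -- apply (diffable_ext_loc (fun x => fst (h x))); trivial.
           exists (Rmin r d). split; [apply Rmin_glb_lt; trivial|]. intros x Hx. rewrite E; trivial.
        -- apply (diffable_ext_loc (fun x => snd (h x))); trivial.
           exists (Rmin r d). split; [apply Rmin_glb_lt; trivial|]. intros x Hx. rewrite E; trivial.
    + intros p Hp. apply tau_neq_0; trivial.
    + intros q Hq. apply Hg; trivial.
    + intros p Hp. destruct (Hg (psi p, tau p)) as [G1 [G2 G3]]; [apply tau_neq_0; trivial|].
      apply psi_tau_injective; trivial.
    + intros q Hq. destruct (Hg q Hq) as [_ [G2 G3]]. rewrite G2, G3. symmetry. apply surjective_pairing.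
  - intros p Hp. destruct (psi_tau_F p Hp) as [E1 E2]. rewrite E1, E2. reflexivity.
Qed.

End Coordinates.

(** * From the local basin to the blow-up *)

Lemma converges_polydisc (u : nat -> C2) (p : C2) :
  filterlim u eventually (@locally C2_NM p) ->
  forall d, 0 < d -> exists N : nat, forall n, (N <= n)%nat -> polydisc p d (u n).
Proof.
  intros H d Hd. apply (H (polydisc p d)). apply locally_polydisc. exists d. auto.
Qed.

Lemma basin_coordinates lam l theta0 beta0 Fc Om r0 : Cmod lam = 1 -> has_expansion lam l Fc ->
  0 < theta0 < PI / 2 -> 0 < beta0 < 1 / 2 -> beta0 * INR (l + 1) >= 4 -> 0 < r0 ->
  automorphism Fc -> @open C2_NM Om -> orbits_converge_to Fc Om origin ->
  (forall p, Bcheck r0 theta0 beta0 p -> Bcheck r0 theta0 beta0 (Fc p)) ->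
  (forall p, Om p <-> exists n : nat, Bcheck r0 theta0 beta0 (iterate Fc n p)) ->
  exists Psi, biholomorphic Om C_times_Cstar Psi /\
    forall p, Om p -> Psi (Fc p) = translation (Psi p).
Proof.
  intros Hlam Hexp Hth Hb Hbl Hr0 [G [HF [HG [_ [_ [GF FG]]]]]] HOpen Hlim Hinv HOm.
  apply holomorphic_on_diffable2 in HF. apply holomorphic_on_diffable2 in HG.
  assert (DF : forall p, diffable2 Fc p) by (intros p; apply HF; exact I).
  assert (DG : forall p, diffable2 G p) by (intros p; apply HG; exact I).
  destruct (region_step lam l Fc theta0 beta0 r0 Hlam Hexp Hth Hb Hbl Hr0 Hinv)
    as [rho [K [Hrho [Hrho0 [HK Step]]]]].
  assert (Nlam : lam <> 0) by (apply Cmod_gt_0; lra).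
  destruct (Cexp_surj lam Nlam) as [y Ey].
  (* This is where |lam| = 1 enters the coordinates: |exp (y psi)| depends only on Im psi and is
     unchanged by translation. *)
  assert (Hy : Re y = 0).
  { apply exp_inv. rewrite <- Cmod_Cexp, Ey, exp_0. trivial. }
  set (B := region theta0 beta0 rho) in *.
  assert (B_neq : forall p, B p -> (fst p * snd p)%C <> 0 /\ 1 <= Re (uinv p)).
  { intros p [N [H _]]. split; [trivial|lra]. }
  assert (B_inv : forall p, B p -> B (Fc p)) by (intros p Hp; apply Step; trivial).
  assert (B_open : forall p, B p -> exists r, 0 < r /\ forall q, polydisc p r q -> B q).
  { intros p. apply region_open. }
  assert (DU : forall p, B p -> diffable uinv p).
  { intros p Hp. apply uinv_diffable, B_neq; trivial. }
  assert (DU1 : forall p, B p -> diffable (fun q => uinv (Fc q)) p).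
  { intros p Hp. apply (diffable_comp2 uinv Fc); auto. }
  assert (DL : forall p, B p -> diffable (fun q => Clog (uinv (Fc q)) - Clog (uinv q))%C p).
  { intros p Hp. destruct (B_neq p Hp). destruct (B_neq _ (B_inv p Hp)).
    apply diffable_minus; apply diffable_Clog; auto; lra. }
  destruct (coboundary Fc B (fun p => Re (uinv p))
    (fun p => uinv (Fc p) - uinv p - 1 - 3 / 4 * (Clog (uinv (Fc p)) - Clog (uinv p)))%C K)
    as [e1 He1]; trivial.
  { intros p Hp. split; [auto|]. apply Step; trivial. }
  { intros p Hp. apply B_neq; trivial. }
  { intros p Hp. split; [|apply Step; trivial].
    apply diffable_minus; [|apply diffable_mult; [apply diffable_const|auto]].
    apply diffable_minus; [|apply diffable_const]. apply diffable_minus; auto. }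
  destruct (coboundary Fc B (fun p => Re (uinv p))
    (fun p => Clog (lam * snd (Fc p) / snd p) + 1 / 2 * (Clog (uinv (Fc p)) - Clog (uinv p)))%C K)
    as [e2 He2]; trivial.
  { intros p Hp. split; [auto|]. apply Step; trivial. }
  { intros p Hp. apply B_neq; trivial. }
  { intros p Hp. destruct (Step p Hp) as [_ [_ [S1 [_ S2]]]]. split; [|exact S2].
    apply diffable_plus; [|apply diffable_mult; [apply diffable_const|auto]].
    apply diffable_Clog; [|exact S1].
    apply diffable_mult; [apply diffable_mult; [apply diffable_const|apply DF]|].
    apply diffable_inv; [apply diffable_snd|]. intros E. apply (B_neq p Hp). rewrite E. ring. }
  rewrite <- Ey in He2.
  apply (Fatou_coordinates Fc G Om B y e1 e2 (4 * K)); trivial; try lra.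
  - intros p. apply FG. exact I.
  - intros p. apply GF. exact I.
  - intros n p Hp. apply HOm. exists n. apply (Bcheck_of_region r0 rho); trivial.
  - intros p X Hp. destruct (proj1 (HOm p) Hp) as [n0 Hn0].
    assert (HBn : forall n, (n0 <= n)%nat -> Bcheck r0 theta0 beta0 (iterate Fc n p)).
    { intros n L. induction L as [|n L IH]; [trivial|].
      change (iterate Fc (S n) p) with (Fc (iterate Fc n p)). auto. }
    set (Y := Rabs X + rho + 1).
    pose proof (Rabs_pos X) as PX. pose proof (Rle_abs X) as AX.
    assert (Pc : 0 < cos theta0) by (apply cos_gt_0; lra).
    (* If |z| and |w| are below d <= 1, then |zw| <= cos theta0/Y, and the sector bound Re U >= cos
       theta0/|zw| gives Re U >= Y. *)
    set (d := Rmin 1 (cos theta0 / Y)).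
    assert (Hd : 0 < d) by (apply Rmin_glb_lt; [lra|apply Rdiv_lt_0_compat; unfold Y; lra]).
    destruct (converges_polydisc _ _ (Hlim p Hp) d Hd) as [N HN].
    exists (N + n0)%nat. intros n Hn.
    destruct (HN n ltac:(lia)) as [Z1 Z2]. pose proof (HBn n ltac:(lia)) as HB.
    set (q := iterate Fc n p) in *.
    destruct (Bcheck_sector _ _ _ _ Hth HB) as [Nq [_ Sq]].
    assert (R : Y <= Re (uinv q)).
    { pose proof (proj1 (Cmod_gt_0 _) Nq) as Pq.
      simpl in Z1, Z2. replace (fst q - 0)%C with (fst q) in Z1 by ring.
      replace (snd q - 0)%C with (snd q) in Z2 by ring.
      assert (d <= 1) by apply Rmin_l. assert (d <= cos theta0 / Y) by apply Rmin_r.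
      assert (Hu : Cmod (fst q * snd q) <= cos theta0 / Y).
      { rewrite Cmod_mult. pose proof (Cmod_ge_0 (fst q)). pose proof (Cmod_ge_0 (snd q)). nra. }
      eapply Rle_trans; [|exact Sq]. apply Rmult_le_reg_r with (Cmod (fst q * snd q)); trivial.
      rewrite Rmult_assoc, Rinv_l, Rmult_1_r by lra.
      apply Rmult_le_compat_l with (r := Y) in Hu; [|unfold Y; lra].
      replace (Y * (cos theta0 / Y)) with (cos theta0) in Hu by (field; unfold Y; lra). trivial. }
    split; [|unfold Y in R; lra].
    apply (region_of_Bcheck r0); trivial. unfold Y in R. lra.
  - intros K'. apply chart_region; trivial.
  - intros p Hp. rewrite Ey. apply Step; trivial.
Qed.

Theorem corollary4p7
  (lam : C) (Hlam : Cmod lam = 1) (HBrjuno : Brjuno lam)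
  (l : nat) (Hl : (4 <= l)%nat)
  (theta0 : R) (Htheta0 : 0 < theta0 < PI / 2)
  (beta0 : R) (Hbeta0 : 0 < beta0 < 1 / 2) (Hbeta0l : beta0 * INR (l + 1) >= 4)
  (Fcheck : C2 -> C2)
  (HFcheck : automorphism Fcheck)
  (HFcheck_exp : has_expansion lam l Fcheck)
  (HFcheck_axis : forall z : C, Fcheck (z, RtoC 0) = ((lam * z)%C, RtoC 0))
  (Omegacheck : C2 -> Prop)
  (HOmega_Fatou : Fatou_component Fcheck Omegacheck)
  (HOmega_inv : invariant Fcheck Omegacheck)
  (HOmega_nonrec : non_recurrent Fcheck Omegacheck)
  (HOmega_bihol : exists Phi : C2 -> C2, biholomorphic Omegacheck C_times_Cstar Phi)
  (HOmega_lim : orbits_converge_to Fcheck Omegacheck origin)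
  (r0 : R) (Hr0 : 0 < r0)
  (HB_inv : forall p : C2, Bcheck r0 theta0 beta0 p -> Bcheck r0 theta0 beta0 (Fcheck p))
  (HB_unif : orbits_converge_uniformly_to Fcheck (Bcheck r0 theta0 beta0) origin)
  (HOmega_B : forall p : C2,
     Omegacheck p <-> exists n : nat, Bcheck r0 theta0 beta0 (iterate Fcheck n p))
  (F : C2 -> C2)
  (HF : automorphism F)
  (HF_lift : forall p : C2, blowup (F p) = Fcheck (blowup p))
  (HF_axis : forall x : C, F (x, RtoC 0) = ((lam ^ 2 * x)%C, RtoC 0))
  (Omega : C2 -> Prop)
  (HOmega : forall p : C2, Omega p <-> Omegacheck (blowup p)) :
  exists Psi : C2 -> C2,
    biholomorphic Omega C_times_Cstar Psi /\
    forall p : C2, Omega p -> Psi (F p) = translation (Psi p).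
Proof.
  (* Openness is read off the known biholomorphism, since [holomorphic_on] includes it. *)
  assert (HOpen : @open C2_NM Omegacheck).
  { destruct HOmega_bihol as [Phi [g [[H _] _]]]. exact H. }
  assert (Nsnd : forall p, Omegacheck p -> snd p <> 0).
  { intros [z w] Hp E. simpl in E. subst w.
    destruct (proj1 (HOmega_B _) Hp) as [n Hn].
    assert (En : snd (iterate Fcheck n (z, RtoC 0)) = 0).
    { clear Hn. induction n as [|n IH]; [reflexivity|].
      change (iterate Fcheck (S n) (z, RtoC 0)) with (Fcheck (iterate Fcheck n (z, RtoC 0))).
      rewrite (surjective_pairing (iterate Fcheck n (z, RtoC 0))), IH, HFcheck_axis. reflexivity. }
    apply (Bcheck_sector _ _ _ _ Htheta0 Hn). rewrite En. ring. }
  destruct (basin_coordinates lam l theta0 beta0 Fcheck Omegacheck r0) as [Psi [HPsi Hconj]]; trivial.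
  destruct HPsi as [g [Psi_hol [g_hol [Psi_in [g_in [gPsi Psig]]]]]].
  apply holomorphic_on_diffable2 in Psi_hol. apply holomorphic_on_diffable2 in g_hol.
  assert (Dbl : forall p, diffable2 blowup p).
  { intros p. split; simpl; [apply diffable_mult; [apply diffable_fst|apply diffable_snd]|apply diffable_snd]. }
  assert (Ebl : forall p : C2, snd p <> RtoC 0 -> blowup (fst p / snd p, snd p)%C = p).
  { intros [z w] N. unfold blowup; simpl in *. f_equal. field. trivial. }
  exists (fun p => Psi (blowup p)). split.
  (* The inverse of the blow-up, (z, w) |-> (z/w, w), composed with the inverse on the basin, where
     w is nonzero. *)
  - exists (fun q => (fst (g q) / snd (g q), snd (g q))%C).
    split; [|split; [|split; [|split; [|split]]]].
    + apply holomorphic_on_diffable2. split.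
      * apply open_polydisc. intros p Hp. apply HOmega in Hp.
        destruct (proj1 (open_polydisc _) HOpen _ Hp) as [r [Hr Hin]].
        destruct (diffable2_continuous blowup p r (Dbl p) Hr) as [d [Hd Hc]].
        exists d. split; trivial. intros q Hq. apply HOmega. auto.
      * intros p Hp. apply (diffable2_comp Psi blowup); trivial. apply Psi_hol, HOmega; trivial.
    + apply holomorphic_on_diffable2. split; [apply g_hol|].
      intros q Hq. destruct (proj2 g_hol q Hq) as [D1 D2]. split; simpl; trivial.
      apply diffable_mult; trivial. apply diffable_inv; trivial. apply Nsnd, g_in; trivial.
    + intros p Hp. apply Psi_in, HOmega; trivial.
    + intros q Hq. apply HOmega. rewrite Ebl by (apply Nsnd, g_in; trivial). apply g_in; trivial.
    + intros p Hp. apply HOmega in Hp. rewrite gPsi by trivial.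
      pose proof (Nsnd _ Hp) as N. destruct p as [x y]. unfold blowup in *; simpl in *.
      f_equal. field. trivial.
    + intros q Hq. rewrite Ebl by (apply Nsnd, g_in; trivial). apply Psig; trivial.
  - intros p Hp. rewrite HF_lift. apply Hconj, HOmega; trivial.
Qed.
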